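(* Let $T=\prod_{i=1}^N[a_i,b_i]\subset\mathbb{R}^N$ with $-\infty<a_i<b_i<\infty$, and let $\{X(t),\,t\in T\}$ be a centered real-valued Gaussian random field with the following two properties. Smoothness: $X\in C^2(\mathbb{R}^N)$ almost surely and there exist constants $C,\delta>0$ such that $\mathbb{E}(X_{ij}(t)-X_{ij}(t'))^2\le C\|t-t'\|^{2\delta}$ for all $t,t'\in T$, $i,j=1,\dots,N$. Regularity: for every pair $(t,t')\in T^2$ with $t\ne t'$, the Gaussian vector $(X(t),\nabla X(t),X_{ij}(t),X(t'),\nabla X(t'),X_{ij}(t'),\ 1\le i\le j\le N)$ is non-degenerate. Suppose $\nu$ attains its maximum $\sigma_T^2$ over $T$ only at $t^*\in K\in\partial_kT$, that $\nu_i(t^* )\ne0$ for all $i\notin\tau(K)$, and that $\nabla^2\nu_{|K}(t^* )\prec0$. Then, as $u\to\infty$: if $k=0$, $$ \mathbb{P}\Big\{\sup_{t\in T}X(t)\ge u\Big\}=\Psi\Big(\frac{u}{\sigma_T}\Big)+o\Big(\exp\Big\{-\frac{u^2}{2\sigma_T^2}-\alpha u^2\Big\}\Big)\quad\text{for some }\alpha>0; $$ and if $k\ge1$, $$ \mathbb{P}\Big\{\sup_{t\in T}X(t)\ge u\Big\}=\sqrt{\frac{\det(\Sigma_K(t^* ))}{\det(\Lambda_K(t^* )+\Sigma_K(t^* ))}}\;\Psi\Big(\frac{u}{\sigma_T}\Big)(1+o(1)). $$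
   Context: Variance: $\nu(t)=\mathrm{Var}(X(t))$ and $\sigma_T^2=\sup_{t\in T}\nu(t)$. Subscripts denote partial derivatives: $X_i=\partial X/\partial t_i$, $X_{ij}=\partial^2X/\partial t_i\partial t_j$, and similarly $\nu_i$, $\nu_{ij}$. For a symmetric matrix $B$, $B\prec0$ means negative definite. $\Psi(x)=\int_x^\infty\phi(y)\,dy$, where $\phi$ is the standard normal density. Faces: a face $K$ of $T$ of dimension $k$ ($0\le k\le N$) is determined by a subset $\tau(K)\subset\{1,\dots,N\}$ of size $k$ and numbers $\varepsilon(K)=\{\varepsilon_j\in\{0,1\}:j\notin\tau(K)\}$, via $K=\{t\in T: a_j<t_j<b_j\text{ if }j\in\tau(K),\ t_j=(1-\varepsilon_j)a_j+\varepsilon_jb_j\text{ if }j\notin\tau(K)\}$. $\partial_kT$ is the collection of all $k$-dimensional faces. $\nabla^2\nu_{|K}(t)=(\nu_{ij}(t))_{i,j\in\tau(K)}$ (the condition on it is void when $k=0$), $\Sigma_K(t)=(\mathbb{E}\{X(t)X_{ij}(t)\})_{i,j\in\tau(K)}$, $\Lambda_K(t)=(\mathbb{E}\{X_i(t)X_j(t)\})_{i,j\in\tau(K)}$. (H1) $X\in C^2(\mathbb{R}^N)$ almost surely and there exist constants $C,\delta>0$ such that $\mathbb{E}(X_{ij}(t)-X_{ij}(t'))^2\le C\|t-t'\|^{2\delta}$ for all $t,t'\in T$, $i,j=1,\dots,N$. (H2) For every pair $(t,t')\in T^2$ with $t\ne t'$, the Gaussian vector $(X(t),\nabla X(t),X_{ij}(t),X(t'),\nabla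 X(t'),X_{ij}(t'),\ 1\le i\le j\le N)$ is non-degenerate. *)

(* Defs.v *)
From HB Require Import structures.
From mathcomp Require Import all_boot all_order all_algebra.
From mathcomp Require Import all_classical all_reals all_analysis.

Set Implicit Arguments.
Unset Strict Implicit.
Unset Printing Implicit Defensive.

Import Order.TTheory GRing.Theory Num.Theory.
Import numFieldNormedType.Exports.

Local Open Scope classical_set_scope.
Local Open Scope ring_scope.

Section Calculus.
Context {R : realType} {N : nat}.
Implicit Types (f : 'rV[R]_N -> R) (t : 'rV[R]_N).

Definition basis (i : 'I_N) : 'rV[R]_N := delta_mx 0 i.

Definition partial f (i : 'I_N) t : R := 'D_(basis i) f t.

Definition partial2 f (i j : 'I_N) t : R := partial (partial f j) i t.

Definition C2 f : Prop :=
  [/\ continuous f,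
      forall i, (forall t, derivable f t (basis i)) /\ continuous (partial f i)
    & forall i j, (forall t, derivable (partial f j) t (basis i)) /\
                  continuous (partial2 f i j)].

(* Partial derivative of a function that is only meaningful on [D]: the
   increment [h] is restricted to [t + h e_i \in D]. It is the usual partial
   derivative when [t + h e_i \in D] for all small [h], and the one-sided one
   when [D] is a box and [t_i] is an end point of its [i]-th side. *)
Definition partial_in (D : set 'rV[R]_N) f (i : 'I_N) t : R :=
  lim ((fun h : R => h^-1 * (f (t + h *: basis i) - f t)) @
       within [set h | D (t + h *: basis i)] 0^').

Definition partial2_in (D : set 'rV[R]_N) f (i j : 'I_N) t : R :=
  partial_in D (partial_in D f j) i t.

Definition euclidean_norm t : R := Num.sqrt (\sum_(i < N) t 0 i ^+ 2).

Definition box (a b : 'rV[R]_N) : set 'rV[R]_N :=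
  [set t | forall i, a 0 i <= t 0 i <= b 0 i].

(* Only the values of [eps] outside [tau] matter. *)
Definition face (a b : 'rV[R]_N) (tau : {set 'I_N}) (eps : 'I_N -> bool) :
    set 'rV[R]_N :=
  [set t | [/\ box a b t,
     forall j, j \in tau -> a 0 j < t 0 j < b 0 j
   & forall j, j \notin tau ->
       t 0 j = (1 - (eps j)%:R) * a 0 j + (eps j)%:R * b 0 j]].

Definition submatrix_on (tau : {set 'I_N}) (F : 'I_N -> 'I_N -> R) :
    'M[R]_#|tau| :=
  \matrix_(i, j) F (enum_val i) (enum_val j).

End Calculus.

Definition negative_definite {R : realType} {n : nat} (B : 'M[R]_n) : Prop :=
  B^T = B /\ forall v : 'rV[R]_n, v != 0 -> (v *m B *m v^T) 0 0 < 0.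

Section Probability.
Context {R : realType} {d : measure_display} {Om : measurableType d}.
Variable P : probability Om R.

(* [P] evaluated on events that are measurable only up to a null set (the
   supremum of an almost surely continuous field): on the completion of [P],
   the outer measure is the completed probability. *)
Definition Prob (A : set Om) : R := fine (mu_ext P A).

Lemma ProbE (A : set Om) : measurable A -> Prob A = fine (P A).
Proof. by move=> mA; rewrite /Prob measurable_mu_extE. Qed.

(* [normal_prob m 0] is not the Dirac mass at [m] in the library, hence the
   separate clause for degenerate Gaussian laws. *)
Definition gaussian (Y : Om -> R) : Prop :=
  measurable_fun setT Y /\
  exists m : R,
    (forall A, measurable A -> pushforward P Y A = \d_m A) \/
    (exists s : R, 0 < s /\
       forall A, measurable A -> pushforward P Y A = normal_prob m s A).

Definition centered_gaussian_field {I : Type} (D : set I) (X : I -> Om -> R) :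
    Prop :=
  (forall (n : nat) (c : 'I_n -> R) (t : 'I_n -> I), (forall j, D (t j)) ->
     gaussian (fun w => \sum_(j < n) c j * X (t j) w)) /\
  (forall t, D t -> ('E_P[X t] = 0)%E).

Definition covariance_matrix (Y : seq (Om -> R)) : 'M[R]_(size Y) :=
  \matrix_(i, j) fine (covariance P (nth (cst 0) Y i) (nth (cst 0) Y j)).

Definition nondegenerate (Y : seq (Om -> R)) : Prop :=
  covariance_matrix Y \in unitmx.

Section Field.
Context {N : nat}.
Variable X : 'rV[R]_N -> Om -> R.

(* On the null set where the path is not C2, these take junk values, which do
   not affect the moments below. *)
Definition Xd (i : 'I_N) (t : 'rV[R]_N) : Om -> R :=
  fun w => partial (fun s => X s w) i t.

Definition Xdd (i j : 'I_N) (t : 'rV[R]_N) : Om -> R :=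
  fun w => partial2 (fun s => X s w) i j t.

Definition jet2 (t : 'rV[R]_N) : seq (Om -> R) :=
  X t :: [seq Xd i t | i <- enum 'I_N]
  ++ [seq Xdd p.1 p.2 t
     | p : 'I_N * 'I_N <- enum {: 'I_N * 'I_N} & (p.1 <= p.2)%N].

Definition smooth_on (D : set 'rV[R]_N) : Prop :=
  {ae P, forall w, C2 (fun s => X s w)} /\
  exists C delta : R, [/\ 0 < C, 0 < delta &
    forall t t', D t -> D t' -> forall i j : 'I_N,
      ('E_P[(fun w => (Xdd i j t w - Xdd i j t' w) ^+ 2)%R] <=
       (C * euclidean_norm (t - t')%R `^ (2 * delta))%R%:E)%E].

Definition regular_on (D : set 'rV[R]_N) : Prop :=
  forall t t', D t -> D t' -> t != t' -> nondegenerate (jet2 t ++ jet2 t').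

Definition nu (t : 'rV[R]_N) : R := fine ('V_P[X t])%E.

Definition sigma2 (D : set 'rV[R]_N) : R := sup [set nu t | t in D].

Definition sigma (D : set 'rV[R]_N) : R := Num.sqrt (sigma2 D).

Definition hess_nu (D : set 'rV[R]_N) (tau : {set 'I_N}) (t : 'rV[R]_N) :
    'M[R]_#|tau| :=
  submatrix_on tau (fun i j => partial2_in D nu i j t).

Definition Sigma_mx (tau : {set 'I_N}) (t : 'rV[R]_N) : 'M[R]_#|tau| :=
  submatrix_on tau (fun i j => fine ('E_P[(fun w => X t w * Xdd i j t w)%R])%E).

Definition Lambda_mx (tau : {set 'I_N}) (t : 'rV[R]_N) : 'M[R]_#|tau| :=
  submatrix_on tau (fun i j => fine ('E_P[(fun w => Xd i t w * Xd j t w)%R])%E).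

Definition excursion_prob (D : set 'rV[R]_N) (u : R) : R :=
  Prob [set w | (u%:E <= ereal_sup [set (X t w)%:E | t in D])%E].

End Field.
End Probability.

Definition Psi {R : realType} (x : R) : R :=
  \int[lebesgue_measure]_(y in `[x, +oo[) normal_pdf 0 1 y.

(* Main.v *)
(* Off events of probability O(exp(-(1/(2 sigma^2) + alpha) u^2)), the supremum
   exceeds u if and only if its quadratic model at ts does. Write X0 = X(ts),
   G for the gradient of X at ts along the face K, and A = - Sigma_K(ts). For t
   near ts the Hessian X_ij(t) is close to its regression (u / sigma^2) Sigma_ij
   on {X0 = u}, and the coordinates outside tau(K) must be those of ts because
   X increases towards ts in these directions. Maximizing
   X0 + <G, v> - (u / (2 sigma^2)) <A v, v> over v turns {sup X >= u} into
   {X0 + (sigma^2 / (2 u)) <A^-1 G, G> >= u}, up to factors 1 + o(1).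
   Each exceptional event says that a smooth Gaussian field Y with
   Var Y(ts) < kappa^2 sigma^2 exceeds kappa u near ts; the fields are
   X + lambda s_j X_j for j outside tau(K), 2 X - X0, and
   X0 +- lambda (X_ij - rho_ij X0), besides X itself away from ts. These
   probabilities are bounded by chaining along dyadic grids, which only needs
   the Hoelder condition on the second derivatives.
   As ts maximizes the variance, X0 is independent of G. With V = X0 / sigma,
   x = u / sigma and Q = <A^-1 G, G>, the substitution z = x + r / x shows that
   x exp(x^2 / 2) sqrt(2 pi) P(V + Q / (2 x) >= x) increases to E exp(Q / 2),
   which equals sqrt(det A / det(A - Lambda_K)). *)

From HB Require Import structures.
Require Import Defs.
From mathcomp Require Import all_boot all_order all_algebra.
From mathcomp Require Import all_classical all_reals all_analysis.
From mathcomp Require Import measurable_realfun zify ring lra.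

Set Implicit Arguments.
Unset Strict Implicit.
Unset Printing Implicit Defensive.

Import Order.TTheory GRing.Theory Num.Theory.
Import numFieldNormedType.Exports.

Local Open Scope classical_set_scope.
Local Open Scope ring_scope.

(** * Integration against the standard normal law *)

(** No joint density is ever written down. A Gaussian family is a linear space [S] whose elements
    all have the Fourier transform of a centered normal law. Such spaces are stable under pointwise
    limits, so one closure takes in the first derivatives and a second one the second derivatives.
    To make these limits hold at every point, the paths are set to 0 on a null set. Independence of
    [X0] and the gradient is deduced from zero covariance by Fourier uniqueness for signed weights.
    The exceptional events are unions over uncountably many points, so each is only covered by a
    measurable set of small probability. Their gain over the rate 1/(2 sigma^2) comes from a strict
    variance inequality at ts alone, extended to a neighbourhood by continuity. The two bounds are
    not symmetric. The upper one expands the path at a maximiser; the lower one tests the point m^-1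
    A^-1 G, which lies in the box only if A^-1 G is at most a small multiple of u. These
    restrictions exhaust the space as u grows, hence cost nothing in the limit. The factors 1 + o(1)
    replace A - Lambda by A - c Lambda with c close to 1, and continuity of the determinant removes
    c. *)

Section Integration.
Import HBSimple HBNNSimple.
Context {d} {T : measurableType d} {R : realType}.

Lemma bounded_integrable (P : probability T R) (f : T -> R) (M : R) :
  measurable_fun setT f -> (forall x, `|f x| <= M) ->
  P.-integrable setT (EFin \o f).
Proof.
move=> mf fM; apply: measurable_bounded_integrable => //.
  exact: fin_num_fun_lty.
exists M; split; first exact: num_real.
by move=> y My x _; exact: (le_trans (fM x) (ltW My)).
Qed.

Lemma dominated_cvg_Rintegral (mu : {measure set T -> \bar R})
    (f_ : nat -> T -> R) (f g : T -> R) :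
  (forall n, measurable_fun setT (f_ n)) ->
  (forall x, f_ n x @[n --> \oo] --> f x) ->
  mu.-integrable setT (EFin \o g) ->
  (forall n x, `|f_ n x| <= g x) ->
  measurable_fun setT f /\ mu.-integrable setT (EFin \o f) /\
  \int[mu]_x f_ n x @[n --> \oo] --> \int[mu]_x f x.
Proof.
move=> mf cf ig fg.
have mlim : measurable_fun setT f.
  apply/measurable_EFinP; apply: (emeasurable_fun_cvg (fun n => EFin \o f_ n)).
    by move=> n; exact/measurable_EFinP.
  by move=> x _; apply: cvg_EFin; [exact: nearW|exact: cf].
have [] := @dominated_convergence _ _ _ mu setT measurableT
   (fun n => EFin \o f_ n) (EFin \o f) (EFin \o g).
- by move=> n; exact/measurable_EFinP.
- exact/measurable_EFinP.
- by apply: aeW => x _; apply: cvg_EFin; [exact: nearW|exact: cf].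
- exact: ig.
- by apply: aeW => x n _; rewrite /= lee_fin.
move=> intf _ h; split => //; split => //.
apply: fine_cvg; rewrite fineK//; exact: integrable_fin_num.
Qed.

(** Monotone convergence along the simple approximations [h n] of [f] reduces both sides to simple
    functions, where the identity is the hypothesis on each level set. *)
Lemma ge0_integral_density (mu nu : {measure set T -> \bar R}) (g : T -> R)
    (f : T -> \bar R) :
  measurable_fun setT g -> (forall x, 0 <= g x) ->
  (forall A, measurable A -> nu A = \int[mu]_(x in A) (g x)%:E)%E ->
  measurable_fun setT f -> (forall x, 0 <= f x)%E ->
  (\int[nu]_x f x = \int[mu]_x (f x * (g x)%:E))%E.
Proof.
move=> /measurable_EFinP mg g0 H mf f0.
have mT := @measurableT _ T.
pose h := nnsfun_approx mT mf.
have hnd x : {homo (fun n => (h n x)%:E) : a b / (a <= b)%N >-> (a <= b)%E}.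
  by move=> a b ab; rewrite lee_fin; have /lefP := nd_nnsfun_approx mT mf ab; apply.
have -> : (\int[nu]_x f x = limn (fun n => \int[nu]_x (h n x)%:E))%E.
  rewrite -monotone_convergence//; first last.
  - by move=> n x _; rewrite lee_fin.
  - by move=> n; exact/measurable_EFinP.
  apply: eq_integral => x _; apply/esym/cvg_lim => //.
  exact: cvg_nnsfun_approx.
have -> : (\int[mu]_x (f x * (g x)%:E) = limn (fun n => \int[mu]_x ((h n x)%:E * (g x)%:E)))%E.
  rewrite -monotone_convergence//; first last.
  - by move=> x _ a b ab; rewrite lee_wpmul2r ?lee_fin//; have := hnd x _ _ ab; rewrite lee_fin.
  - by move=> n x _; rewrite mule_ge0 ?lee_fin.
  - by move=> n; apply: emeasurable_funM => //; exact/measurable_EFinP.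
  apply: eq_integral => x _; apply/esym/cvg_lim => //.
  by apply: cvgeZr => //; exact: cvg_nnsfun_approx.
congr (limn _); apply/funext => n.
transitivity (\sum_(y \in range (h n)) (y%:E * nu (h n @^-1` [set y])))%E.
  by rewrite integral_nnsfun// patch_setT sintegralE.
transitivity (\int[mu]_x \sum_(y \in range (h n))
    ((y * \1_(h n @^-1` [set y]) x)%:E * (g x)%:E))%E; last first.
  apply: eq_integral => x _; rewrite -ge0_mule_fsuml; last first.
    by move=> y; exact: nnfun_muleindic_ge0.
  by rewrite fsumEFin// -fimfunE.
rewrite ge0_integral_fsum//; last 2 first.
- move=> y; apply: emeasurable_funM => //.
  by apply/measurable_EFinP; apply: measurable_funM.
- by move=> y x _; rewrite mule_ge0 ?lee_fin//; exact: nnfun_muleindic_ge0.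
apply: eq_fsbigr => y /set_mem [x _ <-].
rewrite H//.
under [RHS]eq_integral do rewrite EFinM -muleA.
rewrite ge0_integralZl ?lee_fin//; first last.
- by move=> z _; rewrite mule_ge0 ?lee_fin.
- by apply: emeasurable_funM => //; apply/measurable_EFinP.
congr (_ * _)%E; rewrite [LHS]integral_mkcond; apply: eq_integral => z _.
by rewrite epatch_indic muleC.
Qed.

End Integration.

Section DensityReal.
Context {d} {T : measurableType d} {R : realType}.
Variables (mu nu : {measure set T -> \bar R}) (g : T -> R).
Hypotheses (mg : measurable_fun setT g) (g0 : forall x, 0 <= g x).
Hypothesis nuE : forall A, measurable A -> (nu A = \int[mu]_(x in A) (g x)%:E)%E.

Lemma integrable_density (f : T -> R) : measurable_fun setT f ->
  nu.-integrable setT (EFin \o f) <-> mu.-integrable setT (EFin \o (fun x => f x * g x)).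
Proof.
move=> mf.
have mfg : measurable_fun setT (EFin \o (fun x => f x * g x)).
  by apply/measurable_EFinP; exact: measurable_funM.
have H : (\int[nu]_x `|(f x)%:E| = \int[mu]_x `|(f x * g x)%:E|)%E.
  rewrite (ge0_integral_density mg g0 nuE)//.
    by apply: eq_integral => x _; rewrite /= -EFinM normrM (ger0_norm (g0 x)).
  by apply: measurableT_comp => //; exact/measurable_EFinP.
by split => /integrableP[_ h]; apply/integrableP; split => //;
  [rewrite -H|exact/measurable_EFinP|rewrite /= H].
Qed.

Lemma Rintegral_density (f : T -> R) : measurable_fun setT f ->
  nu.-integrable setT (EFin \o f) ->
  \int[nu]_x f x = \int[mu]_x (f x * g x).
Proof.
move=> mf intf.
have intfg := (integrable_density mf).1 intf.
have intn : nu.-integrable setT (EFin \o (fun x => `|f x|)) by exact: integrable_norm.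
have mn : measurable_fun setT (fun x => `|f x|) by exact: measurableT_comp.
have intng := (integrable_density mn).1 intn.
have E (h : T -> R) : measurable_fun setT h -> (forall x, 0 <= h x) ->
    \int[nu]_x h x = \int[mu]_x (h x * g x).
  move=> mh h0; rewrite /Rintegral (ge0_integral_density mg g0 nuE)//.
  exact/measurable_EFinP.
(* Both [f + |f|] and [|f|] are nonnegative, and [f] is their difference; this replaces a splitting
   into positive and negative parts. *)
have H : \int[nu]_x (f x + `|f x|) = \int[mu]_x ((f x + `|f x|) * g x).
  apply: E; first exact: measurable_funD.
  by move=> x; have := ler_norm (- f x); rewrite normrN; lra.
have := E _ mn (fun x => normr_ge0 _).
move: H; rewrite RintegralD//.
under [in RHS]eq_Rintegral do rewrite mulrDl.
by rewrite RintegralD// => + H; rewrite H => /addIr.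
Qed.

End DensityReal.

Section StdNormal.
Context {R : realType}.
Notation nz := (normal_prob (0:R) 1).
Notation mu := (@lebesgue_measure R).
Notation phi := (normal_pdf (0:R) 1).

Let mp : measurable_fun setT phi. Proof. exact: measurable_normal_pdf. Qed.
Let p0 : forall x, 0 <= phi x. Proof. exact: normal_pdf_ge0. Qed.
Let nE (A : set R) : measurable A -> (nz A = \int[mu]_(x in A) (phi x)%:E)%E.
Proof. by []. Qed.

Lemma ge0_integral_normal (f : R -> \bar R) : measurable_fun setT f ->
  (forall x, 0 <= f x)%E -> (\int[nz]_x f x = \int[mu]_x (f x * (phi x)%:E))%E.
Proof. by move=> mf f0; apply: (@ge0_integral_density _ _ R mu nz phi f mp p0 _ mf f0) => A; exact: nE. Qed.

Lemma normal_pdf1E (x : R) : phi x = normal_peak 1 * expR (- (x ^+ 2 / 2)).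
Proof. by rewrite normal_pdfE// /normal_fun subr0 expr1n mulNr. Qed.

(** Completing the square: the exponential times the standard density is a constant times the normal
    density of mean [l / (1 - b)] and standard deviation [(1 - b)^(-1/2)]. This is the
    one-dimensional case of the Gaussian integral of the exponential of a quadratic form, and it
    also supplies dominating functions. *)
Lemma integrable_expR_normal (b l : R) : b < 1 ->
  nz.-integrable setT (EFin \o (fun v : R => expR (b * v ^+ 2 / 2 + v * l))) /\
  (\int[nz]_v (expR (b * v ^+ 2 / 2 + v * l))%:E =
   ((Num.sqrt (1 - b))^-1 * expR (l ^+ 2 / (2 * (1 - b))))%:E)%E.
Proof.
move=> b1.
have mf : measurable_fun setT (fun v : R => expR (b * v ^+ 2 / 2 + v * l)).
  apply: measurableT_comp => //; apply: measurable_funD.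
    by apply: measurable_funM => //; apply: measurable_funM => //; exact: measurable_funX.
  exact: measurable_funM.
suff E : (\int[nz]_v (expR (b * v ^+ 2 / 2 + v * l))%:E =
   ((Num.sqrt (1 - b))^-1 * expR (l ^+ 2 / (2 * (1 - b))))%:E)%E.
  split => //; apply/integrableP; split; first exact/measurable_EFinP.
  by under eq_integral do rewrite /= ger0_norm ?expR_ge0//; rewrite E ltry.
have b0 : 0 < 1 - b by rewrite subr_gt0.
pose s := (Num.sqrt (1 - b))^-1.
have s0 : 0 < s by rewrite invr_gt0 sqrtr_gt0.
have s2 : s ^+ 2 = (1 - b)^-1 by rewrite exprVn sqr_sqrtr// ltW.
rewrite ge0_integral_normal; first last.
  by move=> x; rewrite lee_fin expR_ge0.
  exact/measurable_EFinP.
transitivity (\int[mu]_x ((s * expR (l ^+ 2 / (2 * (1 - b))))%:E * (normal_pdf (l / (1 - b)) s x)%:E))%E.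
  apply: eq_integral => x _; rewrite -!EFinM; congr EFin.
  rewrite normal_pdf1E normal_pdfE ?gt_eqF//.
  have -> : normal_peak s = s^-1 * normal_peak 1.
    rewrite /normal_peak expr1n mul1r -mulrnAr sqrtrM ?sqr_ge0// sqrtr_sqr gtr0_norm//.
    by rewrite invfM.
  rewrite /normal_fun s2.
  have -> : - (x - l / (1 - b)) ^+ 2 / ((1 - b)^-1 *+ 2) =
            (b * x ^+ 2 / 2 + x * l) + - (x ^+ 2 / 2) - l ^+ 2 / (2 * (1 - b)).
    by rewrite -mulr_natr; field; rewrite ?gt_eqF//.
  rewrite !expRD !expRN.
  by field; rewrite !gt_eqF ?expR_gt0.
rewrite ge0_integralZl//.
- by rewrite integral_normal_pdf mule1.
- by apply/measurable_EFinP; exact: measurable_normal_pdf.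
- by move=> x _; rewrite lee_fin normal_pdf_ge0.
- by rewrite lee_fin mulr_ge0 ?expR_ge0 ?ltW.
Qed.

Lemma integrable_id_normal : nz.-integrable setT (EFin \o (fun v : R => `|v|)).
Proof.
(* The dominating function is exp(x) + exp(-x), the case [b = 0] with [l = 1] and [l = -1]. *)
have [i1 _] := @integrable_expR_normal 0 1 ltr01.
have [i2 _] := @integrable_expR_normal 0 (-1) ltr01.
apply: (le_integrable measurableT _ _ (integrableD measurableT i1 i2)).
  by apply/measurable_EFinP; exact: measurableT_comp.
move=> x _ /=; rewrite lee_fin normr_id ?mul0r ?add0r ?mulr1 ?mulrN1.
have := expR_ge1Dx x; have := expR_ge1Dx (- x).
have := expR_ge0 x; have := expR_ge0 (- x).
rewrite (ger0_norm (addr_ge0 (expR_ge0 x) (expR_ge0 (- x)))).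
by case: (ger0P x) => _; lra.
Qed.

Lemma normal_peak_le1 : normal_peak (1:R) <= 1.
Proof.
rewrite /normal_peak invf_le1 ?sqrtr_gt0; last by rewrite expr1n mul1r mulrn_wgt0// pi_gt0.
rewrite -[leLHS]sqrtr1 ler_sqrt ?expr1n ?mul1r; have := pi_ge2 R; rewrite mulr2n; lra.
Qed.

(** Integration by parts with phi'(x) = - x phi(x): the function [F = - phi g] is a primitive of the
    difference of the integrands. The fundamental theorem is applied on growing symmetric intervals,
    whose boundary terms vanish because [g] is bounded. *)
Lemma normal_stein (g g' : R -> R) (M : R) :
  (forall x : R, is_derive x 1 g (g' x)) -> continuous g' ->
  (forall x, `|g x| <= 1) -> (forall x, `|g' x| <= M) ->
  \int[nz]_x (x * g x) = \int[nz]_x g' x.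
Proof.
move=> dg cg' g1 gM.
have cg : continuous g.
  by move=> x; apply: differentiable_continuous; apply/derivable1_diffP; case: (dg x).
have mg : measurable_fun setT g by exact: continuous_measurable_fun.
have mg' : measurable_fun setT g' by exact: continuous_measurable_fun.
have mxg : measurable_fun setT (fun x : R => x * g x) by exact: measurable_funM.
have i1 : nz.-integrable setT (EFin \o (fun x : R => x * g x)).
  apply: (le_integrable measurableT _ _ integrable_id_normal).
    exact/measurable_EFinP.
  by move=> x _; rewrite /= lee_fin normr_id normrM ler_piMr.
have i2 : nz.-integrable setT (EFin \o g') by have := @bounded_integrable _ _ R nz g' M mg' gM.
rewrite (@Rintegral_density _ _ R mu nz phi mp p0 nE _ mxg i1) (@Rintegral_density _ _ R mu nz phi mp p0 nE _ mg' i2).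
have j1 := (@integrable_density _ _ R mu nz phi mp p0 nE _ mxg).1 i1.
have j2 := (@integrable_density _ _ R mu nz phi mp p0 nE _ mg').1 i2.
apply/eqP; rewrite -subr_eq0 -RintegralB//; apply/eqP.
set f := fun x : R => x * g x * phi x - g' x * phi x.
have jf : mu.-integrable setT (EFin \o f).
  by have := integrableB measurableT j1 j2; apply: eq_integrable.
pose F (x : R) := - (phi x * g x).
have dphi (x : R) : is_derive x 1 phi (- x * phi x).
  have -> : phi = (fun x : R => normal_peak 1 * expR (- (x ^+ 2 / 2))).
    by apply/funext => y; rewrite normal_pdf1E.
  apply: is_derive_eq; rewrite /GRing.scale/=; by field.
have dF (x : R) : is_derive x 1 F (f x).
  rewrite /F /f; have := dg x; have := dphi x => ? ?.
  apply: is_derive_eq; rewrite /GRing.scale/=; ring.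
have cphi : continuous phi by exact: continuous_normal_pdf.
have cf : continuous f.
  move=> x; apply: cvgB; apply: cvgM; [apply: cvgM|..]; by [exact: cvg_id|exact: cg|exact: cphi|exact: cg'].
have cF : continuous F.
  by move=> x; apply: differentiable_continuous; apply/derivable1_diffP; case: (dF x).
have FTC (n : nat) : \int[mu]_(x in `[- n.+1%:R, n.+1%:R]) f x = F n.+1%:R - F (- n.+1%:R).
  have nn : - n.+1%:R < n.+1%:R :> R by rewrite gtrN// ltr0n.
  rewrite /Rintegral (@continuous_FTC2 R f F) //.
  - exact: continuous_subspaceT.
  - split.
    + by move=> x _; case: (dF x).
    + by apply: cvg_at_right_filter; exact: cF.
    + by apply: cvg_at_left_filter; exact: cF.
  - by move=> x _; rewrite derive1E; case: (dF x).
have L1 : \int[mu]_(x in `[- n.+1%:R, n.+1%:R]) f x @[n --> \oo] --> \int[mu]_x f x.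
  have -> : (fun n : nat => \int[mu]_(x in `[- n.+1%:R, n.+1%:R]) f x) =
     (fun n : nat => \int[mu]_x (f \_ `[- n.+1%:R, n.+1%:R]) x).
    by apply/funext => n; rewrite Rintegral_mkcond.
  have [] := @dominated_cvg_Rintegral _ _ R mu
      (fun n : nat => f \_ `[- n.+1%:R, n.+1%:R]) f (fun x : R => `|f x|).
  - move=> n; apply/(measurable_restrictT _ _).1 => //.
    by apply: measurable_funTS; exact: continuous_measurable_fun.
  - move=> x; apply: cvg_near_cst; near=> n.
    rewrite patchE mem_set// /= in_itv/= -ler_norml.
    have h : (Num.bound `|x| <= n)%N by near: n; exact: nbhs_infty_ge.
    apply: (le_trans (ltW (archi_boundP (normr_ge0 x)))).
    by rewrite ler_nat (leq_trans h).
  - exact: integrable_norm.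
  - by move=> n x; rewrite patchE; case: ifP => //; rewrite normr0.
  by move=> _ [].
have L2 : (fun n : nat => F n.+1%:R - F (- n.+1%:R)) @ \oo --> (0:R).
  apply/cvgr0Pnorm_le => e e0; near=> n.
  have phin (x : R) : n.+1%:R <= x ^+ 2 -> `|F x| <= e / 2.
    move=> nx; rewrite /F normrN normrM ger0_norm//.
    apply: (le_trans (ler_piMr (p0 x) (g1 x))).
    rewrite normal_pdf1E; apply: (le_trans (ler_piMl (expR_ge0 _) normal_peak_le1)).
    rewrite expRN -[leRHS]invrK lef_pV2 ?posrE ?expR_gt0 ?invr_gt0 ?divr_gt0//.
    apply: le_trans (expR_ge1Dx _).
    have : 2 * (e / 2)^-1 <= n%:R by near: n; exact: nbhs_infty_ger.
    move: nx; rewrite -natr1; lra.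
  have nn : n.+1%:R <= (n.+1%:R : R) ^+ 2 by rewrite expr2 ler_peMr// ler1n.
  have n1 := phin _ nn; have n2 : `|F (- n.+1%:R)| <= e / 2 by apply: phin; rewrite sqrrN.
  by apply: (le_trans (ler_normB _ _)); rewrite [leRHS](splitr e) lerD.
move: L1; under eq_fun do rewrite FTC.
by move=> L1; apply: (cvg_unique _ L1 L2).
Unshelve. all: by end_near.
Qed.

(** Differentiation under the integral, dominated by |x|, brings out a factor x, which
    [normal_stein] turns into a factor s. The resulting linear equation characterises the Fourier
    transform. *)
Lemma normal_sinP (s : R) :
  [/\ is_derive s 1 (fun s => \int[nz]_x cos (s * x)) (- s * \int[nz]_x cos (s * x))
    & is_derive s 1 (fun s => \int[nz]_x sin (s * x)) (- s * \int[nz]_x sin (s * x))].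
Proof.
have mc (t : R) : measurable_fun setT (fun x : R => cos (t * x)).
  by apply: continuous_measurable_fun => x; apply: continuous_comp;
    [exact: mulrl_continuous|exact: continuous_cos].
have ms (t : R) : measurable_fun setT (fun x : R => sin (t * x)).
  by apply: continuous_measurable_fun => x; apply: continuous_comp;
    [exact: mulrl_continuous|exact: continuous_sin].
have D1 (t x : R) : is_derive t 1 (fun t : R => cos (t * x)) (- (x * sin (t * x))).
  apply: is_derive_eq; rewrite /GRing.scale/=; ring.
have D2 (t x : R) : is_derive t 1 (fun t : R => sin (t * x)) (x * cos (t * x)).
  apply: is_derive_eq; rewrite /GRing.scale/=; ring.
have D3 (t x : R) : is_derive x 1 (fun x : R => cos (t * x)) (- (t * sin (t * x))).
  apply: is_derive_eq; rewrite /GRing.scale/=; ring.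
have D4 (t x : R) : is_derive x 1 (fun x : R => sin (t * x)) (t * cos (t * x)).
  apply: is_derive_eq; rewrite /GRing.scale/=; ring.
have c1 (y : R) : `|cos y| <= 1 by rewrite ler_norml cos_geN1 cos_le1.
have s1 (y : R) : `|sin y| <= 1 by rewrite ler_norml sin_geN1 sin_le1.
have Is : s \in `]s - 1, s + 1[ by rewrite in_itv/= ltrBlDr !ltrDl ltr01.
split.
- have i t : nz.-integrable setT (EFin \o (fun x : R => cos (t * x))).
    by have := @bounded_integrable _ _ R nz _ 1 (mc t) (fun x => c1 _).
  apply: DeriveDef.
    apply: (@derivable_under_integral R _ _ nz (fun t x => cos (t * x)) setT measurableT s (s - 1) (s + 1) Is
      (fun t _ => i t) _ (fun x => `|x|) (fun=> normr_ge0 _) integrable_id_normal).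
    + by move=> t x _ _; case: (D1 t x).
    + move=> t x _ _; rewrite /partial1of2 derive1E; have [_ ->] := D1 t x.
      by rewrite normrN normrM ler_piMr.
  rewrite -derive1E (@differentiation_under_integral R _ _ nz (fun t x => cos (t * x)) setT measurableT s (s - 1) (s + 1) Is
      (fun t _ => i t) _ (fun x => `|x|) (fun=> normr_ge0 _) integrable_id_normal); first last.
  + move=> t x _ _; rewrite /partial1of2 derive1E; have [_ ->] := D1 t x.
    by rewrite normrN normrM ler_piMr.
  + by move=> t x _ _; case: (D1 t x).
  under eq_Rintegral.
    move=> x _; rewrite /partial1of2 derive1E; have [_ ->] := D1 s x.
    rewrite -mulrN; over.
  rewrite (@normal_stein (fun x => - sin (s * x)) (fun x => - (s * cos (s * x))) `|s|).
  + under eq_Rintegral do rewrite -mulNr.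
    by rewrite RintegralZl.
  + move=> x; apply: cvgN; apply: cvgM; first exact: cvg_cst.
    by apply: continuous_comp; [exact: mulrl_continuous|exact: continuous_cos].
  + by move=> x; rewrite normrN.
  + by move=> x; rewrite normrN normrM ler_piMr.
- have i t : nz.-integrable setT (EFin \o (fun x : R => sin (t * x))).
    by have := @bounded_integrable _ _ R nz _ 1 (ms t) (fun x => s1 _).
  apply: DeriveDef.
    apply: (@derivable_under_integral R _ _ nz (fun t x => sin (t * x)) setT measurableT s (s - 1) (s + 1) Is
      (fun t _ => i t) _ (fun x => `|x|) (fun=> normr_ge0 _) integrable_id_normal).
    + by move=> t x _ _; case: (D2 t x).
    + move=> t x _ _; rewrite /partial1of2 derive1E; have [_ ->] := D2 t x.
      by rewrite normrM ler_piMr.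
  rewrite -derive1E (@differentiation_under_integral R _ _ nz (fun t x => sin (t * x)) setT measurableT s (s - 1) (s + 1) Is
      (fun t _ => i t) _ (fun x => `|x|) (fun=> normr_ge0 _) integrable_id_normal); first last.
  + move=> t x _ _; rewrite /partial1of2 derive1E; have [_ ->] := D2 t x.
    by rewrite normrM ler_piMr.
  + by move=> t x _ _; case: (D2 t x).
  under eq_Rintegral.
    move=> x _; rewrite /partial1of2 derive1E; have [_ ->] := D2 s x.
    over.
  rewrite (@normal_stein (fun x => cos (s * x)) (fun x => - (s * sin (s * x))) `|s|)//.
  + under eq_Rintegral do rewrite -mulNr.
    by rewrite RintegralZl.
  + move=> x; apply: cvgN; apply: cvgM; first exact: cvg_cst.
    by apply: continuous_comp; [exact: mulrl_continuous|exact: continuous_sin].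
  + by move=> x; rewrite normrN normrM ler_piMr.
Qed.

Lemma normal_ode (f : R -> R) : (forall s : R, is_derive s 1 f (- s * f s)) ->
  forall s, f s = f 0 * expR (- (s ^+ 2 / 2)).
Proof.
move=> df s.
(* Multiplication by the integrating factor exp(s^2 / 2) makes the derivative vanish. *)
pose h (s : R) := f s * expR (s ^+ 2 / 2).
have dh (x : R) : is_derive x 1 h 0.
  rewrite /h; have := df x => ?; apply: is_derive_eq; rewrite /GRing.scale/=; by field.
have : h s = h 0 by apply: (@is_derive_0_is_cst R h) => x; exact: dh.
rewrite /h expr0n/= mul0r expR0 mulr1 => <-.
by rewrite -mulrA -expRD subrr expR0 mulr1.
Qed.

Lemma normal_cos (s : R) : \int[nz]_x cos (s * x) = expR (- (s ^+ 2 / 2)).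
Proof.
have D (t : R) : is_derive t 1 (fun s => \int[nz]_x cos (s * x)) (- t * \int[nz]_x cos (t * x)).
  by case: (normal_sinP t).
rewrite (normal_ode D).
under eq_Rintegral do rewrite mul0r cos0.
by rewrite Rintegral_cst//= probability_setT mulr1 mul1r.
Qed.

Lemma normal_sin (s : R) : \int[nz]_x sin (s * x) = 0.
Proof.
have D (t : R) : is_derive t 1 (fun s => \int[nz]_x sin (s * x)) (- t * \int[nz]_x sin (t * x)).
  by case: (normal_sinP t).
rewrite (normal_ode D).
under eq_Rintegral do rewrite mul0r sin0.
by rewrite Rintegral_cst//= mul0r mul0r.
Qed.

End StdNormal.

(** * Gaussian laws and their Fourier transforms *)

Section NormalTails.
Context {R : realType}.
Notation nz := (normal_prob (0:R) 1).
Notation mu := (@lebesgue_measure R).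

(** Chernoff bound: the indicator of v >= x is at most exp(x v - x^2), whose mean is exp(-x^2 /
    2). *)
Lemma normal_tail (x : R) : 0 <= x ->
  (nz `[x, +oo[%classic <= (expR (- (x ^+ 2 / 2)))%:E)%E.
Proof.
move=> x0.
have mA : measurable (`[x, +oo[%classic : set R) by [].
rewrite -(setIT `[x, +oo[%classic) -integral_indic//.
have [i E] := @integrable_expR_normal R 0 x ltr01.
apply: (@le_trans _ _ (\int[nz]_v ((expR (- x ^+ 2))%:E * (expR (0 * v ^+ 2 / 2 + v * x))%:E)))%E.
  apply: ge0_le_integral => //=.
  - by apply/measurable_EFinP; exact: measurable_indic.
  - by apply: measurable_funeM; exact: measurable_int _ i.
  - move=> v _; rewrite indicE; case: (boolP (v \in _)) => [|_]; last by rewrite lee_fin mulr_ge0 ?expR_ge0.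
    rewrite inE/= in_itv/= andbT => xv; rewrite lee_fin -expRD -[leLHS]expR0 ler_expR !mul0r add0r.
    nra.
rewrite ge0_integralZl ?lee_fin ?expR_ge0//; last exact: (measurable_int nz i).
rewrite E -EFinM lee_fin subr0 sqrtr1 invr1 mul1r -expRD ler_expR mulr1; nra.
Qed.

(** Where |y - m| >= e, the density of standard deviation s is at most the stated constant times the
    density of standard deviation sqrt(2) s, and the latter has total mass 1. *)
Lemma normal_concentration (m s e : R) : 0 < s -> 0 <= e ->
  (normal_prob m s [set y : R | (e <= `|y - m|)%R]
    <= (Num.sqrt 2 * expR (- (e ^+ 2 / (4 * s ^+ 2))))%:E)%E.
Proof.
move=> s0 e0.
have mA : measurable [set y : R | e <= `|y - m|].
  rewrite -[X in measurable X]setTI; apply: measurable_fun_le => //.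
  by apply: measurableT_comp => //; exact: measurable_funB.
pose c := Num.sqrt 2 * expR (- (e ^+ 2 / (4 * s ^+ 2))).
have s20 : (0:R) < Num.sqrt 2 by rewrite sqrtr_gt0.
have c0 : 0 <= c by rewrite mulr_ge0 ?expR_ge0 ?ltW.
apply: (@le_trans _ _ (\int[mu]_(y in [set y : R | (e <= `|y - m|)%R]) (c * normal_pdf m (Num.sqrt 2 * s) y)%:E))%E.
  apply: ge0_le_integral => //=.
  - by move=> y _; rewrite lee_fin normal_pdf_ge0.
  - by apply/measurable_EFinP/measurable_funTS; exact: measurable_normal_pdf.
  - apply/measurable_EFinP/measurable_funTS; apply: measurable_funM => //.
    exact: measurable_normal_pdf.
  move=> y ey; rewrite lee_fin !normal_pdfE ?gt_eqF ?mulr_gt0//.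
  have -> : normal_peak (Num.sqrt 2 * s) = (Num.sqrt 2)^-1 * normal_peak s.
    rewrite /normal_peak exprMn sqr_sqrtr// -mulrA -mulrnAr sqrtrM ?ler0n//.
    by rewrite invfM.
  have -> : c * ((Num.sqrt 2)^-1 * normal_peak s * normal_fun m (Num.sqrt 2 * s) y) =
     normal_peak s * (expR (- (e ^+ 2 / (4 * s ^+ 2))) * normal_fun m (Num.sqrt 2 * s) y).
    have alg (A B C D : R) : D != 0 -> D * A * (D^-1 * B * C) = B * (A * C).
      by move=> D0; field.
    by rewrite /c alg// gt_eqF.
  rewrite ler_wpM2l ?normal_peak_ge0//.
  rewrite /normal_fun exprMn sqr_sqrtr// -expRD ler_expR.
  have ey2 : e ^+ 2 <= (y - m) ^+ 2 by rewrite -[leRHS]real_normK ?num_real// ler_pXn2r ?nnegrE.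
  have s2 : 0 < s ^+ 2 by exact: exprn_gt0.
  rewrite -subr_ge0.
  have -> : - (e ^+ 2 / (4 * s ^+ 2)) + - (y - m) ^+ 2 / ((2 * s ^+ 2) *+ 2) -
    - (y - m) ^+ 2 / (s ^+ 2 *+ 2) = ((y - m) ^+ 2 - e ^+ 2) / (4 * s ^+ 2).
    move: (e ^+ 2) ((y - m) ^+ 2) (s ^+ 2) s2 => A B C C0.
    have -> : 2 * C *+ 2 = 4 * C by ring.
    have -> : C *+ 2 = 2 * C by ring.
    by field; rewrite gt_eqF.
  by rewrite divr_ge0 ?subr_ge0// mulr_ge0// ltW.
under eq_integral do rewrite EFinM.
rewrite ge0_integralZl ?lee_fin ?expR_ge0//; last 2 first.
- by apply/measurable_EFinP/measurable_funTS; exact: measurable_normal_pdf.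
- by move=> y _; rewrite lee_fin normal_pdf_ge0.
rewrite -[leRHS]mule1 lee_wpmul2l ?lee_fin//.
exact: (@probability_le1 _ _ _ (normal_prob m (Num.sqrt 2 * s))).
Qed.

End NormalTails.

Section BoundedFubini.
Context {d1 d2} {T1 : measurableType d1} {T2 : measurableType d2} {R : realType}.
Variables (m1 : probability T1 R) (m2 : probability T2 R).

Lemma bounded_Fubini (f : T1 -> T2 -> R) (M : R) :
  measurable_fun setT (fun p : T1 * T2 => f p.1 p.2) ->
  (forall x y, `|f x y| <= M) ->
  [/\ measurable_fun setT (fun x => \int[m2]_y f x y),
     measurable_fun setT (fun y => \int[m1]_x f x y) &
  \int[m1]_x \int[m2]_y f x y = \int[m2]_y \int[m1]_x f x y].
Proof.
move=> mf fM.
have i2 x : m2.-integrable setT (EFin \o f x).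
  apply: (@bounded_integrable _ _ _ m2 _ M _ (fM x)).
  exact: (measurableT_comp mf (pair1_measurable x)).
have i1 y : m1.-integrable setT (EFin \o f ^~ y).
  apply: (@bounded_integrable _ _ _ m1 _ M _ (fun x => fM x y)).
  exact: (measurableT_comp mf (pair2_measurable y)).
have i : (m1 \x m2)%E.-integrable setT (fun p => (f p.1 p.2)%:E).
  apply/integrable12ltyP; first exact/measurable_EFinP.
  apply: (@le_lt_trans _ _ (\int[m1]_x \int[m2]_y (cst M%:E) y)%E).
    apply: ge0_le_integral => //=.
    - by move=> x _; exact: integral_ge0.
    - apply: (measurable_fun_fubini_tonelli_F (fun p => `|(f p.1 p.2)%:E|%E)) => //.
      by apply: measurableT_comp => //; exact/measurable_EFinP.
    - move=> x _; apply: ge0_le_integral => //=.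
      + by apply/measurable_EFinP; apply: measurableT_comp => //; exact: (measurableT_comp mf (pair1_measurable x)).
      + by move=> y _; rewrite lee_fin.
  under eq_integral do rewrite integral_cst//.
  by rewrite integral_cst//= !probability_setT !mule1 ltry.
have E2 x : (\int[m2]_y f x y)%:E = (\int[m2]_y (f x y)%:E)%E.
  by rewrite fineK//; exact: integrable_fin_num (i2 x).
have E1 y : (\int[m1]_x f x y)%:E = (\int[m1]_x (f x y)%:E)%E.
  by rewrite fineK//; exact: integrable_fin_num (i1 y).
split.
- apply/measurable_EFinP; rewrite (_ : _ \o _ = fun x => \int[m2]_y (f x y)%:E)%E.
    exact: (measurable_fubini_F i).
  by apply/funext => x /=; rewrite E2.
- apply/measurable_EFinP; rewrite (_ : _ \o _ = fun y => \int[m1]_x (f x y)%:E)%E.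
    exact: (measurable_fubini_G i).
  by apply/funext => x /=; rewrite E1.
rewrite {1}/Rintegral {3}/Rintegral; congr fine.
under eq_integral do rewrite E2.
under [RHS]eq_integral do rewrite E1.
exact: (Fubini i).
Qed.

End BoundedFubini.

Section WeightedDynkin.
Context {d1 d2 d'} {T1 : measurableType d1} {T2 : measurableType d2}
  {T' : measurableType d'} {R : realType}.
Variables (P1 : probability T1 R) (P2 : probability T2 R).
Variables (V1 : T1 -> T') (V2 : T2 -> T') (H1 : T1 -> R) (H2 : T2 -> R).
Hypotheses (mV1 : measurable_fun setT V1) (mV2 : measurable_fun setT V2).
Hypotheses (iH1 : P1.-integrable setT (EFin \o H1)).
Hypotheses (iH2 : P2.-integrable setT (EFin \o H2)).

Local Notation L1 := (fun A => \int[P1]_(x in V1 @^-1` A) (H1 x)%:E)%E.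
Local Notation L2 := (fun A => \int[P2]_(x in V2 @^-1` A) (H2 x)%:E)%E.

(** The pi-lambda theorem for signed measures. The weights may change sign, so integrability takes
    over the role of finiteness for complements and countable disjoint unions. *)
Lemma weighted_dynkin (G : set (set T')) :
  @measurable _ T' = <<s G >> -> setI_closed G ->
  L1 setT = L2 setT -> (forall A, G A -> L1 A = L2 A) ->
  forall A, measurable A -> L1 A = L2 A.
Proof.
move=> mG IG LT LG A mA.
have pre1 B : measurable B -> measurable (V1 @^-1` B).
  by move=> mB; rewrite -[X in measurable X]setTI; exact: mV1.
have pre2 B : measurable B -> measurable (V2 @^-1` B).
  by move=> mB; rewrite -[X in measurable X]setTI; exact: mV2.
have : <<s G >> A by rewrite -mG.
apply: (@dynkin_induction _ T' G (fun A => L1 A = L2 A)) => //= {A mA}.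
- move=> B mB LB.
  have C d (T : measurableType d) (P : probability T R) (V : T -> T') (H : T -> R) :
      (forall B, measurable B -> measurable (V @^-1` B)) ->
      P.-integrable setT (EFin \o H) ->
      (\int[P]_(x in V @^-1` (~` B)) (H x)%:E =
      \int[P]_x (H x)%:E - \int[P]_(x in V @^-1` B) (H x)%:E)%E.
    move=> pV iH.
    rewrite -[in X in (_ = X - _)%E](setUv (V @^-1` B)) preimage_setC integral_setU//.
    + have fB : (\int[P]_(x in V @^-1` B) (H x)%:E)%E \is a fin_num.
        by apply: integrable_fin_num; [exact: pV|apply: integrableS iH => //; exact: pV].
      by rewrite [X in (_ = X - _)%E]addeC (addeK _ fB).
    + exact: pV.
    + by apply/pV/measurableC.
    + by apply: measurable_funTS; exact: (measurable_int P iH).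
    + by rewrite -preimage_setC; exact/disj_setPCl.
  by rewrite (C _ _ P1)// (C _ _ P2)// LB; congr (_ - _)%E; exact: LT.
- move=> F mF tF LF; rewrite !preimage_bigcup.
  rewrite integral_bigcup; first last.
  + by apply: integrableS iH1 => //; apply: bigcupT_measurable => n; exact: pre1.
  + by move=> n; exact: pre1.
  + by move=> i j _ _ [x [Fi Fj]]; apply: tF => //; eexists; split; [exact: Fi|exact: Fj].
  rewrite integral_bigcup; first last.
  + by apply: integrableS iH2 => //; apply: bigcupT_measurable => n; exact: pre2.
  + by move=> n; exact: pre2.
  + by move=> i j _ _ [x [Fi Fj]]; apply: tF => //; eexists; split; [exact: Fi|exact: Fj].
  by apply: eq_eseriesr => n _; exact: LF.
Qed.

End WeightedDynkin.

(** * Fourier inversion by smoothing with narrow normal laws *)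

Section Smoothing.
Context {R : realType}.
Notation nz := (normal_prob (0:R) 1).
Notation mu := (@lebesgue_measure R).
Notation phi := (normal_pdf (0:R) 1).

(** The density of the normal law centred at [v], cut to [[c, d]] and taken relative to the standard
    normal law, so that all integrals below are against one probability measure. *)
Let kern (c d s v y : R) : R := \1_`[c, d] y * normal_pdf v s y / phi y.

Let phi_gt0 (y : R) : 0 < phi y.
Proof. by rewrite normal_pdf1E mulr_gt0 ?expR_gt0 ?normal_peak_gt0 ?oner_neq0. Qed.

(** A bound for [wgt]: on [[c, d]] the standard density is at least its value at |c| + |d|. *)
Let K (c d s : R) := normal_peak s / (normal_peak 1 * expR (- ((`|c| + `|d|) ^+ 2 / 2))).

Let K_ge0 (c d s : R) : 0 <= K c d s.
Proof. by rewrite divr_ge0 ?mulr_ge0 ?normal_peak_ge0 ?expR_ge0. Qed.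

Let wgt (c d s y : R) : R := \1_`[c, d] y * normal_peak s / phi y.

Let wgt_le (c d s y : R) : `|wgt c d s y| <= K c d s.
Proof.
rewrite ger0_norm /wgt; last first.
  by rewrite divr_ge0 ?mulr_ge0 ?normal_peak_ge0 ?(ltW (phi_gt0 y)).
rewrite indicE; case: (boolP (y \in _)) => [|_]; last by rewrite !mul0r K_ge0.
rewrite inE/= in_itv/= => /andP[cy yd]; rewrite mul1r.
rewrite ler_wpM2l ?normal_peak_ge0//.
rewrite lef_pV2 ?posrE ?phi_gt0//; last by rewrite mulr_gt0 ?expR_gt0 ?normal_peak_gt0 ?oner_neq0.
rewrite normal_pdf1E ler_wpM2l ?normal_peak_ge0// ler_expR lerN2 ler_wpM2r//.
rewrite -[leLHS]real_normK ?num_real// ler_pXn2r ?nnegrE ?addr_ge0//.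
have := ler_norm d; have := ler_norm (- c); rewrite normrN.
by have := normr_ge0 c; have := normr_ge0 d; case: (ger0P y) => _; lra.
Qed.

Let mphiV : measurable_fun setT (fun y => (phi y)^-1).
Proof.
apply: continuous_measurable_fun => y; apply: cvgV; first by rewrite gt_eqF.
by apply: continuous_normal_pdf; exact: oner_neq0.
Qed.

Let mwgt (c d s : R) : measurable_fun setT (wgt c d s).
Proof.
apply: measurable_funM => //.
by apply: measurable_funM => //; exact: measurable_indic.
Qed.

(** The dependence on [v] is only through a Gaussian function of (v - y)/s, and a Gaussian function
    is itself a Fourier transform ([normal_cos]). *)
Let kernE (c d s v y : R) : 0 < s ->
  kern c d s v y = wgt c d s y * \int[nz]_x cos ((v - y) / s * x).
Proof.
move=> s0; rewrite normal_cos /kern /wgt normal_pdfE ?gt_eqF// /normal_fun.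
have -> : - (((v - y) / s) ^+ 2 / 2) = - (y - v) ^+ 2 / (s ^+ 2 *+ 2).
  have -> : s ^+ 2 *+ 2 = 2 * s ^+ 2 by ring.
  by field; rewrite gt_eqF.
ring.
Qed.

Let normal_itvE (c d s v : R) : 0 < s ->
  fine (normal_prob v s `[c, d]%classic) = \int[nz]_y (wgt c d s y * \int[nz]_x cos ((v - y) / s * x)).
Proof.
move=> s0.
have mk : measurable_fun setT (fun y => \1_`[c, d] y * normal_pdf v s y : R).
  by apply: measurable_funM; [exact: measurable_indic|exact: measurable_normal_pdf].
under eq_Rintegral do rewrite -kernE//.
rewrite /normal_prob /Rintegral; congr fine.
rewrite ge0_integral_normal; last 2 first.
- apply/measurable_EFinP; exact: measurable_funM.
- by move=> y; rewrite lee_fin divr_ge0 ?(ltW (phi_gt0 y))// mulr_ge0 ?normal_pdf_ge0.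
rewrite integral_mkcond; apply: eq_integral => y _.
rewrite -EFinM mulfVK ?gt_eqF// patchE indicE.
by case: ifP => _; rewrite ?mul1r ?mul0r.
Qed.

Section one.
Context {d} {T : measurableType d} (P : probability T R) (V H : T -> R) (M : R).
Hypotheses (mV : measurable_fun setT V) (mH : measurable_fun setT H).
Hypothesis HM : forall w, `|H w| <= M.

Let mcos : measurable_fun setT (@cos R).
Proof. by apply: continuous_measurable_fun; exact: continuous_cos. Qed.

(** After two uses of Fubini and the addition formula for the cosine, the right-hand side involves
    [V] and [H] only through the cosine and sine transforms of the weighted law. Equal transforms
    therefore give equal smoothed integrals. *)
Lemma smoothing (c e s : R) : 0 < s ->
  measurable_fun setT (fun w => fine (normal_prob (V w) s `[c, e]%classic)) /\
  \int[P]_w (fine (normal_prob (V w) s `[c, e]%classic) * H w) =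
  \int[nz]_y (wgt c e s y * \int[nz]_x
     (cos (y / s * x) * \int[P]_w (cos (x / s * V w) * H w) +
      sin (y / s * x) * \int[P]_w (sin (x / s * V w) * H w))).
Proof.
move=> s0.
have c1 (y : R) : `|cos y| <= 1 by rewrite ler_norml cos_geN1 cos_le1.
have s1 (y : R) : `|sin y| <= 1 by rewrite ler_norml sin_geN1 sin_le1.
have mf3 (y : R) : measurable_fun setT (fun p : T * R => cos ((V p.1 - y) / s * p.2)).
  apply: measurableT_comp => //; apply: measurable_funM => //.
  apply: measurable_funM => //; apply: measurable_funB => //.
  exact: measurableT_comp.
have M0 : 0 <= M.
  have [w _] : exists w : T, True.
    apply: contrapT => /forallNP nT.
    have := @probability_setT _ _ _ P; rewrite (_ : setT = set0) ?measure0.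
      by move=> /eqP; rewrite eqe eq_sym oner_eq0.
    by apply/seteqP; split => // x; have := nT x.
  by apply: le_trans (HM w).
have bint (f : T -> R) : measurable_fun setT f -> (forall w, `|f w| <= 1) ->
    P.-integrable setT (EFin \o (fun w => f w * H w)).
  move=> mf f1; apply: (@bounded_integrable _ _ _ P _ M); first exact: measurable_funM.
  by move=> w; rewrite normrM (le_trans (ler_piMl _ (f1 w))).
have mg : measurable_fun setT (fun p : T * R => \int[nz]_x cos ((V p.1 - p.2) / s * x)).
  have -> : (fun p : T * R => \int[nz]_x cos ((V p.1 - p.2) / s * x)) =
    (fun p : T * R => expR (- (((V p.1 - p.2) / s) ^+ 2 / 2))).
    by apply/funext => p; rewrite normal_cos.
  apply: measurableT_comp => //; apply: measurableT_comp => //.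
  apply: measurable_funM => //; apply: measurable_funX; apply: measurable_funM => //.
  by apply: measurable_funB => //; exact: measurableT_comp.
have gb v : `|\int[nz]_x cos (v * x)| <= 1.
  by rewrite normal_cos ger0_norm ?expR_ge0// -[leRHS]expR0 ler_expR oppr_le0 divr_ge0// sqr_ge0.
have mk : measurable_fun setT (fun p : T * R => wgt c e s p.2 * \int[nz]_x cos ((V p.1 - p.2) / s * x)).
  by apply: measurable_funM => //; apply: measurableT_comp.
have kb w y : `|wgt c e s y * \int[nz]_x cos ((V w - y) / s * x)| <= K c e s.
  by rewrite normrM -[leRHS]mulr1 ler_pM.
have [mE _ _] := @bounded_Fubini _ _ _ _ _ P nz (fun w y => wgt c e s y * \int[nz]_x cos ((V w - y) / s * x)) _ mk kb.
split.
  rewrite (_ : (fun w => _) = (fun w => \int[nz]_y (wgt c e s y * \int[nz]_x cos ((V w - y) / s * x)))) //.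
  by apply/funext => w; rewrite normal_itvE.
transitivity (\int[P]_w \int[nz]_y (wgt c e s y * (\int[nz]_x cos ((V w - y) / s * x)) * H w)).
  apply: eq_Rintegral => w _; rewrite normal_itvE// RintegralZr//.
  apply: (@bounded_integrable _ _ _ nz _ (K c e s)) => //.
  exact: (measurableT_comp mk (pair1_measurable w)).
have mkH : measurable_fun setT (fun p : T * R => wgt c e s p.2 * \int[nz]_x cos ((V p.1 - p.2) / s * x) * H p.1).
  by apply: measurable_funM => //; apply: measurableT_comp.
have [_ _ ->] := @bounded_Fubini _ _ _ _ _ P nz (fun w y => wgt c e s y * (\int[nz]_x cos ((V w - y) / s * x)) * H w) (K c e s * M) mkH
   (fun w y => ltac:(rewrite normrM; exact: (ler_pM (normr_ge0 _) (normr_ge0 _) (kb w y) (HM w)))).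
apply: eq_Rintegral => y _.
have mgy : measurable_fun setT (fun w => \int[nz]_x cos ((V w - y) / s * x)).
  exact: (measurableT_comp mg (pair2_measurable y)).
under eq_Rintegral do rewrite -mulrA.
rewrite RintegralZl//; last by apply: bint.
congr (_ * _).
transitivity (\int[P]_w \int[nz]_x (cos ((V w - y) / s * x) * H w)).
  apply: eq_Rintegral => w _; rewrite RintegralZr//.
  apply: (@bounded_integrable _ _ _ nz _ 1) => //.
  exact: (measurableT_comp (mf3 y) (pair1_measurable w)).
have mf4 : measurable_fun setT (fun p : T * R => cos ((V p.1 - y) / s * p.2) * H p.1).
  by apply: measurable_funM => //; apply: measurableT_comp.
have [_ _ ->] := @bounded_Fubini _ _ _ _ _ P nz (fun w x => cos ((V w - y) / s * x) * H w) M mf4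
   (fun w x => ltac:(rewrite normrM; exact: (le_trans (ler_piMl (normr_ge0 _) (c1 _)) (HM w)))).
apply: eq_Rintegral => x _.
have mcV (t : R) : measurable_fun setT (fun w => cos (t * V w)).
  by apply: measurableT_comp => //; exact: measurable_funM.
have msV (t : R) : measurable_fun setT (fun w => sin (t * V w)).
  apply: measurableT_comp => //; last exact: measurable_funM.
  by apply: continuous_measurable_fun; exact: continuous_sin.
have iZ (k : R) f : P.-integrable setT (EFin \o f) ->
    P.-integrable setT (EFin \o (fun w => k * f w)).
  by move=> /(integrableZl measurableT k); apply: eq_integrable.
rewrite -!RintegralZl//; [|exact: bint..].
rewrite -RintegralD//; first last.
- by apply: iZ; exact: bint.
- by apply: iZ; exact: bint.
apply: eq_Rintegral => w _; rewrite !mulrA -mulrDl; congr (_ * _).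
rewrite -cosB -cosN; congr cos; ring.
Qed.

End one.

(** The standard deviation (n+1)^-2 is much smaller than the margin (n+1)^-1 by which the interval
    is widened. This makes the limit the indicator of the closed interval at its end points too;
    without the margin it would be 1/2 there. *)
Lemma normal_itv_cvg (c e v : R) :
  fine (normal_prob v (n.+1%:R ^- 2) `[c - n.+1%:R^-1, e + n.+1%:R^-1]%classic)
    @[n --> \oo] --> (\1_`[c, e] v : R).
Proof.
pose q n := normal_prob v (n.+1%:R ^- 2 : R) `[c - n.+1%:R^-1, e + n.+1%:R^-1]%classic.
pose b (n : nat) : R := Num.sqrt 2 * expR (- (n.+1%:R ^+ 2 / 4)).
have bconc n : (normal_prob v (n.+1%:R ^- 2) [set y : R | (n.+1%:R^-1 <= `|y - v|)%R] <= (b n)%:E)%E.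
  apply: (le_trans (normal_concentration _ _ _)).
  - by rewrite invr_gt0 exprn_gt0.
  - by rewrite invr_ge0.
  - rewrite lee_fin /b ler_wpM2l// ler_expR lerN2 le_eqVlt; apply/orP; left; apply/eqP.
    have : n.+1%:R != 0 :> R by rewrite pnatr_eq0.
    by move: (n.+1%:R) => z z0; field.
have b0 : b n @[n --> \oo] --> 0.
  rewrite -[X in _ --> X](mulr0 (Num.sqrt 2)); apply: cvgM; first exact: cvg_cst.
  apply/cvgr0Pnorm_le => eps eps0; near=> n.
  rewrite ger0_norm ?expR_ge0// expRN -[leRHS]invrK lef_pV2 ?posrE ?expR_gt0 ?invr_gt0//.
  apply: le_trans (expR_ge1Dx _).
  have : 4 * eps^-1 <= n%:R by near: n; exact: nbhs_infty_ger.
  have nn : n.+1%:R <= (n.+1%:R : R) ^+ 2 by rewrite expr2 ler_peMr// ler1n.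
  by move: nn; rewrite -natr1; lra.
have qfin n : q n \is a fin_num by exact: fin_num_measure.
rewrite indicE; case: (boolP (v \in _)) => [|].
  rewrite inE/= in_itv/= => /andP[cv ve].
  apply/subr_cvg0.
  apply: (@squeeze_cvgr _ _ _ _ (fun n => - b n) (fun n => 0)) => //; last 2 first.
  - by rewrite -oppr0; exact: cvgN.
  - exact: cvg_cst.
  near=> n; apply/andP; split; last first.
    rewrite subr_le0 -lee_fin (fineK (qfin n)).
    exact: (@probability_le1 _ _ _ (normal_prob v (n.+1%:R ^- 2))).
  suff : 1 <= fine (q n) + b n by rewrite /q /=; lra.
  rewrite -lee_fin EFinD (fineK (qfin n)).
  rewrite -(@probability_setT _ _ _ (normal_prob v (n.+1%:R ^- 2))).
  apply: le_trans (leeD2l _ (bconc n)).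
  apply: le_trans (measureU2 _ _ _) => //; last 1 first.
  - rewrite -[X in measurable X]setTI; apply: measurable_fun_le => //.
    by apply: measurableT_comp => //; exact: measurable_funB.
  apply: le_measure; rewrite ?inE//; first apply: measurableU => //.
  - rewrite -[X in measurable X]setTI; apply: measurable_fun_le => //.
    by apply: measurableT_comp => //; exact: measurable_funB.
  move=> y _ /=; rewrite in_itv/=.
  have [h|h] := leP (n.+1%:R^-1) `|y - v|; [by right|left].
  have alg (z r : R) : `|z - v| < r -> c - r <= z <= e + r.
    by rewrite ltr_norml => /andP[? ?]; apply/andP; split; lra.
  exact: alg.
rewrite notin_setE/= in_itv/= => /negP; rewrite negb_and -!ltNge => vce.
apply: (@squeeze_cvgr _ _ _ _ (fun n => 0) b) => //; last exact: cvg_cst.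
have [r r0 vr] : exists2 r : R, 0 < r & v <= c - r \/ e + r <= v.
  by case/orP: vce => h; [exists (c - v)|exists (v - e)]; rewrite ?subr_gt0//; [left|right]; lra.
near=> n; apply/andP; split; first by rewrite fine_ge0// measure_ge0.
rewrite -lee_fin (fineK (qfin n)); apply: le_trans (bconc n).
apply: le_measure; rewrite ?inE//.
- rewrite -[X in measurable X]setTI; apply: measurable_fun_le => //.
  by apply: measurableT_comp => //; exact: measurable_funB.
move=> y /=; rewrite in_itv/= => /andP[y1 y2].
have nr : n.+1%:R^-1 <= r / 2.
  rewrite -[leRHS]invrK lef_pV2 ?posrE ?invr_gt0 ?divr_gt0//.
  have : (r / 2)^-1 <= n%:R by near: n; exact: nbhs_infty_ger.
  rewrite -natr1; lra.
have alg (z t : R) : t <= r / 2 -> c - t <= z -> z <= e + t -> t <= `|z - v|.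
  have := ler_norm (z - v); have := ler_norm (v - z); rewrite (distrC v z).
  by case: vr => ?; lra.
exact: alg nr y1 y2.
Unshelve. all: by end_near.
Qed.

End Smoothing.

Section FourierUniqueness.
Context {d1 d2} {T1 : measurableType d1} {T2 : measurableType d2} {R : realType}.
Variables (P1 : probability T1 R) (P2 : probability T2 R).

(* A bounded weight times the law of a random variable is a signed measure on the
   line; two such measures with the same Fourier transform coincide. *)
Lemma fourier_unique (V1 H1 : T1 -> R) (V2 H2 : T2 -> R) (M1 M2 : R) :
  measurable_fun setT V1 -> measurable_fun setT H1 -> (forall w, `|H1 w| <= M1) ->
  measurable_fun setT V2 -> measurable_fun setT H2 -> (forall w, `|H2 w| <= M2) ->
  (forall s, \int[P1]_w (cos (s * V1 w) * H1 w) = \int[P2]_w (cos (s * V2 w) * H2 w)) ->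
  (forall s, \int[P1]_w (sin (s * V1 w) * H1 w) = \int[P2]_w (sin (s * V2 w) * H2 w)) ->
  forall A, measurable A ->
    (\int[P1]_(w in V1 @^-1` A) (H1 w)%:E = \int[P2]_(w in V2 @^-1` A) (H2 w)%:E)%E.
Proof.
move=> mV1 mH1 HM1 mV2 mH2 HM2 EC ES.
have iH1 : P1.-integrable setT (EFin \o H1) by exact: bounded_integrable HM1.
have iH2 : P2.-integrable setT (EFin \o H2) by exact: bounded_integrable HM2.
have lim1 d (T : measurableType d) (P : probability T R) (V H : T -> R) M c e :
    measurable_fun setT V -> measurable_fun setT H -> (forall w, `|H w| <= M) ->
    \int[P]_w (fine (normal_prob (V w) (n.+1%:R ^- 2) `[c - n.+1%:R^-1, e + n.+1%:R^-1]%classic) * H w)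
       @[n --> \oo] --> \int[P]_w (\1_`[c, e] (V w) * H w).
  move=> mV mH HM.
  have M0 (w : T) : 0 <= M by apply: le_trans (HM w).
  have [||||_ [_ //]] := @dominated_cvg_Rintegral _ _ R P
      (fun n w => fine (normal_prob (V w) (n.+1%:R ^- 2) `[c - n.+1%:R^-1, e + n.+1%:R^-1]%classic) * H w)
      (fun w => \1_`[c, e] (V w) * H w) (fun _ => M).
  - move=> n; apply: measurable_funM => //.
    by apply: (smoothing P mV mH HM _ _ _).1; rewrite invr_gt0 exprn_gt0.
  - by move=> w; apply: cvgM; [exact: normal_itv_cvg|exact: cvg_cst].
  - exact: finite_measure_integrable_cst.
  move=> n w; rewrite normrM -[leRHS]mul1r ler_pM// ger0_norm ?fine_ge0//.
  rewrite -lee_fin fineK ?fin_num_measure//.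
  exact: (@probability_le1 _ _ _ (normal_prob (V w) (n.+1%:R ^- 2))).
have itvE c e : \int[P1]_w (\1_`[c, e] (V1 w) * H1 w) = \int[P2]_w (\1_`[c, e] (V2 w) * H2 w).
  have l1 := lim1 _ _ P1 _ _ _ c e mV1 mH1 HM1.
  have l2 := lim1 _ _ P2 _ _ _ c e mV2 mH2 HM2.
  move: l1; rewrite (_ : (fun n => _) = (fun n : nat =>
     \int[P2]_w (fine (normal_prob (V2 w) (n.+1%:R ^- 2) `[c - n.+1%:R^-1, e + n.+1%:R^-1]%classic) * H2 w))).
    by move=> l1; exact: (cvg_unique _ l1 l2).
  apply/funext => n.
  have s0 : 0 < n.+1%:R ^- 2 :> R by rewrite invr_gt0 exprn_gt0.
  apply: (etrans (smoothing P1 mV1 mH1 HM1 _ _ s0).2).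
  apply: (etrans _ (esym (smoothing P2 mV2 mH2 HM2 _ _ s0).2)).
  apply: eq_Rintegral => y _; congr (_ * _); apply: eq_Rintegral => x _.
  by rewrite EC ES.
(* Half-lines are stable under intersection and generate the Borel sets, which is what the pi-lambda
   argument asks of its generators. *)
have rayE c : \int[P1]_w (\1_`[c, +oo[ (V1 w) * H1 w) = \int[P2]_w (\1_`[c, +oo[ (V2 w) * H2 w).
  have lim2 d (T : measurableType d) (P : probability T R) (V H : T -> R) M :
      measurable_fun setT V -> measurable_fun setT H -> (forall w, `|H w| <= M) ->
      \int[P]_w (\1_`[c, n%:R] (V w) * H w)
       @[n --> \oo] --> \int[P]_w (\1_`[c, +oo[ (V w) * H w).
    move=> mV mH HM.
    have [||||_ [_ //]] := @dominated_cvg_Rintegral _ _ R P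
      (fun n w => \1_`[c, n%:R] (V w) * H w) (fun w => \1_`[c, +oo[ (V w) * H w) (fun _ => M).
    - move=> n; apply: measurable_funM => //; apply: measurableT_comp => //; exact: measurable_indic.
    - move=> w; apply: cvg_near_cst; near=> n; congr (_ * _).
      rewrite !indicE; congr (_%:R); congr nat_of_bool.
      apply/idP/idP; rewrite !inE/= !in_itv/= andbT; first by case/andP.
      move=> ->/=; near: n; exact: nbhs_infty_ger.
    - exact: finite_measure_integrable_cst.
    move=> n w; rewrite normrM -[leRHS]mul1r ler_pM// indicE ger0_norm//.
    by case: (_ \in _); rewrite /= ?ler01.
  have l1 := lim2 _ _ P1 _ _ _ mV1 mH1 HM1.
  have l2 := lim2 _ _ P2 _ _ _ mV2 mH2 HM2.
  move: l1; under eq_fun do rewrite itvE.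
  by move=> l1; exact: (cvg_unique _ l1 l2).
apply: (weighted_dynkin mV1 mV2 iH1 iH2 (RGenCInfty.measurableE R)).
- move=> _ _ [x ->] [y ->]; exists (Num.max x y); apply/seteqP; split => z /=;
    rewrite !in_itv/= !andbT ge_max; [by case=> -> ->|by case/andP].
- rewrite !preimage_setT.
  (* The total masses are the values of the cosine transforms at 0. *)
  have E1 := EC 0; move: E1.
  under eq_Rintegral do rewrite mul0r cos0 mul1r.
  under [RHS]eq_Rintegral do rewrite mul0r cos0 mul1r.
  rewrite /Rintegral => E1.
  rewrite -[LHS]fineK ?[in LHS]E1 ?fineK//; exact: integrable_fin_num.
- move=> _ [x ->].
  have conv d (T : measurableType d) (P : probability T R) (V H : T -> R) :
     measurable_fun setT V -> P.-integrable setT (EFin \o H) ->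
     (\int[P]_(w in V @^-1` `[x, +oo[) (H w)%:E)%E = (\int[P]_w (\1_`[x, +oo[ (V w) * H w))%:E.
    move=> mV iH.
    have mA : measurable (V @^-1` `[x, +oo[) by rewrite -[X in measurable X]setTI; exact: mV.
    rewrite -[LHS]fineK; last first.
      by apply: integrable_fin_num => //; apply: integrableS iH.
    rewrite -/(Rintegral P _ H) Rintegral_mkcond; congr EFin; apply: eq_Rintegral => w _.
    rewrite patchE indicE; have -> : (w \in V @^-1` `[x, +oo[) = (V w \in `[x, +oo[%classic) by [].
    by case: ifP; rewrite ?mul1r ?mul0r.
  by rewrite !conv// rayE.
Unshelve. all: by end_near.
Qed.

End FourierUniqueness.

Section NormalAffine.
Context {R : realType}.
Notation nz := (normal_prob (0:R) 1).
Notation mu := (@lebesgue_measure R).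

Lemma ge0_integral_normal_affine (m s : R) (G : R -> R) : 0 < s ->
  continuous G -> (forall x, 0 <= G x) ->
  (\int[normal_prob m s]_x (G x)%:E = \int[nz]_x (G (m + s * x))%:E)%E.
Proof.
move=> s0 cG G0.
have cF : continuous (fun x : R => m + s * x).
  by move=> x; apply: cvgD; [exact: cvg_cst|exact: mulrl_continuous].
have mG : measurable_fun setT G by exact: continuous_measurable_fun.
have mGF : measurable_fun setT (fun x : R => G (m + s * x)).
  by apply: measurableT_comp => //; exact: continuous_measurable_fun.
rewrite ge0_integral_normal; [|exact/measurable_EFinP|by move=> x; rewrite lee_fin].
have mp : measurable_fun setT (normal_pdf m s) by exact: measurable_normal_pdf.
have p0 x : 0 <= normal_pdf m s x by exact: normal_pdf_ge0.
have nE (A : set R) : measurable A ->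
  (normal_prob m s A = \int[mu]_(x in A) (normal_pdf m s x)%:E)%E by [].
have mGE : measurable_fun setT (EFin \o G) by exact/measurable_EFinP.
have E : (\int[normal_prob m s]_x (G x)%:E = \int[mu]_x ((G x)%:E * (normal_pdf m s x)%:E))%E.
  apply: (@ge0_integral_density _ _ R mu (normal_prob m s) (normal_pdf m s) (EFin \o G) mp p0 _ mGE).
    by move=> A; exact: nE.
  by move=> x; rewrite lee_fin.
apply: (etrans E) => {E}.
under eq_integral do rewrite -EFinM.
have F'E : derive1 (fun x : R => m + s * x) = cst s.
  apply/funext => x; rewrite derive1E; have H : is_derive x 1 (fun x : R => m + s * x) s.
    by apply: is_derive_eq; rewrite /GRing.scale/=; ring.
  by case: H.
rewrite (@increasing_ge0_integration_by_substitutionT R (fun x => m + s * x)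
  (fun x => G x * normal_pdf m s x)).
- apply: eq_integral => x _; rewrite F'E /= -EFinM; congr EFin.
  rewrite -mulrA; congr (_ * _); rewrite normal_pdf1E normal_pdfE ?gt_eqF//.
  have -> : normal_peak s = s^-1 * normal_peak 1.
    rewrite /normal_peak expr1n mul1r -mulrnAr sqrtrM ?sqr_ge0// sqrtr_sqr gtr0_norm//.
    by rewrite invfM.
  rewrite !fctE /=; have -> : normal_fun m s (m + s * x) = expR (- (x ^+ 2 / 2)).
    rewrite /normal_fun; congr expR.
    have -> : s ^+ 2 *+ 2 = 2 * s ^+ 2 by ring.
    by field; rewrite gt_eqF.
  move: (normal_peak _) (expR _) => p q.
  have s1 : s != 0 by rewrite gt_eqF.
  by clear - s1; field.
- by move=> x y xy; rewrite ltrD2l ltr_pM2l.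
- by rewrite F'E => x; exact: cvg_cst.
- by rewrite F'E; exact: is_cvg_cst.
- by rewrite F'E; exact: is_cvg_cst.
- move=> x; have H : is_derive x 1 (fun x : R => m + s * x) s.
    by apply: is_derive_eq; rewrite /GRing.scale/=; ring.
  by case: H.
- apply/cvgrNyPle => A; near=> x.
  have : x <= (A - m) / s by near: x; apply: nbhs_ninfty_le; exact: num_real.
  by rewrite ler_pdivlMr// => ?; lra.
- apply/cvgryPge => A; near=> x.
  have : (A - m) / s <= x by near: x; apply: nbhs_pinfty_ge; exact: num_real.
  by rewrite ler_pdivrMr// => ?; lra.
- by move=> x; apply: cvgM; [exact: cG|apply: continuous_normal_pdf; rewrite gt_eqF].
- by move=> x; rewrite mulr_ge0 ?normal_pdf_ge0.
Unshelve. all: by end_near.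
Qed.

Lemma integral_normal_affine (m s : R) (G : R -> R) : 0 < s -> continuous G ->
  (\int[normal_prob m s]_x (G x)%:E = \int[nz]_x (G (m + s * x))%:E)%E.
Proof.
move=> s0 cG; rewrite integralE [RHS]integralE.
have c1 : continuous (fun x => Num.max (G x) 0).
  by move=> x; apply: (@continuous_max _ _ G (fun=> 0)); [exact: cG|exact: cvg_cst].
have c2 : continuous (fun x => Num.max (- G x) 0).
  by move=> x; apply: (@continuous_max _ _ (fun x => - G x) (fun=> 0)); [apply: cvgN; exact: cG|exact: cvg_cst].
have h1 := @ge0_integral_normal_affine m s _ s0 c1 (fun x => ltac:(by rewrite le_max lexx orbT)).
have h2 := @ge0_integral_normal_affine m s _ s0 c2 (fun x => ltac:(by rewrite le_max lexx orbT)).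
have e1 : (\int[normal_prob m s]_x ((EFin \o G)^\+ x) =
           \int[nz]_x ((fun x => (G (m + s * x))%:E)^\+ x))%E.
  transitivity (\int[normal_prob m s]_x (Num.max (G x) 0)%:E)%E.
    apply: eq_integral; by move=> x _; rewrite funeposE EFin_max.
  apply: (etrans h1); apply: eq_integral => x _; by rewrite funeposE EFin_max.
have e2 : (\int[normal_prob m s]_x ((EFin \o G)^\- x) =
           \int[nz]_x ((fun x => (G (m + s * x))%:E)^\- x))%E.
  transitivity (\int[normal_prob m s]_x (Num.max (- G x) 0)%:E)%E.
    apply: eq_integral; by move=> x _; rewrite funenegE EFin_max.
  apply: (etrans h2); apply: eq_integral => x _; by rewrite funenegE EFin_max.
exact: (f_equal2 (fun a b => a - b)%E e1 e2).
Qed.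

Lemma normal_mean : nz.-integrable setT (EFin \o (fun x : R => x)) /\ \int[nz]_x x = 0.
Proof.
split.
  apply: (le_integrable measurableT _ _ integrable_id_normal).
    by apply/measurable_EFinP; exact: measurable_id.
  by move=> x _; rewrite /= normr_id.
have H := @normal_stein R (fun=> 1) (fun=> 0) 0 (fun x => is_derive_cst _ _ _) _ _ _.
transitivity (\int[nz]_x (x * 1)); first by apply: eq_Rintegral => x _; rewrite mulr1.
rewrite H ?Rintegral_cst ?mul0r// => x; [exact: cvg_cst|by rewrite normr1|by rewrite normr0].
Qed.

Lemma norm_sin_le (x : R) : `|sin x| <= `|x|.
Proof.
wlog x0 : x / 0 <= x => [H|].
  have [|/ltW x0] := leP 0 x; first exact: H.
  by rewrite -normrN -sinN -[leRHS]normrN H// oppr_ge0.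
move: x0; rewrite le_eqVlt => /predU1P[<-|x0]; first by rewrite sin0.
have [|c _] := @MVT R sin cos 0 x x0 (fun y _ => is_derive_sin y).
  by apply: continuous_subspaceT; exact: continuous_sin.
rewrite sin0 !subr0 => ->; rewrite normrM ler_piMl//.
by rewrite ler_norml cos_geN1 cos_le1.
Qed.

(** [normal_stein] wants a bounded function, so x is replaced by sin(a x)/a with a = 1/(n+1). Then x
    sin(a x)/a has mean exp(-a^2 / 2), which tends to 1, and is dominated by x^2. *)
Lemma normal_variance : nz.-integrable setT (EFin \o (fun x : R => x ^+ 2)) /\
  \int[nz]_x (x ^+ 2) = 1.
Proof.
have i2 : nz.-integrable setT (EFin \o (fun x : R => x ^+ 2)).
  (* The dominating function is 4 exp(x^2 / 4). *)
  have [i _] := @integrable_expR_normal R 2^-1 0 ltac:(lra).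
  have i4 := integrableZl measurableT 4 i.
  apply: (le_integrable measurableT _ _ i4).
    by apply/measurable_EFinP; exact: measurable_funX.
  move=> x _ /=; rewrite lee_fin ger0_norm ?sqr_ge0//.
  have := expR_ge1Dx (2^-1 * x ^+ 2 / 2 + x * 0).
  have := expR_ge0 (2^-1 * x ^+ 2 / 2 + x * 0).
  move: (expR _) => E E0 H; rewrite ger0_norm; last by rewrite mulr_ge0.
  by move: H; rewrite mulr0 addr0 => H; nra.
split => //.
pose a (n : nat) : R := n.+1%:R^-1.
have a0 n : a n != 0 by rewrite invr_neq0// pnatr_eq0.
have ac : a n @[n --> \oo] --> (0 : R) by exact: cvg_harmonic.
have L1 : \int[nz]_x (x * ((a n)^-1 * sin (a n * x))) @[n --> \oo] --> \int[nz]_x (x ^+ 2).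
  have [||||_ [_ //]] := @dominated_cvg_Rintegral _ _ R nz
    (fun n x => x * ((a n)^-1 * sin (a n * x))) (fun x => x ^+ 2) (fun x => x ^+ 2).
  - move=> n; apply: measurable_funM => //; apply: measurable_funM => //.
    by apply: continuous_measurable_fun => x; apply: continuous_comp;
      [exact: mulrl_continuous|exact: continuous_sin].
  - move=> x; rewrite expr2; apply: cvgM; first exact: cvg_cst.
    have D : is_derive (0:R) 1 (fun h : R => sin (h * x)) x.
      by apply: is_derive_eq; rewrite /GRing.scale/= mul0r cos0; ring.
    have [/cvg_ex[l hl] De] := D.
    have lx : l = x by rewrite -De; apply/esym/cvg_lim.
    move: hl => /cvgr_dnbhsP/(_ a (conj a0 ac)); rewrite lx.
    apply: cvg_trans; apply: near_eq_cvg; apply: nearW => n /=.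
    by rewrite /GRing.scale/= addr0 mul0r sin0 subr0 mulr1.
  - exact: i2.
  - move=> n x; rewrite !normrM normfV.
    apply: (@le_trans _ _ (`|x| * (`|a n|^-1 * (`|a n| * `|x|)))).
      by rewrite !ler_wpM2l ?invr_ge0// -normrM norm_sin_le.
    by rewrite mulKf ?normr_eq0// -expr2 real_normK ?num_real.
have L2 : \int[nz]_x (x * ((a n)^-1 * sin (a n * x))) @[n --> \oo] --> (1:R).
  have -> : (fun n => \int[nz]_x (x * ((a n)^-1 * sin (a n * x)))) =
     (fun n => expR (- ((a n) ^+ 2 / 2))).
    apply/funext => n.
    transitivity ((a n)^-1 * \int[nz]_x (x * sin (a n * x))).
      rewrite -RintegralZl//; first by apply: eq_Rintegral => x _; ring.
      apply: (le_integrable measurableT _ _ integrable_id_normal).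
        apply/measurable_EFinP; apply: measurable_funM => //.
        by apply: continuous_measurable_fun => x; apply: continuous_comp;
          [exact: mulrl_continuous|exact: continuous_sin].
      by move=> x _ /=; rewrite lee_fin normr_id normrM ler_piMr// ler_norml sin_geN1 sin_le1.
    have D (x : R) : is_derive x 1 (fun x : R => sin (a n * x)) (a n * cos (a n * x)).
      by apply: is_derive_eq; rewrite /GRing.scale/=; ring.
    have cc : continuous (fun x : R => a n * cos (a n * x)).
      move=> x; apply: cvgM; first exact: cvg_cst.
      by apply: continuous_comp; [exact: mulrl_continuous|exact: continuous_cos].
    rewrite (normal_stein (M := `|a n|) D cc); last 2 first.
    - by move=> x; rewrite ler_norml sin_geN1 sin_le1.
    - by move=> x; rewrite normrM ler_piMr// ler_norml cos_geN1 cos_le1.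
    rewrite RintegralZl//; first by rewrite normal_cos mulKf.
    apply: (@bounded_integrable _ _ _ nz _ 1).
      by apply: continuous_measurable_fun => x; apply: continuous_comp;
        [exact: mulrl_continuous|exact: continuous_cos].
    by move=> x; rewrite ler_norml cos_geN1 cos_le1.
  have h : (a n) ^+ 2 @[n --> \oo] --> (0:R).
    have h2 : (fun n => a n * a n) @ \oo --> (0 * 0 : R) by exact: cvgM.
    by move: h2; rewrite mulr0; under eq_fun do rewrite -expr2.
  have h3 : (fun n => - (a n ^+ 2 / 2)) @ \oo --> (- (0 / 2) : R).
    by apply: cvgN; apply: cvgM; [exact: h|exact: cvg_cst].
  have h4 : (fun n => - (a n ^+ 2 / 2)) @ \oo --> (0 : R) by move: h3; rewrite mul0r oppr0.
  have h5 : (fun n => expR (- (a n ^+ 2 / 2))) @ \oo --> expR (0 : R).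
    by apply: continuous_cvg; [exact: continuous_expR|exact: h4].
  by move: h5; rewrite expR0.
exact: (cvg_unique _ L1 L2).
Qed.

End NormalAffine.

(** * Centered normal laws, including the degenerate one *)

Section CenteredGaussian.
Context {d} {T : measurableType d} {R : realType} (P : probability T R).
Notation nz := (normal_prob (0:R) 1).
Implicit Types (Y : T -> R) (v : R).

(* The law N(0, v), with v = 0 allowed, in terms of its Fourier transform. *)
Definition cgauss Y v : Prop := [/\ measurable_fun setT Y, 0 <= v,
  forall s, \int[P]_w cos (s * Y w) = expR (- (s ^+ 2 * v / 2)) &
  forall s, \int[P]_w sin (s * Y w) = 0].

Lemma measurable_cos Y s : measurable_fun setT Y -> measurable_fun setT (fun w => cos (s * Y w)).
Proof.
move=> mY; apply: measurableT_comp; last exact: measurable_funM.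
by apply: continuous_measurable_fun; exact: continuous_cos.
Qed.

Lemma measurable_sin Y s : measurable_fun setT Y -> measurable_fun setT (fun w => sin (s * Y w)).
Proof.
move=> mY; apply: measurableT_comp; last exact: measurable_funM.
by apply: continuous_measurable_fun; exact: continuous_sin.
Qed.

Lemma norm_cos_le1 (x : R) : `|cos x| <= 1.
Proof. by rewrite ler_norml cos_geN1 cos_le1. Qed.

Lemma norm_sin_le1 (x : R) : `|sin x| <= 1.
Proof. by rewrite ler_norml sin_geN1 sin_le1. Qed.

Lemma integrable_cos Y s : measurable_fun setT Y ->
  P.-integrable setT (EFin \o (fun w => cos (s * Y w))).
Proof.
move=> mY; apply: (@bounded_integrable _ _ _ P _ 1); first exact: measurable_cos.
by move=> w; exact: norm_cos_le1.
Qed.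

Lemma integrable_sin Y s : measurable_fun setT Y ->
  P.-integrable setT (EFin \o (fun w => sin (s * Y w))).
Proof.
move=> mY; apply: (@bounded_integrable _ _ _ P _ 1); first exact: measurable_sin.
by move=> w; exact: norm_sin_le1.
Qed.

(** Dominated convergence gives the limits of the transforms. The variances are recovered by a
    logarithm at one point s where the limit transform is positive, so their convergence is a
    conclusion and not an assumption. *)
Lemma cgauss_cvg (Y_ : nat -> T -> R) (v_ : nat -> R) Y :
  (forall n, cgauss (Y_ n) (v_ n)) -> (forall w, Y_ n w @[n --> \oo] --> Y w) ->
  exists2 v, cgauss Y v & v_ n @[n --> \oo] --> v.
Proof.
move=> gY cY.
have mY_ n : measurable_fun setT (Y_ n) by case: (gY n).
have mY : measurable_fun setT Y.
  apply/measurable_EFinP; apply: (emeasurable_fun_cvg (fun n => EFin \o Y_ n)).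
    by move=> n; exact/measurable_EFinP.
  by move=> x _; apply: cvg_EFin; [exact: nearW|exact: cY].
have one : P.-integrable setT (EFin \o (fun=> 1 : R)) by exact: finite_measure_integrable_cst.
have lc s : expR (- (s ^+ 2 * v_ n / 2)) @[n --> \oo] --> \int[P]_w cos (s * Y w).
  have [||||_ [_]] := @dominated_cvg_Rintegral _ _ R P
    (fun n w => cos (s * Y_ n w)) (fun w => cos (s * Y w)) (fun=> 1).
  - by move=> n; exact: measurable_cos.
  - move=> w; apply: continuous_cvg; first exact: continuous_cos.
    by apply: cvgM; [exact: cvg_cst|exact: cY].
  - exact: one.
  - by move=> n w; exact: norm_cos_le1.
  have -> // : (fun n => \int[P]_w cos (s * Y_ n w)) = (fun n => expR (- (s ^+ 2 * v_ n / 2))).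
  by apply/funext => n; case: (gY n).
have ls s : \int[P]_w sin (s * Y w) = 0.
  have [||||_ [_]] := @dominated_cvg_Rintegral _ _ R P
    (fun n w => sin (s * Y_ n w)) (fun w => sin (s * Y w)) (fun=> 1).
  - by move=> n; exact: measurable_sin.
  - move=> w; apply: continuous_cvg; first exact: continuous_sin.
    by apply: cvgM; [exact: cvg_cst|exact: cY].
  - exact: one.
  - by move=> n w; exact: norm_sin_le1.
  have -> : (fun n => \int[P]_w sin (s * Y_ n w)) = (fun=> 0) by apply/funext => n; case: (gY n).
  by move=> h; exact: (cvg_unique _ h (cvg_cst _)).
(* The limit transform tends to 1 at the origin, hence is positive at some nonzero s; s must be
   nonzero to be divided out of the logarithm. *)
have [s [s0 Cs]] : exists s : R, s != 0 /\ 0 < \int[P]_w cos (s * Y w).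
  have [||||_ [_]] := @dominated_cvg_Rintegral _ _ R P
    (fun n w => cos (n.+1%:R^-1 * Y w)) (fun w => 1) (fun=> 1).
  - by move=> n; exact: measurable_cos.
  - move=> w; rewrite -[X in _ --> X]cos0; apply: continuous_cvg; first exact: continuous_cos.
    by rewrite -(mul0r (Y w)); apply: cvgM; [exact: cvg_harmonic|exact: cvg_cst].
  - exact: one.
  - by move=> n w; exact: norm_cos_le1.
  rewrite Rintegral_cst//= probability_setT mulr1 => h.
  have [n _ hn] := cvgr_gt _ h _ (@ltr01 R).
  exists n.+1%:R^-1; split; first by rewrite invr_neq0// pnatr_eq0.
  exact: (hn n (leqnn n)).
pose v := - (ln (\int[P]_w cos (s * Y w)) * 2 / s ^+ 2).
have vv : v_ n @[n --> \oo] --> v.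
  have h : ln (expR (- (s ^+ 2 * v_ n / 2))) @[n --> \oo] --> ln (\int[P]_w cos (s * Y w)).
    by apply: continuous_cvg; [exact: continuous_ln|exact: lc].
  have -> : v_ = fun n => - (ln (expR (- (s ^+ 2 * v_ n / 2))) * 2 / s ^+ 2).
    by apply/funext => n; rewrite expRK; field.
  by apply: cvgN; apply: cvgM; [apply: cvgM => //|]; exact: cvg_cst.
exists v => //; split => //.
- apply: (cvgr_to_ge vv); apply: nearW => n; by case: (gY n).
- move=> t; have lt : (fun n => expR (- (t ^+ 2 * v_ n / 2))) @ \oo --> expR (- (t ^+ 2 * v / 2)); last exact: (cvg_unique _ (lc t) lt).
  apply: continuous_cvg; first exact: continuous_expR.
  apply: cvgN.
  by apply: cvgM; [apply: cvgM => //|]; exact: cvg_cst.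
Qed.

(** Fourier uniqueness with constant weights 1, against the variable x -> sqrt(v) x under the
    standard normal law; [v = 0] needs no separate treatment. *)
Lemma cgauss_law Y v : cgauss Y v ->
  forall A, measurable A ->
  P (Y @^-1` A) = nz ((fun x => Num.sqrt v * x) @^-1` A).
Proof.
move=> [mY v0 hc hs] A mA.
have mS : measurable_fun setT (fun x : R => Num.sqrt v * x) by exact: measurable_funM.
have mA1 : measurable (Y @^-1` A) by rewrite -[X in measurable X]setTI; exact: mY.
have mA2 : measurable ((fun x : R => Num.sqrt v * x) @^-1` A).
  by rewrite -[X in measurable X]setTI; exact: mS.
have e1 : (\int[P]_(w in Y @^-1` A) (1:R)%:E = P (Y @^-1` A))%E.
  by rewrite integral_cst// mul1e.
have e2 : (\int[nz]_(w in (fun x : R => (Num.sqrt v * x)%R) @^-1` A) (1:R)%:E =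
    nz ((fun x : R => (Num.sqrt v * x)%R) @^-1` A))%E.
  by rewrite integral_cst// mul1e.
rewrite -e1 -e2.
have b1 (U : Type) (w : U) : `|1 : R| <= 1 by rewrite normr1.
apply: (@fourier_unique _ _ _ _ R P nz Y (fun=> 1) (fun x => Num.sqrt v * x) (fun=> 1) 1 1 mY
  (measurable_cst _) (b1 _) mS (measurable_cst _) (b1 _) _ _ _ mA) => s.
- under eq_Rintegral do rewrite mulr1.
  rewrite hc; under eq_Rintegral do rewrite mulr1 mulrA.
  by rewrite normal_cos exprMn sqr_sqrtr.
- under eq_Rintegral do rewrite mulr1.
  rewrite hs; under eq_Rintegral do rewrite mulr1 mulrA.
  by rewrite normal_sin.
Qed.

Lemma cgauss_ge0_integral Y v (f : R -> \bar R) : cgauss Y v ->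
  measurable_fun setT f -> (forall x, 0 <= f x)%E ->
  (\int[P]_w f (Y w) = \int[nz]_x f (Num.sqrt v * x)%R)%E.
Proof.
move=> gY mf f0; have [mY v0 _ _] := gY.
have mS : measurable_fun setT (fun x : R => Num.sqrt v * x) by exact: measurable_funM.
transitivity (\int[pushforward P Y]_x f x)%E.
  by rewrite ge0_integral_pushforward// preimage_setT.
transitivity (\int[pushforward nz (fun x => (Num.sqrt v * x)%R)]_x f x)%E; last first.
  by rewrite ge0_integral_pushforward// preimage_setT.
by apply: eq_measure_integral => A mA _; exact: (cgauss_law gY mA).
Qed.

Lemma cgauss_variance Y v : cgauss Y v ->
  P.-integrable setT (EFin \o (fun w => Y w ^+ 2)) /\ \int[P]_w (Y w ^+ 2) = v.
Proof.
move=> gY; have [mY v0 _ _] := gY.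
have [i2 E2] := @normal_variance R.
have E : (\int[P]_w (Y w ^+ 2)%:E = v%:E)%E.
  rewrite (cgauss_ge0_integral (f := fun x => (x ^+ 2)%:E) gY); last 2 first.
  - by apply/measurable_EFinP; exact: measurable_funX.
  - by move=> x; rewrite lee_fin sqr_ge0.
  under eq_integral do rewrite exprMn sqr_sqrtr// EFinM.
  rewrite integralZl//; rewrite -[X in (_ * X)%E]fineK; last exact: integrable_fin_num.
  by rewrite -/(Rintegral nz setT _) E2 mule1.
split; last by rewrite /Rintegral E.
apply/integrableP; split; first by apply/measurable_EFinP; exact: measurable_funX.
under eq_integral do rewrite /= ger0_norm ?sqr_ge0//.
by rewrite E ltry.
Qed.

(** The bound is stated for any positive [v'] above the variance, since later only upper bounds on
    variances are at hand and the variance itself may vanish. *)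
Lemma cgauss_tail Y v v' y : cgauss Y v -> v <= v' -> 0 < v' -> 0 < y ->
  (P [set w | (y <= Y w)%R] <= (expR (- (y ^+ 2 / (2 * v'))))%:E)%E.
Proof.
move=> gY vv v'0 y0; have [mY v0 _ _] := gY.
have -> : [set w | y <= Y w] = Y @^-1` `[y, +oo[.
  by apply/seteqP; split => w /=; rewrite in_itv/= andbT.
rewrite (cgauss_law gY)//.
move: v0; rewrite le_eqVlt => /predU1P[v0|v0].
  rewrite (_ : _ @^-1` _ = set0) ?measure0 ?lee_fin ?expR_ge0//.
  apply/seteqP; split => // x /=; rewrite in_itv/= andbT -v0 sqrtr0 mul0r.
  by rewrite leNgt y0.
have s0 : 0 < Num.sqrt v by rewrite sqrtr_gt0.
have -> : (fun x => Num.sqrt v * x) @^-1` `[y, +oo[ = `[y / Num.sqrt v, +oo[%classic.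
  by apply/seteqP; split => x /=; rewrite !in_itv/= !andbT ler_pdivrMr// mulrC.
apply: (le_trans (normal_tail _)); first by rewrite divr_ge0// ltW.
rewrite lee_fin ler_expR lerN2 expr_div_n (sqr_sqrtr (ltW v0)).
rewrite ler_pdivrMr ?mulr_gt0//.
have -> : y ^+ 2 / v / 2 * (2 * v') = y ^+ 2 * (v' / v) by field; rewrite gt_eqF.
by rewrite ler_peMr ?sqr_ge0// ler_pdivlMr// mul1r.
Qed.

End CenteredGaussian.

(** * Linear spaces of centered Gaussian variables *)

Section GaussianTransform.
Context {d} {T : measurableType d} {R : realType} (P : probability T R).
Notation nz := (normal_prob (0:R) 1).

Lemma integral_lawE (nu : {measure set (measurableTypeR R) -> \bar R}) (Y : T -> R)
    (G : R -> \bar R) :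
  measurable_fun setT Y -> measurable_fun setT G ->
  (forall A, measurable A -> P (Y @^-1` A) = nu A) ->
  (\int[P]_w G (Y w) = \int[nu]_x G x)%E.
Proof.
move=> mY mG HY.
have ge0 (f : R -> \bar R) : measurable_fun setT f -> (forall x, 0 <= f x)%E ->
    (\int[P]_w f (Y w) = \int[nu]_x f x)%E.
  move=> mf f0; transitivity (\int[pushforward P Y]_x f x)%E.
    by rewrite ge0_integral_pushforward// preimage_setT.
  have mid : measurable_fun setT (idfun : measurableTypeR R -> R) by exact: measurable_id.
  transitivity (\int[pushforward nu (idfun : measurableTypeR R -> R)]_x f x)%E; last first.
    by rewrite ge0_integral_pushforward// preimage_setT.
  by apply: eq_measure_integral => A mA _; exact: HY.
rewrite integralE [RHS]integralE.
have e1 : (\int[P]_w ((fun w => G (Y w))^\+ w) = \int[nu]_x (G^\+ x))%E.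
  rewrite -ge0//; last exact: measurable_funepos.
  by apply: eq_integral => w _; rewrite /= !funeposE.
have e2 : (\int[P]_w ((fun w => G (Y w))^\- w) = \int[nu]_x (G^\- x))%E.
  rewrite -ge0//; last exact: measurable_funeneg.
  by apply: eq_integral => w _; rewrite /= !funenegE.
exact: (f_equal2 (fun a b => a - b)%E e1 e2).
Qed.

(** In both clauses of [gaussian] the vanishing expectation forces [m = 0]; the Dirac clause gives
    variance 0. *)
Lemma gaussian_cgauss (Y : T -> R) : gaussian P Y -> ('E_P[Y] = 0)%E ->
  exists v, cgauss P Y v.
Proof.
move=> [mY [m [HD|[s [s0 HN]]]]] EY.
- have PY : P (Y @^-1` (~` [set m])) = 0%E.
    have := HD (~` [set m]) (measurableC (measurable_set1 m)).
    by rewrite /pushforward => ->; rewrite diracE memNset//= => /(_ erefl).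
  have cst_int (f : R -> R) : measurable_fun setT f -> (\int[P]_w (f (Y w))%:E = (f m)%:E)%E.
    move=> mf; transitivity (\int[P]_w (cst (f m)%:E) w)%E; last first.
      by rewrite integral_cst//= probability_setT mule1.
    apply: ae_eq_integral => //.
    - by apply/measurable_EFinP; exact: measurableT_comp.
    - exists (Y @^-1` (~` [set m])); split => //.
        rewrite -[X in measurable X]setTI; exact: (mY measurableT _ (measurableC (measurable_set1 m))).
      by move=> w /= h Ym; apply: h => _; rewrite Ym.
  have m0 : m = 0.
    have := cst_int idfun (@measurable_id _ _ _).
    by move: EY; rewrite unlock /= => -> [].
  exists 0; split => //.
  + move=> t; rewrite mulr0 mul0r oppr0 expR0 /Rintegral.
    rewrite (cst_int (fun x => cos (t * x))); first by rewrite /= m0 mulr0 cos0.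
    by apply: continuous_measurable_fun => x; apply: continuous_comp;
      [exact: mulrl_continuous|exact: continuous_cos].
  + move=> t; rewrite /Rintegral.
    rewrite (cst_int (fun x => sin (t * x))); first by rewrite /= m0 mulr0 sin0.
    by apply: continuous_measurable_fun => x; apply: continuous_comp;
      [exact: mulrl_continuous|exact: continuous_sin].
- have H (f : R -> R) : continuous f ->
      (\int[P]_w (f (Y w))%:E = \int[nz]_x (f (m + s * x)%R)%:E)%E.
    move=> cf; have mf : measurable_fun setT f by exact: continuous_measurable_fun.
    have mEf : measurable_fun setT (EFin \o f) by exact/measurable_EFinP.
    apply: (etrans _ (integral_normal_affine m s0 cf)).
    by apply: (@integral_lawE (normal_prob m s) Y (EFin \o f)) => // A mA; exact: HN.
  have m0 : m = 0.
    have [i1 E1] := @normal_mean R.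
    have := H idfun (fun x => cvg_id).
    have -> : (\int[P]_w (idfun (Y w))%:E = 'E_P[Y])%E by rewrite unlock.
    rewrite EY => /(congr1 fine)/=.
    have -> : fine (\int[nz]_x (idfun (m + s * x)%R)%:E)%E = \int[nz]_x (m + s * x) by [].
    have i2 : nz.-integrable setT (EFin \o (fun x : R => s * x)).
      by have := integrableZl measurableT s i1; apply: eq_integrable.
    rewrite RintegralD//; last exact: finite_measure_integrable_cst.
    rewrite RintegralZl// E1 Rintegral_cst//= probability_setT mulr1 mulr0 addr0.
    by move=> <-.
  have ccos (t : R) : continuous (fun x : R => cos (t * x)).
    by move=> x; apply: continuous_comp; [exact: mulrl_continuous|exact: continuous_cos].
  have csin (t : R) : continuous (fun x : R => sin (t * x)).
    by move=> x; apply: continuous_comp; [exact: mulrl_continuous|exact: continuous_sin].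
  exists (s ^+ 2); split => //; first exact: sqr_ge0.
  + move=> t; rewrite /Rintegral (H _ (ccos t)) m0.
    transitivity (\int[nz]_x cos (t * s * x)).
      by apply: eq_Rintegral => x _; rewrite add0r mulrA.
    by rewrite normal_cos exprMn.
  + move=> t; rewrite /Rintegral (H _ (csin t)) m0.
    transitivity (\int[nz]_x sin (t * s * x)).
      by apply: eq_Rintegral => x _; rewrite add0r mulrA.
    by rewrite normal_sin.
Qed.

End GaussianTransform.

Section GaussianSpace.
Context {d} {T : measurableType d} {R : realType} (P : probability T R).
Implicit Types (S : set (T -> R)) (Y Z : T -> R).

(* A linear space of centered Gaussian variables, so that any finite family in it
   is jointly Gaussian. *)
Definition gspace S : Prop := [/\ S (fun=> 0),
  forall a Y Z, S Y -> S Z -> S (fun w => a * Y w + Z w) &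
  forall Y, S Y -> exists v, cgauss P Y v].

(** Closure under sequential limits at every point of the space, not almost surely. It is meant for
    difference quotients: one application contains the first derivatives of the field, two contain
    the second ones. *)
Definition glim S : set (T -> R) := [set Y | exists Y_ : nat -> T -> R,
  (forall n, S (Y_ n)) /\ forall w, Y_ n w @[n --> \oo] --> Y w].

Lemma sub_glim S : S `<=` glim S.
Proof. by move=> Y SY; exists (fun=> Y); split => // w; exact: cvg_cst. Qed.

Lemma gspace_glim S : gspace S -> gspace (glim S).
Proof.
move=> [S0 SD SG]; split.
- exact: sub_glim.
- move=> a Y Z [Y_ [SY cY]] [Z_ [SZ cZ]].
  exists (fun n w => a * Y_ n w + Z_ n w); split => [n|w]; first exact: SD.
  by apply: cvgD; [apply: cvgM; [exact: cvg_cst|exact: cY]|exact: cZ].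
- move=> Y [Y_ [SY cY]].
  have [v_ hv] := choice (fun n => SG _ (SY n)).
  by have [v gv _] := cgauss_cvg hv cY; exists v.
Qed.

(** No means are subtracted, all variables of a Gaussian space being centered. *)
Definition cov Y Z : R := \int[P]_w (Y w * Z w).

Lemma covC Y Z : cov Y Z = cov Z Y.
Proof. by apply: eq_Rintegral => w _; rewrite mulrC. Qed.

Section theory.
Variable S : set (T -> R).
Hypothesis gS : gspace S.

Lemma gspace0 : S (fun=> 0). Proof. by case: gS. Qed.

Lemma gspaceDZ a Y Z : S Y -> S Z -> S (fun w => a * Y w + Z w).
Proof. by case: gS => _ + _; apply. Qed.

Lemma gspaceZ a Y : S Y -> S (fun w => a * Y w).
Proof.
move=> SY; have := gspaceDZ a SY gspace0.
by rewrite (_ : (fun w => _ + 0) = (fun w => a * Y w))//; apply/funext => w; rewrite addr0.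
Qed.

Lemma gspaceD Y Z : S Y -> S Z -> S (fun w => Y w + Z w).
Proof.
move=> SY SZ; have := gspaceDZ 1 SY SZ.
by rewrite (_ : (fun w => _ + _) = (fun w => Y w + Z w))//; apply/funext => w; rewrite mul1r.
Qed.

Lemma gspaceB Y Z : S Y -> S Z -> S (fun w => Y w - Z w).
Proof.
move=> SY SZ; have := gspaceDZ (-1) SZ SY.
by rewrite (_ : (fun w => _ + _) = (fun w => Y w - Z w))//; apply/funext => w; rewrite mulN1r addrC.
Qed.

Lemma gspace_sum (I : Type) (r : seq I) (p : pred I) (F : I -> T -> R) :
  (forall i, p i -> S (F i)) -> S (fun w => \sum_(i <- r | p i) F i w).
Proof.
move=> SF; elim: r => [|i r IH].
  by rewrite (_ : (fun w => _) = (fun=> 0)); [exact: gspace0|apply/funext => w; rewrite big_nil].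
case: (boolP (p i)) => pi.
  rewrite (_ : (fun w => _) = (fun w => F i w + \sum_(j <- r | p j) F j w)).
    by apply: gspaceD => //; exact: SF.
  by apply/funext => w; rewrite big_cons pi.
rewrite (_ : (fun w => _) = (fun w => \sum_(j <- r | p j) F j w))//.
by apply/funext => w; rewrite big_cons (negbTE pi).
Qed.

Lemma gspace_measurable Y : S Y -> measurable_fun setT Y.
Proof. by case: gS => _ _ + SY => /(_ _ SY)[v []]. Qed.

Lemma gspace_sqr_integrable Y : S Y -> P.-integrable setT (EFin \o (fun w => Y w ^+ 2)).
Proof. by case: gS => _ _ + SY => /(_ _ SY)[v /cgauss_variance[]]. Qed.

Lemma gspace_cgauss Y : S Y -> cgauss P Y (cov Y Y).
Proof.
case: gS => _ _ /[apply] -[v gv].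
suff -> : cov Y Y = v by [].
have [_ <-] := cgauss_variance gv.
by apply: eq_Rintegral => w _; rewrite expr2.
Qed.

Lemma cov_ge0 Y : S Y -> 0 <= cov Y Y.
Proof. by move=> /gspace_cgauss[]. Qed.

Lemma gspace_prod_integrable Y Z : S Y -> S Z ->
  P.-integrable setT (EFin \o (fun w => Y w * Z w)).
Proof.
move=> SY SZ.
have := integrableD measurableT (gspace_sqr_integrable SY) (gspace_sqr_integrable SZ).
apply: le_integrable => //.
  by apply/measurable_EFinP; apply: measurable_funM; exact: gspace_measurable.
move=> w _ /=; rewrite lee_fin [leRHS]ger0_norm ?addr_ge0 ?sqr_ge0//.
by rewrite ler_norml; apply/andP; split; nra.
Qed.

Lemma covDl Y Y' Z : S Y -> S Y' -> S Z ->
  cov (fun w => Y w + Y' w) Z = cov Y Z + cov Y' Z.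
Proof.
move=> SY SY' SZ; rewrite /cov -RintegralD//; [|exact: gspace_prod_integrable..].
by apply: eq_Rintegral => w _; rewrite mulrDl.
Qed.

Lemma covZl a Y Z : S Y -> S Z -> cov (fun w => a * Y w) Z = a * cov Y Z.
Proof.
move=> SY SZ; rewrite /cov -RintegralZl//; last exact: gspace_prod_integrable.
by apply: eq_Rintegral => w _; rewrite mulrA.
Qed.

Lemma covBl Y Y' Z : S Y -> S Y' -> S Z ->
  cov (fun w => Y w - Y' w) Z = cov Y Z - cov Y' Z.
Proof.
move=> SY SY' SZ; rewrite /cov -RintegralB//; [|exact: gspace_prod_integrable..].
by apply: eq_Rintegral => w _; rewrite mulrBl.
Qed.

Lemma cov_suml (I : Type) (r : seq I) (p : pred I) (F : I -> T -> R) Z :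
  (forall i, p i -> S (F i)) -> S Z ->
  cov (fun w => \sum_(i <- r | p i) F i w) Z = \sum_(i <- r | p i) cov (F i) Z.
Proof.
move=> SF SZ; elim: r => [|i r IH].
  rewrite big_nil /cov; transitivity (\int[P]_w (0 : R)).
    by apply: eq_Rintegral => w _; rewrite big_nil mul0r.
  by rewrite Rintegral_cst// mul0r.
rewrite big_cons; case: (boolP (p i)) => pi.
  rewrite -IH -covDl//; [|exact: SF|exact: gspace_sum].
  by apply: eq_Rintegral => w _; rewrite big_cons pi.
by rewrite -IH; apply: eq_Rintegral => w _; rewrite big_cons (negbTE pi).
Qed.

Lemma covDD A B : S A -> S B ->
  cov (fun w => A w + B w) (fun w => A w + B w) = cov A A + 2 * cov A B + cov B B.
Proof.
move=> SA SB; have SAB := gspaceD SA SB.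
rewrite covDl// (covC A) (covC B) !covDl// (covC B A); ring.
Qed.

Lemma covBB A B : S A -> S B ->
  cov (fun w => A w - B w) (fun w => A w - B w) = cov A A - 2 * cov A B + cov B B.
Proof.
move=> SA SB; have SAB := gspaceB SA SB.
rewrite covBl// (covC A) (covC B) !covBl// (covC B A); ring.
Qed.

(** For variances this is [cgauss_cvg], which needs no uniform integrability; covariances follow by
    polarization. *)
Lemma cov_cvg (Y_ Z_ : nat -> T -> R) Y Z :
  (forall n, S (Y_ n)) -> (forall n, S (Z_ n)) -> S Y -> S Z ->
  (forall w, Y_ n w @[n --> \oo] --> Y w) -> (forall w, Z_ n w @[n --> \oo] --> Z w) ->
  cov (Y_ n) (Z_ n) @[n --> \oo] --> cov Y Z.
Proof.
move=> SY_ SZ_ SY SZ cY cZ.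
have V (F_ : nat -> T -> R) F : (forall n, S (F_ n)) -> S F ->
    (forall w, F_ n w @[n --> \oo] --> F w) -> cov (F_ n) (F_ n) @[n --> \oo] --> cov F F.
  move=> SF_ SF cF; have [v gv] := cgauss_cvg (fun n => gspace_cgauss (SF_ n)) cF.
  suff -> : v = cov F F by [].
  have [_ <-] := cgauss_variance gv; have [_ <-] := cgauss_variance (gspace_cgauss SF).
  by [].
have pol A B : S A -> S B -> cov A B =
    (cov (fun w => A w + B w) (fun w => A w + B w) -
     cov (fun w => A w - B w) (fun w => A w - B w)) / 4.
  by move=> SA SB; rewrite covDD// covBB//; field.
rewrite pol//; under eq_fun do rewrite pol//.
apply: cvgM; last exact: cvg_cst.
apply: cvgB; apply: V.
- by move=> n; exact: gspaceD.
- exact: gspaceD.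
- by move=> w; apply: cvgD; [exact: cY|exact: cZ].
- by move=> n; exact: gspaceB.
- exact: gspaceB.
- by move=> w; apply: cvgB; [exact: cY|exact: cZ].
Qed.

End theory.
End GaussianSpace.

(** * Uncorrelated Gaussian variables are independent *)

Section Killed.
Context {d} {T : measurableType d} {R : realType} (P : probability T R).

Lemma measurable_preimageT (d' : measure_display) (T' : measurableType d') (V : T -> T') B :
  measurable_fun setT V -> measurable B -> measurable (V @^-1` B).
Proof. by move=> mV mB; rewrite -[X in measurable X]setTI; exact: mV. Qed.

Lemma measurable_indic_comp (V : T -> R) (B : set R) :
  measurable_fun setT V -> measurable B -> measurable_fun setT (fun w => \1_B (V w) : R).
Proof. by move=> mV mB; apply: measurableT_comp => //; exact: measurable_indic. Qed.

Lemma indic_comp_le1 (V : T -> R) (B : set R) w : `|\1_B (V w) : R| <= 1.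
Proof. by rewrite indicE; case: (_ \in _); rewrite ?normr1 ?normr0. Qed.

Lemma Rintegral_indic_preimage (V K : T -> R) (B : set R) :
  \int[P]_w (K w * \1_B (V w)) = fine (\int[P]_(w in V @^-1` B) (K w)%:E)%E.
Proof.
transitivity (\int[P]_(w in V @^-1` B) K w); last by [].
rewrite [RHS]Rintegral_mkcond; apply: eq_Rintegral => w _.
rewrite patchE indicE; have -> : (w \in V @^-1` B) = (V w \in B) by [].
by case: ifP; rewrite ?mulr1 ?mulr0.
Qed.

Lemma fourier_zero (V K : T -> R) (M : R) (B : set R) :
  measurable_fun setT V -> measurable_fun setT K -> (forall w, `|K w| <= M) ->
  (forall s, \int[P]_w (cos (s * V w) * K w) = 0) ->
  (forall s, \int[P]_w (sin (s * V w) * K w) = 0) ->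
  measurable B -> \int[P]_w (K w * \1_B (V w)) = 0.
Proof.
move=> mV mK KM hc hs mB; rewrite Rintegral_indic_preimage.
have z (U : Type) (w : U) : `|0 : R| <= 0 by rewrite normr0.
rewrite (@fourier_unique _ _ _ _ R P P V K V (fun=> 0) M 0 mV mK KM mV (measurable_cst _) (z _) _ _ B mB).
- by rewrite integral0.
- by move=> s; rewrite hc; under eq_Rintegral do rewrite mulr0; rewrite Rintegral_cst// mul0r.
- by move=> s; rewrite hs; under eq_Rintegral do rewrite mulr0; rewrite Rintegral_cst// mul0r.
Qed.

Lemma cosM (x y : R) : cos x * cos y = (cos (x + y) + cos (x - y)) / 2.
Proof. rewrite cosB cosD; by field. Qed.

Lemma sinMsin (x y : R) : sin x * sin y = (cos (x - y) - cos (x + y)) / 2.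
Proof. rewrite cosB cosD; by field. Qed.

Lemma sinMcos (x y : R) : sin x * cos y = (sin (x + y) + sin (x - y)) / 2.
Proof. rewrite sinB sinD; by field. Qed.

Lemma cosMsin (x y : R) : cos x * sin y = (sin (x + y) - sin (x - y)) / 2.
Proof. rewrite sinB sinD; by field. Qed.

Variable U : set (T -> R).
Hypothesis UD : forall a Y Z, U Y -> U Z -> U (fun w => a * Y w + Z w).
Hypothesis UB : forall Y, U Y -> U (fun w => - Y w).
Hypothesis U0 : U (fun=> 0).
Hypothesis Um : forall Y, U Y -> measurable_fun setT Y.

(* If V is uncorrelated with all of U, then H = 1_A(V) - P(V in A) is killed; a
   killed weight integrates to 0 over the sigma-algebra of U: this is independence. *)
Definition killed (H : T -> R) := forall Y, U Y ->
  \int[P]_w (H w * cos (Y w)) = 0 /\ \int[P]_w (H w * sin (Y w)) = 0.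

Let mcos Y : U Y -> measurable_fun setT (fun w => cos (Y w)).
Proof.
move=> UY; have := @measurable_cos _ T R Y 1 (Um UY).
by under eq_fun do rewrite mul1r.
Qed.

Let msin Y : U Y -> measurable_fun setT (fun w => sin (Y w)).
Proof.
move=> UY; have := @measurable_sin _ T R Y 1 (Um UY).
by under eq_fun do rewrite mul1r.
Qed.

(** The weight H cos(Y) has a vanishing transform along [g]: product-to-sum formulas express cos(s
    g) cos(Y) and its variants through s g + Y and s g - Y, which lie in [U] and are killed. Fourier
    uniqueness then allows an indicator of [g] as a further factor. *)
Lemma killed_step (H g : T -> R) (M : R) (B : set R) :
  measurable_fun setT H -> (forall w, `|H w| <= M) -> U g -> measurable B ->
  killed H -> killed (fun w => H w * \1_B (g w)).
Proof.
move=> mH HM Ug mB kH Y UY.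
have iHf (f : T -> R) : measurable_fun setT f -> (forall w, `|f w| <= 1) ->
    P.-integrable setT (EFin \o (fun w => H w * f w)).
  move=> mf f1; apply: (@bounded_integrable _ _ _ P _ M); first exact: measurable_funM.
  by move=> w; rewrite normrM (le_trans (ler_piMr _ (f1 w))).
have HY1 s : U (fun w => s * g w + Y w) by exact: UD.
have HY2 s : U (fun w => s * g w - Y w) by apply: UD => //; exact: UB.
have half (f1 f2 f : T -> R) (b : R) : (forall w, f w = (H w * f1 w + b * (H w * f2 w)) / 2) ->
   P.-integrable setT (EFin \o (fun w => H w * f1 w)) ->
   P.-integrable setT (EFin \o (fun w => H w * f2 w)) ->
   \int[P]_w (H w * f1 w) = 0 -> \int[P]_w (H w * f2 w) = 0 -> \int[P]_w (f w) = 0.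
  move=> fE i1 i2 e1 e2.
  have i3 : P.-integrable setT (EFin \o (fun w => b * (H w * f2 w))).
    by have := integrableZl measurableT b i2; apply: eq_integrable.
  have i4 : P.-integrable setT (EFin \o (fun w => H w * f1 w + b * (H w * f2 w))).
    by have := integrableD measurableT i1 i3; apply: eq_integrable.
  under eq_Rintegral do rewrite fE.
  by rewrite RintegralZr// RintegralD// RintegralZl// e1 e2 mulr0 addr0 mul0r.
split.
- under eq_Rintegral do rewrite mulrAC.
  apply: (@fourier_zero g (fun w => H w * cos (Y w)) M) => //.
  + exact: Um.
  + by apply: measurable_funM => //; exact: mcos.
  + by move=> w; rewrite normrM (le_trans (ler_piMr _ (norm_cos_le1 _))).
  + move=> s; apply: (half (fun w => cos (s * g w + Y w)) (fun w => cos (s * g w - Y w)) _ 1).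
    * by move=> w; rewrite mulrCA cosM; ring.
    * by apply: iHf => [|w]; [exact: (mcos (HY1 s))|exact: norm_cos_le1].
    * by apply: iHf => [|w]; [exact: (mcos (HY2 s))|exact: norm_cos_le1].
    * exact: (kH _ (HY1 s)).1.
    * exact: (kH _ (HY2 s)).1.
  + move=> s; apply: (half (fun w => sin (s * g w + Y w)) (fun w => sin (s * g w - Y w)) _ 1).
    * by move=> w; rewrite mulrCA sinMcos; ring.
    * by apply: iHf => [|w]; [exact: (msin (HY1 s))|exact: norm_sin_le1].
    * by apply: iHf => [|w]; [exact: (msin (HY2 s))|exact: norm_sin_le1].
    * exact: (kH _ (HY1 s)).2.
    * exact: (kH _ (HY2 s)).2.
- under eq_Rintegral do rewrite mulrAC.
  apply: (@fourier_zero g (fun w => H w * sin (Y w)) M) => //.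
  + exact: Um.
  + by apply: measurable_funM => //; exact: msin.
  + by move=> w; rewrite normrM (le_trans (ler_piMr _ (norm_sin_le1 _))).
  + move=> s; apply: (half (fun w => sin (s * g w + Y w)) (fun w => sin (s * g w - Y w)) _ (-1)).
    * by move=> w; rewrite mulrCA cosMsin; ring.
    * by apply: iHf => [|w]; [exact: (msin (HY1 s))|exact: norm_sin_le1].
    * by apply: iHf => [|w]; [exact: (msin (HY2 s))|exact: norm_sin_le1].
    * exact: (kH _ (HY1 s)).2.
    * exact: (kH _ (HY2 s)).2.
  + move=> s; apply: (half (fun w => cos (s * g w - Y w)) (fun w => cos (s * g w + Y w)) _ (-1)).
    * by move=> w; rewrite mulrCA sinMsin; ring.
    * by apply: iHf => [|w]; [exact: (mcos (HY2 s))|exact: norm_cos_le1].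
    * by apply: iHf => [|w]; [exact: (mcos (HY1 s))|exact: norm_cos_le1].
    * exact: (kH _ (HY2 s)).1.
    * exact: (kH _ (HY1 s)).1.
Qed.

(** The sequences [g] and [B] are total and only their first [n] terms count; intersections are then
    formed by concatenation. *)
Definition cylinders : set (set T) := [set E | exists n (g : nat -> T -> R) (B : nat -> set R),
  [/\ forall i, U (g i), forall i, measurable (B i) &
      E = [set w | forall i, (i < n)%N -> B i (g i w)]]].

Lemma cylindersI : setI_closed cylinders.
Proof.
move=> _ _ [n1 [g1 [B1 [U1 m1 ->]]]] [n2 [g2 [B2 [U2 m2 ->]]]].
exists (n1 + n2)%N, (fun i => if (i < n1)%N then g1 i else g2 (i - n1)%N),
  (fun i => if (i < n1)%N then B1 i else B2 (i - n1)%N); split.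
- by move=> i; case: ifP.
- by move=> i; case: ifP.
apply/seteqP; split => w /=.
- move=> [h1 h2] i ilt; case: ifP => i1; first exact: h1.
  by apply: h2; rewrite ltn_subLR// leqNgt i1.
- move=> h; split => i ilt.
  + by have := h i (leq_trans ilt (leq_addr _ _)); rewrite ilt.
  + have := h (n1 + i)%N; rewrite ltn_add2l => /(_ ilt).
    by rewrite ltnNge leq_addr/= addKn.
Qed.

Lemma cylinders_measurable : cylinders `<=` measurable.
Proof.
move=> _ [n [g [B [Ug mB ->]]]].
elim: n => [|n IH].
  by rewrite (_ : [set _ | _] = setT)//; apply/seteqP; split.
rewrite (_ : [set _ | _] = [set w | forall i, (i < n)%N -> B i (g i w)] `&` (g n @^-1` B n)).
  by apply: measurableI => //; apply: measurable_preimageT => //; exact: Um.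
apply/seteqP; split => w /=.
- by move=> h; split => [i ilt|]; apply: h => //; exact: ltnW.
- by move=> [h1 h2] i; rewrite ltnS leq_eqVlt => /predU1P[->//|]; exact: h1.
Qed.

(** Induction on the number of coordinates: each [killed_step] multiplies by the indicator of one
    more constraint and stays killed, with the same bound [M]. *)
Lemma killed_cylinder (H : T -> R) (M : R) (E : set T) :
  measurable_fun setT H -> (forall w, `|H w| <= M) -> killed H ->
  cylinders E -> killed (fun w => H w * \1_E w).
Proof.
move=> mH HM kH [n [g [B [Ug mB ->]]]].
elim: n => [|n IH].
  rewrite (_ : (fun w => _) = H)//; apply/funext => w.
  by rewrite indicE mem_set ?mulr1.
have mE := cylinders_measurable (ex_intro _ n (ex_intro _ g (ex_intro _ B (And3 Ug mB erefl)))).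
pose E0 := [set w | forall i, (i < n)%N -> B i (g i w)].
have mi : measurable_fun setT (fun w => H w * \1_E0 w).
  by apply: measurable_funM => //; exact: measurable_indic.
have := @killed_step (fun w => H w * \1_E0 w) (g n) M (B n) mi _ (Ug n) (mB n) IH.
rewrite (_ : (fun w => _ * _ * _) = (fun w =>
    H w * \1_[set w | forall i, (i < n.+1)%N -> B i (g i w)] w)).
  apply => w; rewrite normrM (le_trans (ler_piMr _ _))// indicE.
  by case: (_ \in _); rewrite ?normr1 ?normr0.
apply/funext => w; rewrite -mulrA !indicE -natrM mulnb; congr (_ * (nat_of_bool _)%:R).
apply/andP/idP.
- rewrite !inE => -[h1 h2] i; rewrite ltnS leq_eqVlt => /predU1P[->//|]; exact: h1.
- by rewrite !inE => h; split => [i ilt|]; apply: h => //; exact: ltnW.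
Qed.

(** The same points with the sigma-algebra generated by [U]; measurability there encodes being a
    function of the variables in [U]. *)
Definition cylType := g_sigma_algebraType cylinders.

Lemma measurable_cyl_id : measurable_fun setT (idfun : T -> cylType).
Proof.
move=> _ E mE; rewrite setTI.
exact: (smallest_sub (@sigma_algebra_measurable _ T) cylinders_measurable mE).
Qed.

Lemma measurable_cyl (g : T -> R) : U g -> measurable_fun setT (g : cylType -> R).
Proof.
move=> Ug _ B mB; rewrite setTI; apply: sub_sigma_algebra.
exists 1%N, (fun=> g), (fun=> B); split => //.
by apply/seteqP; split => w /= => [|/(_ 0%N)]; [move=> h i _|apply].
Qed.

(** On cylinders this is the cosine identity at the element 0 of [U]; [weighted_dynkin] against the
    zero weight extends it to the generated sigma-algebra. *)
Lemma killed_sigma (H : T -> R) (M : R) (E : set cylType) :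
  measurable_fun setT H -> (forall w, `|H w| <= M) -> killed H -> measurable E ->
  (\int[P]_(w in E) (H w)%:E = 0)%E.
Proof.
move=> mH HM kH mE.
have iH : P.-integrable setT (EFin \o H) by exact: bounded_integrable HM.
have i0 : P.-integrable setT (EFin \o (fun=> 0 : R)) by exact: finite_measure_integrable_cst.
have cE C : cylinders C -> (\int[P]_(w in C) (H w)%:E = 0)%E.
  move=> cC; have [] := killed_cylinder mH HM kH cC U0.
  under eq_Rintegral do rewrite cos0 mulr1.
  have mC := cylinders_measurable cC.
  have -> : (fun w => H w * \1_C w) = H \_ C.
    by apply/funext => w; rewrite patchE indicE; case: ifP; rewrite ?mulr1 ?mulr0.
  rewrite -Rintegral_mkcond /Rintegral => e _.
  rewrite -[LHS]fineK ?e//; apply: integrable_fin_num => //; exact: integrableS iH.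
have cT : cylinders setT.
  exists 0%N, (fun=> fun=> 0), (fun=> setT); split => //.
  by apply/seteqP; split.
apply: (etrans (@weighted_dynkin _ _ _ T T cylType R P P idfun idfun H (fun=> 0)
  measurable_cyl_id measurable_cyl_id iH i0 cylinders erefl cylindersI _ _ E mE)).
- by rewrite integral0; exact: (cE setT cT).
- by move=> C cC; rewrite integral0; exact: (cE C cC).
- exact: integral0.
Qed.

End Killed.

Section Independence.
Context {d} {T : measurableType d} {R : realType} (P : probability T R).
Variable S : set (T -> R).
Hypothesis gS : gspace P S.
Variable V : T -> R.
Hypothesis SV : S V.
Notation nz := (normal_prob (0:R) 1).

Definition uncorr : set (T -> R) := [set Y | S Y /\ cov P V Y = 0].

Lemma uncorrD a Y Z : uncorr Y -> uncorr Z -> uncorr (fun w => a * Y w + Z w).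
Proof.
move=> [SY cY] [SZ cZ]; split; first exact: (gspaceDZ gS).
rewrite covC (covDl gS)//; last exact: (gspaceZ gS).
by rewrite (covZl gS)// !(covC P _ V) cY cZ mulr0 addr0.
Qed.

Lemma uncorr0 : uncorr (fun=> 0).
Proof.
split; first exact: (gspace0 gS).
rewrite /cov; under eq_Rintegral do rewrite mulr0; by rewrite Rintegral_cst// mul0r.
Qed.

Lemma uncorrN Y : uncorr Y -> uncorr (fun w => - Y w).
Proof.
move=> UY; have := uncorrD (-1) UY uncorr0.
by rewrite (_ : (fun w => _ + _) = (fun w => - Y w))//; apply/funext => w; rewrite addr0 mulN1r.
Qed.

Lemma uncorr_measurable Y : uncorr Y -> measurable_fun setT Y.
Proof. by move=> [SY _]; exact: (gspace_measurable gS). Qed.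

(** The variables s V + Y and s V - Y belong to [S] and have the same variance s^2 Var V + Var Y, so
    the transform factorises. Joint normality enters through this use of linearity of [S]. *)
Lemma uncorr_trig Y (s : R) : uncorr Y ->
  [/\ \int[P]_w (cos (s * V w) * cos (Y w)) = \int[P]_w cos (s * V w) * \int[P]_w cos (Y w),
      \int[P]_w (sin (s * V w) * cos (Y w)) = 0,
      \int[P]_w (cos (s * V w) * sin (Y w)) = 0,
      \int[P]_w (sin (s * V w) * sin (Y w)) = 0 &
      \int[P]_w sin (Y w) = 0].
Proof.
move=> [SY cVY].
have G1 : S (fun w => s * V w + Y w) by exact: (gspaceDZ gS).
have G2 : S (fun w => s * V w - Y w) by apply: (gspaceB gS) => //; exact: (gspaceZ gS).
have GV := gspaceZ gS s SV.
have sv : cov P (fun w => s * V w) (fun w => s * V w) = s ^+ 2 * cov P V V.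
  by rewrite (covZl gS)// covC (covZl gS)//; ring.
have sy : cov P (fun w => s * V w) Y = 0 by rewrite (covZl gS)// cVY mulr0.
have v1 : cov P (fun w => s * V w + Y w) (fun w => s * V w + Y w) = s ^+ 2 * cov P V V + cov P Y Y.
  by rewrite (covDD gS)// sv sy; ring.
have v2 : cov P (fun w => s * V w - Y w) (fun w => s * V w - Y w) = s ^+ 2 * cov P V V + cov P Y Y.
  by rewrite (covBB gS)// sv sy; ring.
have [m1 _ c1 s1] := gspace_cgauss gS G1.
have [m2 _ c2 s2] := gspace_cgauss gS G2.
have [mV _ cV sV] := gspace_cgauss gS SV.
have [mY _ cY sY] := gspace_cgauss gS SY.
move: (c1 1) (c2 1) (s1 1) (s2 1) (cY 1) (sY 1).
have ec (Z : T -> R) : \int[P]_w cos (1 * Z w) = \int[P]_w cos (Z w).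
  by apply: eq_Rintegral => w _; rewrite mul1r.
have es (Z : T -> R) : \int[P]_w sin (1 * Z w) = \int[P]_w sin (Z w).
  by apply: eq_Rintegral => w _; rewrite mul1r.
rewrite !ec !es.
rewrite v1 v2 => {}c1 {}c2 {}s1 {}s2 {}cY {}sY.
have i1 : P.-integrable setT (EFin \o (fun w => cos (s * V w + Y w))).
  by have := integrable_cos P 1 m1; apply: eq_integrable => // w _ /=; rewrite mul1r.
have i2 : P.-integrable setT (EFin \o (fun w => cos (s * V w - Y w))).
  by have := integrable_cos P 1 m2; apply: eq_integrable => // w _ /=; rewrite mul1r.
have i3 : P.-integrable setT (EFin \o (fun w => sin (s * V w + Y w))).
  by have := integrable_sin P 1 m1; apply: eq_integrable => // w _ /=; rewrite mul1r.
have i4 : P.-integrable setT (EFin \o (fun w => sin (s * V w - Y w))).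
  by have := integrable_sin P 1 m2; apply: eq_integrable => // w _ /=; rewrite mul1r.
split.
- under eq_Rintegral do rewrite cosM.
  rewrite RintegralZr//; last by have := integrableD measurableT i1 i2; apply: eq_integrable.
  rewrite RintegralD// c1 c2 cV cY -expRD.
  have -> : - (s ^+ 2 * cov P V V / 2) + - (1 ^+ 2 * cov P Y Y / 2) =
    - (1 ^+ 2 * (s ^+ 2 * cov P V V + cov P Y Y) / 2) by field.
  by field.
- under eq_Rintegral do rewrite sinMcos.
  rewrite RintegralZr//; last by have := integrableD measurableT i3 i4; apply: eq_integrable.
  by rewrite RintegralD// s1 s2 addr0 mul0r.
- under eq_Rintegral do rewrite cosMsin.
  rewrite RintegralZr//; last by have := integrableB measurableT i3 i4; apply: eq_integrable.
  by rewrite RintegralB// s1 s2 subr0 mul0r.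
- under eq_Rintegral do rewrite sinMsin.
  rewrite RintegralZr//; last by have := integrableB measurableT i2 i1; apply: eq_integrable.
  by rewrite RintegralB// c1 c2 subrr mul0r.
- exact: sY.
Qed.

(** The roles are exchanged: for f = cos(Y) or sin(Y), the centered weight f - E f has zero
    transform along [V] by [uncorr_trig], hence integrates to 0 against every indicator of [V].
    Rearranged, this is the claim. *)
Lemma killed_indic (A : set R) : measurable A ->
  killed P uncorr (fun w => \1_A (V w) - fine (P (V @^-1` A))).
Proof.
move=> mA Y UY.
have mV := gspace_measurable gS SV.
have mY := uncorr_measurable UY.
set p := fine _.
have mc : measurable_fun setT (fun w => cos (Y w)).
  by have := @measurable_cos _ T R Y 1 mY; under eq_fun do rewrite mul1r.
have ms : measurable_fun setT (fun w => sin (Y w)).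
  by have := @measurable_sin _ T R Y 1 mY; under eq_fun do rewrite mul1r.
have iA : P.-integrable setT (EFin \o (fun w => \1_A (V w) : R)).
  apply: (@bounded_integrable _ _ _ P _ 1); first exact: measurable_indic_comp.
  exact: indic_comp_le1.
have pE : \int[P]_w (\1_A (V w) : R) = p.
  rewrite /p -(setIT (V @^-1` A)) -integral_indic//; last exact: measurable_preimageT.
have key (f : T -> R) : measurable_fun setT f -> (forall w, `|f w| <= 1) ->
    (forall s, \int[P]_w (cos (s * V w) * f w) = \int[P]_w cos (s * V w) * \int[P]_w f w) ->
    (forall s, \int[P]_w (sin (s * V w) * f w) = 0) ->
    \int[P]_w ((\1_A (V w) - p) * f w) = 0.
  move=> mf f1 hc hs; set e := \int[P]_w f w.
  have iff : P.-integrable setT (EFin \o f) by apply: (@bounded_integrable _ _ _ P _ 1).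
  have ib (g h : T -> R) : measurable_fun setT g -> measurable_fun setT h ->
      (forall w, `|g w| <= 1) -> (forall w, `|h w| <= 1) ->
      P.-integrable setT (EFin \o (fun w => g w * h w)).
    move=> mg mh g1 h1; apply: (@bounded_integrable _ _ _ P _ 1); first exact: measurable_funM.
    by move=> w; rewrite normrM -[leRHS]mulr1 ler_pM.
  have iZ (k : R) g : P.-integrable setT (EFin \o g) ->
      P.-integrable setT (EFin \o (fun w => g w * k)).
    by move=> /(integrableZr measurableT k); apply: eq_integrable.
  have i1 : P.-integrable setT (EFin \o (fun w => \1_A (V w) * f w)).
    by apply: ib => //; [exact: measurable_indic_comp|exact: indic_comp_le1].
  have z : \int[P]_w ((f w - e) * \1_A (V w)) = 0.
    apply: (@fourier_zero _ _ _ P V (fun w => f w - e) (1 + `|e|)) => //.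
    + exact: measurable_funB.
    + by move=> w; apply: (le_trans (ler_normB _ _)); rewrite lerD2r.
    + move=> s; under eq_Rintegral do rewrite mulrBr.
      have j1 : P.-integrable setT (EFin \o (fun w => cos (s * V w) * f w)).
        by apply: ib => // [|w]; [exact: measurable_cos|exact: norm_cos_le1].
      have j2 := iZ e _ (integrable_cos P s mV).
      by rewrite RintegralB// hc RintegralZr ?subrr//; exact: integrable_cos.
    + move=> s; under eq_Rintegral do rewrite mulrBr.
      have j1 : P.-integrable setT (EFin \o (fun w => sin (s * V w) * f w)).
        by apply: ib => // [|w]; [exact: measurable_sin|exact: norm_sin_le1].
      have j2 := iZ e _ (integrable_sin P s mV).
      rewrite RintegralB// hs RintegralZr; [|by []|exact: integrable_sin].
      by have [_ _ _ ->] := gspace_cgauss gS SV; rewrite mul0r subrr.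
  move: z; under eq_Rintegral do rewrite mulrBl (mulrC (f _)) (mulrC e).
  rewrite RintegralB//; last exact: iZ.
  rewrite RintegralZr// pE => z.
  under eq_Rintegral do rewrite mulrBl (mulrC p).
  rewrite RintegralB//; last exact: iZ.
  by rewrite RintegralZr// -/e mulrC.
split; apply: key => //.
- by move=> w; exact: norm_cos_le1.
- by move=> s; have [] := uncorr_trig s UY.
- by move=> s; have [] := uncorr_trig s UY.
- by move=> w; exact: norm_sin_le1.
- by move=> s; have [_ _ -> _ ->] := uncorr_trig s UY; rewrite mulr0.
- by move=> s; have [] := uncorr_trig s UY.
Qed.

Lemma indep_sets (A : set R) (E : set (cylType uncorr)) : measurable A -> measurable E ->
  P (V @^-1` A `&` E) = (P (V @^-1` A) * P E)%E.
Proof.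
move=> mA mE.
have mV := gspace_measurable gS SV.
have mE' : measurable (E : set T).
  have := measurable_cyl_id uncorr_measurable measurableT mE.
  by rewrite setTI.
have mVA := measurable_preimageT mV mA.
have K := killed_indic mA.
have H1 (w : T) : `|\1_A (V w) - fine (P (V @^-1` A))| <= 1 + `|fine (P (V @^-1` A))|.
  by apply: (le_trans (ler_normB _ _)); rewrite lerD2r; exact: indic_comp_le1.
have mH : measurable_fun setT (fun w => \1_A (V w) - fine (P (V @^-1` A)) : R).
  by apply: measurable_funB => //; exact: measurable_indic_comp.
have := killed_sigma uncorrD uncorrN uncorr0 uncorr_measurable mH H1 K mE.
have iA : P.-integrable E (EFin \o (fun w => \1_A (V w) : R)).
  apply: (@integrableS _ _ _ P setT E) => //; apply: (@bounded_integrable _ _ _ P _ 1).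
    exact: measurable_indic_comp.
  exact: indic_comp_le1.
have ic : P.-integrable E (EFin \o (fun=> fine (P (V @^-1` A)))).
  by apply: (@integrableS _ _ _ P setT E) => //; exact: finite_measure_integrable_cst.
under eq_integral do rewrite EFinB.
rewrite (integralB mE' iA ic).
have -> : (\int[P]_(w in E) (fine (P (V @^-1` A)))%:E = P (V @^-1` A) * P E)%E.
  by rewrite integral_cst// fineK// fin_num_measure.
have -> : (\int[P]_(w in E) (\1_A (V w) : R)%:E = P (V @^-1` A `&` E))%E.
  rewrite -integral_indic//; apply: eq_integral => w _.
have fb : (P (V @^-1` A) * P E)%E \is a fin_num by rewrite fin_numM// fin_num_measure.
by move=> h; rewrite -[LHS](subeK _ fb) h add0e.
Qed.

(** The pair (V w, w), its second component seen through the sigma-algebra of [uncorr], has a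
    product law. Keeping w itself as second component lets [F] depend on all uncorrelated variables
    at once; unit variance makes the first factor standard normal. *)
Lemma indep_integral (F : (measurableTypeR R * cylType uncorr)%type -> \bar R) : cov P V V = 1 ->
  measurable_fun setT F -> (forall p, 0 <= F p)%E ->
  (\int[P]_w F (V w, w) = \int[P]_w \int[nz]_x F (x, w))%E.
Proof.
move=> V1 mF F0.
have mV := gspace_measurable gS SV.
have mid : measurable_fun setT (idfun : T -> cylType uncorr).
  exact: (measurable_cyl_id uncorr_measurable).
pose X : {mfun T >-> cylType uncorr} :=
  HB.pack (idfun : T -> cylType uncorr) (isMeasurableFun.Build _ _ _ _ _ mid).
pose Q := distribution P X.
have mpsi : measurable_fun setT (fun w : T => (V w : measurableTypeR R, w : cylType uncorr)).
  exact: measurable_fun_pair.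
pose Psi : {mfun T >-> (measurableTypeR R * cylType uncorr)%type} :=
  HB.pack (fun w : T => (V w : measurableTypeR R, w : cylType uncorr)) (isMeasurableFun.Build _ _ _ _ _ mpsi).
pose M := distribution P Psi.
have U : forall B : set (measurableTypeR R * cylType uncorr), measurable B -> (nz \x Q)%E B = M B.
  apply: product_measure_unique => A E mA mE.
  transitivity (P (V @^-1` A `&` E)); first by [].
  rewrite indep_sets//.
  congr (_ * _)%E.
  rewrite (cgauss_law (gspace_cgauss gS SV) mA) V1 sqrtr1.
  by congr (nz _); apply/seteqP; split => x /=; rewrite mul1r.
transitivity (\int[M]_p F p)%E; first by rewrite ge0_integral_distribution.
transitivity (\int[(nz \x Q)%E]_p F p)%E.
  by apply: eq_measure_integral => A mA _; first [exact: (U A mA)|exact: (esym (U A mA))].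
rewrite fubini_tonelli2// ge0_integral_distribution//.
- exact: measurable_fun_fubini_tonelli_G.
- by move=> y; apply: integral_ge0 => x _; exact: F0.
Qed.

End Independence.

(** * Positive definite matrices *)

Section PositiveDefinite.
Context {R : realType}.

Definition posdef n (M : 'M[R]_n) : Prop :=
  M^T = M /\ forall v : 'rV[R]_n, v != 0 -> 0 < (v *m M *m v^T) 0 0.

Lemma row_sqr_ge0 n (v : 'rV[R]_n) : 0 <= (v *m v^T) 0 0.
Proof. by rewrite mxE sumr_ge0// => i _; rewrite mxE -expr2 sqr_ge0. Qed.

Lemma row_sqr_gt0 n (v : 'rV[R]_n) : v != 0 -> 0 < (v *m v^T) 0 0.
Proof.
move=> v0; rewrite lt_def row_sqr_ge0 andbT; apply: contra v0 => /eqP.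
rewrite mxE => /eqP; rewrite psumr_eq0; last by move=> i _; rewrite mxE -expr2 sqr_ge0.
move=> /allP h; apply/eqP/rowP => i; rewrite mxE.
have := h i (mem_index_enum i); rewrite /= mxE mulf_eq0 orbb => /eqP ->.
by [].
Qed.

Lemma quadE n (v : 'rV[R]_n) (M : 'M[R]_n) :
  (v *m M *m v^T) 0 0 = \sum_i \sum_j M i j * (v 0 i * v 0 j).
Proof.
rewrite mxE exchange_big/=; apply: eq_bigr => j _.
by rewrite !mxE mulr_suml; apply: eq_bigr => i _; ring.
Qed.

Definition schur n (M : 'M[R]_(1 + n)) : 'M[R]_n :=
  drsubmx M - (M 0 0)^-1 *: ((ursubmx M)^T *m ursubmx M).

Lemma posdef_block n (M : 'M[R]_(1 + n)) : M^T = M ->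
  M = block_mx (M 0 0)%:M (ursubmx M) (ursubmx M)^T (drsubmx M).
Proof.
move=> Ms; rewrite -[LHS]submxK; congr block_mx.
  by rewrite [LHS]mx11_scalar; congr (_ %:M); rewrite !mxE; congr (M _ _); apply/val_inj.
by rewrite trmx_ursub Ms.
Qed.

Lemma posdef_diag n (M : 'M[R]_(1 + n)) : posdef M -> 0 < M 0 0.
Proof.
move=> [_ Mp]; have := Mp (delta_mx 0 0).
rewrite -rowE trmx_delta -colE !mxE; apply.
by apply/eqP => /matrixP/(_ 0 0)/eqP; rewrite !mxE !eqxx oner_eq0.
Qed.

Lemma posdef_schur n (M : 'M[R]_(1 + n)) : posdef M -> posdef (schur M).
Proof.
move=> Mp; have m0 := posdef_diag Mp; case: Mp => Ms Mp.
have mn0 : M 0 0 != 0 by rewrite gt_eqF.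
split.
  rewrite /schur linearB/= linearZ/= trmx_mul trmxK; congr (_ - _).
  by rewrite -[in RHS]Ms trmx_drsub.
move=> v v0; set u := ursubmx M.
(* The first coordinate minimising the form for given [v]; it cancels the first block of the
   product. *)
pose x := - (M 0 0)^-1 *: (v *m u^T).
have := Mp (row_mx x v).
have -> : row_mx x v != 0 by apply: contra v0; rewrite row_mx_eq0 => /andP[].
move=> /(_ isT); rewrite {1}(posdef_block Ms) -/u mul_row_block tr_row_mx mul_row_col.
suff -> : (x *m (M 0 0)%:M + v *m u^T) *m x^T + (x *m u + v *m drsubmx M) *m v^T = v *m schur M *m v^T by [].
have -> : x *m (M 0 0)%:M + v *m u^T = 0.
  by rewrite mul_mx_scalar /x scalerA mulrN mulfV// scaleN1r addNr.
rewrite mul0mx add0r /schur -/u mulmxBr -scalemxAr; congr (_ *m _).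
by rewrite /x -scalemxAl scaleNr addrC mulmxA.
Qed.

Lemma det_schur n (M : 'M[R]_(1 + n)) : posdef M -> \det M = M 0 0 * \det (schur M).
Proof.
move=> Mp; have m0 := posdef_diag Mp; case: Mp => Ms _.
have mn0 : M 0 0 != 0 by rewrite gt_eqF.
set u := ursubmx M.
(* Unipotent column elimination, which makes [M] block triangular without changing its
   determinant. *)
pose L : 'M[R]_(1 + n) := block_mx 1%:M (- (M 0 0)^-1 *: u) 0 1%:M.
have dL : \det L = 1 by rewrite det_ublock !det1 mulr1.
have E : M *m L = block_mx (M 0 0)%:M 0 u^T (schur M).
  rewrite {1}(posdef_block Ms) -/u /L mulmx_block !mulmx1 !mulmx0 !addr0 mul_scalar_mx.
  rewrite scalerA mulrN mulfV// scaleN1r addNr; congr block_mx.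
  by rewrite /schur -/u addrC -scalemxAr scaleNr.
by rewrite -[LHS]mulr1 -dL -det_mulmx E det_lblock det_scalar expr1.
Qed.

Lemma posdef_det n (M : 'M[R]_n) : posdef M -> 0 < \det M.
Proof.
elim: n M => [M _|n IH M Mp]; first by rewrite det_mx00.
rewrite (@det_schur n M Mp) mulr_gt0//; first exact: (@posdef_diag n).
by apply: IH; exact: (@posdef_schur n).
Qed.

Lemma posdef_unit n (M : 'M[R]_n) : posdef M -> M \in unitmx.
Proof. by move=> /posdef_det M0; rewrite unitmxE unitfE gt_eqF. Qed.

Lemma cholesky n (M : 'M[R]_n) : posdef M -> exists L : 'M[R]_n, L *m L^T = M.
Proof.
elim: n M => [M _|n IH M Mp]; first by exists 0; apply/matrixP => -[].
have m0 := @posdef_diag n M Mp.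
have [L' EL'] := IH _ (@posdef_schur n M Mp).
have Ms := Mp.1.
pose s := Num.sqrt ((M : 'M[R]_(1 + n)) 0 0).
have s0 : s != 0 by rewrite gt_eqF// sqrtr_gt0.
have s2 : s * s = (M : 'M[R]_(1 + n)) 0 0 by rewrite -expr2 sqr_sqrtr// ltW.
pose u : 'rV[R]_n := ursubmx (M : 'M[R]_(1 + n)).
pose Lb : 'M[R]_(1 + n) := block_mx s%:M 0 (s^-1 *: u^T) L'.
exists Lb; suff : Lb *m Lb^T = (M : 'M[R]_(1 + n)) by [].
rewrite [RHS](@posdef_block n M Ms) -/u /Lb tr_block_mx mulmx_block !trmx0 !mulmx0 !mul0mx !addr0.
rewrite tr_scalar_mx linearZ/= trmxK -scalar_mxM s2 mul_scalar_mx mul_mx_scalar !scalerA mulfV// !scale1r.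
congr block_mx.
rewrite EL' /schur -/u -scalemxAl -scalemxAr scalerA -s2 invfM addrC subrK.
by [].
Qed.

(** With y = v L^T A^-1 and q the value of the form of [A] at y, expanding |v - c y L|^2 >= 0 gives
    |v|^2 - c q >= c (q - c y La y^T), and the right side is positive by hypothesis when y is
    nonzero. *)
Lemma posdef_conj n (A La L : 'M[R]_n) (c : R) : 0 < c -> posdef A -> posdef (A - c *: La) ->
  L *m L^T = La -> posdef (1%:M - c *: (L^T *m invmx A *m L)).
Proof.
move=> c0 Ap [_ ACp] LL; have uA := posdef_unit Ap; have As := Ap.1.
have iAs : (invmx A)^T = invmx A by rewrite trmx_inv As.
split.
  by rewrite linearB/= linearZ/= trmx1 !trmx_mul trmxK iAs mulmxA.
move=> v v0.
pose y := v *m L^T *m invmx A.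
pose q := (y *m L *m v^T) 0 0.
have q1 : (y *m A *m y^T) 0 0 = q.
  have yT : y^T = invmx A *m (L *m v^T) by rewrite /y !trmx_mul trmxK iAs mulmxA.
  by rewrite yT !mulmxA mulmxK.
have -> : (v *m (1%:M - c *: (L^T *m invmx A *m L)) *m v^T) 0 0 = (v *m v^T) 0 0 - c * q.
  rewrite mulmxBr mulmx1 mulmxBl -scalemxAr -scalemxAl /q /y [LHS]mxE [X in _ + X]mxE [in X in _ - X]mxE.
  by rewrite !mulmxA.
pose z := v - c *: (y *m L).
have zz : (z *m z^T) 0 0 = (v *m v^T) 0 0 - 2 * c * q + c ^+ 2 * (y *m La *m y^T) 0 0.
  have qT : (v *m (y *m L)^T) 0 0 = q.
    have -> : v *m (y *m L)^T = (y *m L *m v^T)^T by rewrite [RHS]trmx_mul trmxK.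
    by rewrite mxE.
  have zT : z^T = v^T - c *: (y *m L)^T by rewrite /z linearB linearZ.
  rewrite zT /z mulmxBl !mulmxBr -!scalemxAl -!scalemxAr -LL.
  have yy : y *m (L *m L^T) *m y^T = (y *m L) *m (y *m L)^T.
    rewrite [(y *m L)^T]trmx_mul. by rewrite !mulmxA.
  rewrite yy.
  move: qT; rewrite /q.
  move: (v *m v^T) (v *m (y *m L)^T) (y *m L *m v^T) (y *m L *m (y *m L)^T) => m1 m2 m3 m4 m23.
  by rewrite !mxE m23; ring.
have zz0 := row_sqr_ge0 z.
have [y0|y0] := eqVneq y 0.
  by rewrite /q y0 !mul0mx [in X in _ - X]mxE mulr0 subr0 row_sqr_gt0.
have := ACp y y0; rewrite mulmxBr mulmxBl -scalemxAr -scalemxAl.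
move: zz0 q1; rewrite zz {zz}; clearbody q; move: (y *m La *m y^T) (v *m v^T) (y *m A *m y^T) q => m1 m2 m3 q' h1 h2.
rewrite !mxE h2 => h3; move: h1 h3; move: (m1 0 0) (m2 0 0) => a b h1 h2'.
nra.
Qed.

(** The matrix on the left is similar, through L^T, to A^-1 (A - c La). *)
Lemma det_conj n (A La L : 'M[R]_n) (c : R) : posdef A -> L *m L^T = La -> L \in unitmx ->
  \det (1%:M - c *: (L^T *m invmx A *m L)) = \det (A - c *: La) / \det A.
Proof.
move=> Ap LL uL; have uA := posdef_unit Ap.
have uLT : L^T \in unitmx by rewrite unitmx_tr.
have dA : \det A != 0 by rewrite gt_eqF// posdef_det.
have E : L^T *m (invmx A *m (A - c *: La)) *m invmx L^T = 1%:M - c *: (L^T *m invmx A *m L).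
  rewrite mulmxBr mulVmx// mulmxBr mulmx1 mulmxBl mulmxV//; congr (_ - _).
  by rewrite -!scalemxAr -scalemxAl -LL !mulmxA mulmxK.
have dL : \det L^T != 0 by rewrite -unitfE -unitmxE.
rewrite -E !det_mulmx !det_inv; move: dA dL; move: (\det A) (\det L^T) (\det (A - c *: La)) => x y z x0 y0.
by field; rewrite x0 y0.
Qed.

End PositiveDefinite.

(** * Tail of a normal variable perturbed by an independent quadratic form *)

Section TailAsymptotics.
Context {R : realType}.
Notation nz := (normal_prob (0:R) 1).
Notation mu := (@lebesgue_measure R).

(** The reciprocal of phi(x)/x, the classical equivalent of [Psi x]. *)
Definition tail_scale (x : R) : R := x * expR (x ^+ 2 / 2) / normal_peak 1.

(** The normal tail beyond x - q/(2x) after rescaling. It is nondecreasing in [x], so that monotone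
    convergence suffices for all limits, and its limit is exp(q/2). *)
Definition tail_integral (x q : R) : \bar R :=
  (\int[mu]_(r in `[(- (q / 2))%R, +oo[) (expR (- r - r ^+ 2 / (2 * x ^+ 2)))%:E)%E.

Lemma tail_scale_gt0 (x : R) : 0 < x -> 0 < tail_scale x.
Proof.
by move=> x0; rewrite divr_gt0 ?mulr_gt0 ?expR_gt0 ?normal_peak_gt0 ?oner_neq0.
Qed.

(* The substitution z = x + r / x. *)
Lemma tail_integralE (x q : R) : 0 < x ->
  ((tail_scale x)%:E * nz `[(x - q / (2 * x))%R, +oo[%classic = tail_integral x q)%E.
Proof.
move=> x0; have xn0 : x != 0 by rewrite gt_eqF.
pose F (r : R) := x + r / x.
have dF (r : R) : is_derive r 1 F x^-1.
  by rewrite /F; apply: is_derive_eq; rewrite /GRing.scale/=; ring.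
have F'E : derive1 F = cst x^-1.
  by apply/funext => r; rewrite derive1E; case: (dF r).
have cF : continuous F.
  by move=> r; apply: cvgD; [exact: cvg_cst|exact: mulrr_continuous].
have cphi : continuous (normal_pdf (0:R) 1) by apply: continuous_normal_pdf; exact: oner_neq0.
have Fa : F (- (q / 2)) = x - q / (2 * x) by rewrite /F; field.
rewrite /normal_prob -Fa (@increasing_ge0_integration_by_substitutiony R F (normal_pdf 0 1)).
- rewrite -ge0_integralZl//.
  + apply: eq_integral => r _; rewrite F'E/= -EFinM; congr EFin.
    rewrite !fctE/= normal_pdf1E /tail_scale /F.
    have -> : expR (- r - r ^+ 2 / (2 * x ^+ 2)) = expR (x ^+ 2 / 2) * expR (- ((x + r / x) ^+ 2 / 2)).
      by rewrite -expRD; congr expR; field.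
    have p0 : normal_peak (1:R) != 0 by rewrite gt_eqF// normal_peak_gt0// oner_neq0.
    by move: (expR _) (expR _) (normal_peak 1) p0 => A B C C0; field; rewrite C0 xn0.
  + apply/measurable_EFinP/measurable_funTS; rewrite F'E; apply: measurable_funM => //.
    apply: continuous_measurable_fun => r.
    by apply: continuous_comp; [exact: cF|exact: cphi].
  + by move=> r _; rewrite F'E lee_fin mulr_ge0 ?normal_pdf_ge0// invr_ge0 ltW.
  + by rewrite lee_fin ltW// tail_scale_gt0.
- by move=> r s _ _ rs; rewrite ltrD2l ltr_pM2r// invr_gt0.
- by move=> r _; rewrite F'E; exact: cvg_cst.
- by rewrite F'E; exact: is_cvg_cst.
- by rewrite F'E; exact: is_cvg_cst.
- split; first by move=> r _; case: (dF r).
  by apply: cvg_at_right_filter; exact: cF.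
- apply/cvgryPge => A; near=> r.
  have : (A - x) * x <= r by near: r; apply: nbhs_pinfty_ge; exact: num_real.
  by rewrite -ler_pdivlMr// => ?; rewrite /F; lra.
- exact: continuous_subspaceT.
- by move=> r _; exact: normal_pdf_ge0.
Unshelve. all: by end_near.
Qed.

Let mE (x : R) : measurable_fun setT (fun r : R => expR (- r - r ^+ 2 / (2 * x ^+ 2))).
Proof.
apply: continuous_measurable_fun => r; apply: continuous_cvg; first exact: continuous_expR.
apply: cvgB; first by apply: cvgN; exact: cvg_id.
by apply: cvgM; [exact: exprn_continuous|exact: cvg_cst].
Qed.

Lemma integral_expRN (q : R) :
  (\int[mu]_(r in `[(- (q / 2))%R, +oo[) (expR (- r))%:E = (expR (q / 2))%:E)%E.
Proof.
have D (r : R) : is_derive r 1 (fun r : R => - expR (- r)) (expR (- r)).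
  by apply: is_derive_eq; rewrite /GRing.scale/=; ring.
have c1 : continuous (fun r : R => expR (- r)).
  by move=> r; apply: continuous_cvg; [exact: continuous_expR|apply: cvgN; exact: cvg_id].
rewrite (@ge0_continuous_FTC2y R (fun r => expR (- r)) (fun r => - expR (- r)) _ 0).
- by rewrite opprK sub0e -EFinN !opprK.
- by move=> r _; exact: expR_ge0.
- exact: continuous_subspaceT.
- rewrite -oppr0; apply: cvgN; exact: cvgr_expR.
- by move=> r _; case: (D r).
- by apply: cvg_at_right_filter; apply: cvgN; exact: c1.
- by move=> r _; rewrite derive1E; case: (D r).
Qed.

Lemma tail_integral_le (x q : R) : 0 < x -> (tail_integral x q <= (expR (q / 2))%:E)%E.
Proof.
move=> x0; rewrite -integral_expRN; apply: ge0_le_integral => //=.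
- by apply/measurable_EFinP/measurable_funTS; exact: mE.
- by apply/measurable_EFinP/measurable_funTS; apply: measurableT_comp => //; exact: measurableT_comp.
- move=> r _; rewrite lee_fin ler_expR lerBlDr lerDl divr_ge0 ?sqr_ge0//.
  by rewrite mulr_ge0 ?sqr_ge0.
Qed.

Lemma tail_integral_ge0 (x q : R) : (0 <= tail_integral x q)%E.
Proof. by apply: integral_ge0 => r _; rewrite lee_fin expR_ge0. Qed.

Lemma tail_integral_homo (x y q : R) : 0 < x -> x <= y ->
  (tail_integral x q <= tail_integral y q)%E.
Proof.
move=> x0 xy; have y0 : 0 < y by exact: lt_le_trans xy.
apply: ge0_le_integral => //=.
- by apply/measurable_EFinP/measurable_funTS; exact: mE.
- by apply/measurable_EFinP/measurable_funTS; exact: mE.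
- move=> r _; rewrite lee_fin ler_expR lerD2l lerN2.
  rewrite ler_wpM2l ?sqr_ge0// lef_pV2 ?posrE ?mulr_gt0 ?exprn_gt0//.
  by rewrite ler_wpM2l// ler_pXn2r// nnegrE ltW.
Qed.

Lemma tail_integral_cvg (q : R) :
  (tail_integral n.+1%:R q @[n --> \oo] --> (expR (q / 2))%:E)%E.
Proof.
rewrite -integral_expRN.
have -> : (\int[mu]_(r in `[(- (q / 2))%R, +oo[) (expR (- r))%:E =
   \int[mu]_(r in `[(- (q / 2))%R, +oo[) limn (fun n => (expR (- r - r ^+ 2 / (2 * n.+1%:R ^+ 2)))%:E))%E.
  apply: eq_integral => r _; apply/esym/cvg_lim => //.
  apply: cvg_EFin; first exact: nearW.
  apply: continuous_cvg; first exact: continuous_expR.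
  rewrite -[X in _ --> X]subr0; apply: cvgB; first exact: cvg_cst.
  apply/cvgr0Pnorm_le => e e0; near=> n.
  have nn : n.+1%:R <= (n.+1%:R : R) ^+ 2 by rewrite expr2 ler_peMr// ler1n.
  have n0 : (0:R) < n.+1%:R ^+ 2 by rewrite exprn_gt0.
  have h : r ^+ 2 / e <= n%:R by near: n; exact: nbhs_infty_ger.
  have h2 : r ^+ 2 <= n%:R * e by rewrite -ler_pdivrMr.
  have d0 : 0 < 2 * n.+1%:R ^+ 2 :> R by rewrite mulr_gt0.
  rewrite ger0_norm; last by rewrite divr_ge0 ?sqr_ge0// ltW.
  rewrite ler_pdivrMr//; apply: (le_trans h2); rewrite mulrC ler_wpM2l ?(ltW e0)//.
  by move: nn n0; rewrite -natr1; lra.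
apply: cvg_monotone_convergence => //.
- by move=> n; apply/measurable_EFinP/measurable_funTS; exact: mE.
- move=> r _ m n mn; rewrite lee_fin ler_expR lerD2l lerN2.
  rewrite ler_wpM2l ?sqr_ge0// lef_pV2 ?posrE ?mulr_gt0 ?exprn_gt0//.
  by rewrite ler_wpM2l// ler_pXn2r ?nnegrE// ler_nat.
Unshelve. all: by end_near.
Qed.

Lemma PsiE (x : R) : nz `[x, +oo[%classic = (Psi x)%:E.
Proof.
rewrite /Psi /Rintegral fineK//; exact: (@fin_num_measure _ _ _ nz).
Qed.

End TailAsymptotics.

(** * Exponential moments of Gaussian quadratic forms and the perturbed tail *)

Section GaussianQuadratic.
Context {d} {T : measurableType d} {R : realType} (P : probability T R).
Variable S : set (T -> R).
Hypothesis gS : gspace P S.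
Notation nz := (normal_prob (0:R) 1).

Definition quad n (M : 'M[R]_n) (G : 'I_n -> T -> R) (w : T) : R :=
  \sum_i \sum_j M i j * (G i w * G j w).

Lemma measurable_quad d' (T' : measurableType d') n (M : 'M[R]_n) (G : 'I_n -> T' -> R) :
  (forall i, measurable_fun setT (G i)) ->
  measurable_fun setT (fun w => \sum_i \sum_j M i j * (G i w * G j w)).
Proof.
move=> mG; apply: measurable_sum => i; apply: measurable_sum => j.
by apply: measurable_funM => //; exact: measurable_funM.
Qed.

Lemma schurE n (M : 'M[R]_n.+1) i j : (@schur R n M) i j =
  M (lift ord0 i) (lift ord0 j) - (M ord0 ord0)^-1 * (M ord0 (lift ord0 i) * M ord0 (lift ord0 j)).
Proof.
have er (k : 'I_n) : rshift 1 k = lift ord0 k by apply: (@ord_inj (1 + n)).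
have el (k : 'I_1) : lshift n k = ord0 by rewrite ord1; apply: (@ord_inj (1 + n)).
by rewrite /schur !mxE big_ord1 !mxE !er !el.
Qed.

(** Induction on the dimension: the first variable is independent of the others and is integrated
    out by [integrable_expR_normal]. What remains is the same problem for the Schur complement of 1
    - B, and the factor (1 - b)^(-1/2) is the one split off by [det_schur]. *)
Lemma integral_quad_orthonormal n (W : 'I_n -> T -> R) (B : 'M[R]_n) :
  (forall i, S (W i)) -> (forall i j, cov P (W i) (W j) = (i == j)%:R) ->
  posdef (1%:M - B) ->
  (\int[P]_w (expR (quad B W w / 2))%:E = ((Num.sqrt (\det (1%:M - B)))^-1)%:E)%E.
Proof.
elim: n W B => [|n IH] W B SW oW Bp.
  rewrite det_mx00 sqrtr1 invr1.
  under eq_integral do rewrite /quad big_ord0 mul0r expR0.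
  by rewrite integral_cst// mul1e; exact: probability_setT.
pose V := W ord0; pose W' i := W (lift ord0 i); pose b := B ord0 ord0.
pose be i := B ord0 (lift ord0 i).
pose B' : 'M[R]_n := \matrix_(i, j) B (lift ord0 i) (lift ord0 j).
have Bs i j : B i j = B j i.
  have := Bp.1 => /matrixP/(_ j i); rewrite !mxE (eq_sym j).
  by move: (_%:R) (B i j) (B j i) => x y z; lra.
have b1 : b < 1.
  by have := @posdef_diag R n _ Bp; rewrite !mxE eqxx subr_gt0.
have b1' : 0 < 1 - b by rewrite subr_gt0.
have UW i : uncorr P S V (W' i).
  by split; [exact: SW|exact: (etrans (oW _ _))].
pose l w := \sum_j be j * W' j w.
pose F (p : measurableTypeR R * cylType (uncorr P S V)) : \bar R :=
  ((expR (b * p.1 ^+ 2 / 2 + p.1 * l p.2)) * expR (quad B' W' p.2 / 2))%:E.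
have mW' i : measurable_fun setT (W' i : cylType (uncorr P S V) -> R) by exact: measurable_cyl.
have ml : measurable_fun setT (l : cylType (uncorr P S V) -> R).
  by apply: measurable_sum => j; exact: measurable_funM.
have mq : measurable_fun setT (quad B' W' : cylType (uncorr P S V) -> R).
  exact: measurable_quad.
have mF : measurable_fun setT F.
  apply/measurable_EFinP; apply: measurable_funM; apply: measurableT_comp => //.
    apply: measurable_funD.
      apply: measurable_funM => //; apply: measurable_funM => //.
      by apply: measurable_funX; exact: measurable_fst.
    apply: measurable_funM; first exact: measurable_fst.
    by apply: measurableT_comp => //; exact: measurable_snd.
  by apply: measurable_funM => //; apply: measurableT_comp => //; exact: measurable_snd.
have quadF w : quad B W w = b * V w ^+ 2 + 2 * (V w * l w) + quad B' W' w.
  rewrite /quad big_ord_recl/= big_ord_recl/= -/b -/V.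
  under [X in _ + X]eq_bigr do rewrite big_ord_recl/=.
  rewrite big_split/=.
  have -> : \sum_(i < n) B ord0 (lift ord0 i) * (V w * W (lift ord0 i) w) = V w * l w.
    by rewrite /l mulr_sumr; apply: eq_bigr => i _; rewrite /be/W'; ring.
  have -> : \sum_(i < n) B (lift ord0 i) ord0 * (W (lift ord0 i) w * W ord0 w) = V w * l w.
    by rewrite /l mulr_sumr; apply: eq_bigr => i _; rewrite /be/W'/V Bs; ring.
  under [X in _ + (_ + X)]eq_bigr do under eq_bigr do rewrite -/(W' _) -/(W' _).
  have -> : \sum_(i < n) \sum_(j < n) B (lift ord0 i) (lift ord0 j) * (W (lift ord0 i) w * W (lift ord0 j) w)
     = \sum_(i < n) \sum_(j < n) B' i j * (W' i w * W' j w).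
    by apply: eq_bigr => i _; apply: eq_bigr => j _; rewrite mxE.
  by ring.
have V1 : cov P V V = 1 by rewrite /V oW eqxx.
transitivity (\int[P]_w F (V w, w))%E.
  apply: eq_integral => w _; rewrite /F/= -expRD quadF; congr (expR _)%:E.
  by field.
rewrite (indep_integral gS (SW ord0) V1 mF); last by move=> p; rewrite lee_fin mulr_ge0 ?expR_ge0.
have [_ _] := integrable_expR_normal 0 b1.
(* Integrating out [V] adds to [B'] the rank-one matrix be_i be_j / (1 - b), and this is exactly
   passage to the Schur complement. *)
pose B'' := 1%:M - @schur R n (1%:M - B).
have B''E i j : B'' i j = B' i j + be i * be j / (1 - b).
  rewrite /B'' mxE [X in _ + X]mxE schurE !mxE /= !sub0r -/b -/(be i) -/(be j) (inj_eq lift_inj).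
  by rewrite (eq_sym i) mulrNN; ring.
transitivity (\int[P]_w (((Num.sqrt (1 - b))^-1)%:E * (expR (quad B'' W' w / 2))%:E))%E.
  apply: eq_integral => w _; rewrite /F/=.
  under eq_integral do rewrite EFinM muleC.
  rewrite ge0_integralZl ?lee_fin ?expR_ge0//; last first.
    exact: (measurable_int _ (integrable_expR_normal (l w) b1).1).
  have [_ ->] := integrable_expR_normal (l w) b1.
  rewrite -!EFinM mulrCA -expRD; congr (_ * expR _)%:E.
  have -> : quad B'' W' w = quad B' W' w + l w ^+ 2 / (1 - b).
    have -> : l w ^+ 2 = \sum_i \sum_j be i * be j * (W' i w * W' j w).
      rewrite expr2 {1}/l mulr_suml; apply: eq_bigr => i _.
      by rewrite /l mulr_sumr; apply: eq_bigr => j _; ring.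
    rewrite /quad mulr_suml -big_split/=; apply: eq_bigr => i _.
    by rewrite mulr_suml -big_split/=; apply: eq_bigr => j _; rewrite B''E; ring.
  move: (quad B' W' w) (l w) => q m; field.
  by rewrite gt_eqF.
rewrite ge0_integralZl ?lee_fin ?invr_ge0 ?sqrtr_ge0//; last first.
  apply/measurable_EFinP; apply: measurableT_comp => //; apply: measurable_funM => //.
  by apply: measurable_quad => i; exact: (gspace_measurable gS (SW _)).
have SW' i : S (W' i) by exact: SW.
rewrite (IH W' B'' SW') //; last 2 first.
- by move=> i j; rewrite oW (inj_eq lift_inj).
- by rewrite /B'' opprB addrC subrK; exact: (@posdef_schur R n).
have -> : 1%:M - B'' = @schur R n (1%:M - B) by rewrite /B'' opprB addrC subrK.
rewrite (@det_schur R n _ Bp) !mxE eqxx -/b -EFinM; congr _%:E.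
by rewrite sqrtrM ?ltW// invfM.
Qed.

(** Whitening: with La = L L^T the variables L^-1 G are orthonormal and the form becomes c L^T A^-1
    L, to which [posdef_conj] and [det_conj] apply. *)
Lemma integral_quad n (G : 'I_n -> T -> R) (A La : 'M[R]_n) (c : R) :
  (forall i, S (G i)) -> (forall i j, cov P (G i) (G j) = La i j) ->
  0 < c -> posdef A -> posdef La -> posdef (A - c *: La) ->
  (\int[P]_w (expR (c * quad (invmx A) G w / 2))%:E =
   (Num.sqrt (\det A / \det (A - c *: La)))%:E)%E.
Proof.
move=> SG cG c0 Ap Lp ACp.
have [L LL] := cholesky Lp.
have uL : L \in unitmx.
  have := posdef_unit Lp; rewrite -LL !unitmxE det_mulmx.
  by rewrite unitrM => /andP[].
pose W i w := \sum_j invmx L i j * G j w.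
pose B := c *: (L^T *m invmx A *m L).
have SW i : S (W i) by apply: (gspace_sum gS) => j _; exact: (gspaceZ gS _ (SG j)).
have oW i j : cov P (W i) (W j) = (i == j)%:R.
  have -> : cov P (W i) (W j) = (invmx L *m La *m (invmx L)^T) i j.
    rewrite (cov_suml gS)//; last by move=> k _; exact: (gspaceZ gS _ (SG k)).
    rewrite mxE.
    transitivity (\sum_i0 \sum_j0 (invmx L i i0 * La i0 j0 * invmx L j j0)).
      apply: eq_bigr => p _; rewrite (covZl gS)// covC (cov_suml gS)//; last by move=> k _; exact: (gspaceZ gS _ (SG k)).
      by rewrite mulr_sumr; apply: eq_bigr => q _; rewrite (covZl gS)// covC cG; ring.
    by rewrite exchange_big/=; apply: eq_bigr => q _; rewrite !mxE mulr_suml.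
  rewrite -LL !mulmxA mulVmx// mul1mx trmx_inv mulmxV ?unitmx_tr//.
  by rewrite mxE.
have Bp : posdef (1%:M - B) by exact: (posdef_conj c0 Ap ACp LL).
have QE w : quad B W w = c * quad (invmx A) G w.
  pose gv : 'rV[R]_n := \row_i G i w; pose wv : 'rV[R]_n := \row_i W i w.
  have -> : quad B W w = (wv *m B *m wv^T) 0 0.
    by rewrite quadE; apply: eq_bigr => i _; apply: eq_bigr => j _; rewrite !mxE.
  have -> : quad (invmx A) G w = (gv *m invmx A *m gv^T) 0 0.
    by rewrite quadE; apply: eq_bigr => i _; apply: eq_bigr => j _; rewrite !mxE.
  have gw : gv = wv *m L^T.
    have -> : wv = gv *m (invmx L)^T.
      by apply/rowP => i; rewrite !mxE; apply: eq_bigr => j _; rewrite !mxE mulrC.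
    by rewrite trmx_inv mulmxKV// unitmx_tr.
  rewrite gw trmx_mul trmxK /B -scalemxAr -scalemxAl [LHS]mxE; congr (_ * _).
  by rewrite !mulmxA.
under eq_integral do rewrite -QE.
rewrite integral_quad_orthonormal//; congr _%:E.
by rewrite (det_conj c Ap LL uL) -sqrtrV ?invfM ?invrK ?divr_ge0 ?ltW ?posdef_det// mulrC.
Qed.

Variables (V q : T -> R) (Dq : R).
Hypothesis SV : S V.
Hypothesis V1 : cov P V V = 1.
Hypothesis mq : measurable_fun setT (q : cylType (uncorr P S V) -> R).
Hypothesis qD : (\int[P]_w (expR (q w / 2))%:E = Dq%:E)%E.

(** For fixed w the integral over [V] is a normal tail beyond x - q/(2x), and [tail_integralE]
    rescales it. The event [E] is carried along because the lower bound has to be localised. *)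
Lemma tail_probE (E : set (cylType (uncorr P S V))) (x : R) : measurable E -> 0 < x ->
  measurable ([set w | x <= V w + q w / (2 * x)] `&` E : set T) /\
  ((tail_scale x)%:E * P ([set w | x <= V w + q w / (2 * x)]%R `&` E) =
   \int[P]_w ((\1_E w)%:E * tail_integral x (q w)))%E.
Proof.
move=> mE x0.
have mid : measurable_fun setT (idfun : T -> cylType (uncorr P S V)).
  exact: (measurable_cyl_id (uncorr_measurable gS (V:=V))).
have mET : measurable (E : set T).
  by have := mid measurableT _ mE; rewrite setTI.
have mqT : measurable_fun setT (q : T -> R) by exact: (measurableT_comp mq mid).
have mV := gspace_measurable gS SV.
have mA : measurable [set w | x <= V w + q w / (2 * x)].
  have mf : measurable_fun setT (fun w => V w + q w / (2 * x)).
    by apply: measurable_funD => //; exact: measurable_funM.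
  rewrite (_ : [set w | _] = (fun w => V w + q w / (2 * x)) @^-1` `[x, +oo[%classic).
    exact: measurable_preimageT.
  by apply/seteqP; split => w /=; rewrite in_itv/= andbT.
split; first exact: measurableI.
pose C : set (measurableTypeR R * cylType (uncorr P S V)) :=
  [set p | x <= (p.1 : R) + q p.2 / (2 * x)] `&` [set p | E p.2].
have mC : measurable C.
  apply: measurableI.
    have mf : measurable_fun setT (fun p : measurableTypeR R * cylType (uncorr P S V) => (p.1 : R) + q p.2 / (2 * x)).
      apply: measurable_funD; first exact: measurable_fst.
      by apply: measurable_funM => //; apply: measurableT_comp => //; exact: measurable_snd.
    rewrite (_ : [set w | _] = (fun p : measurableTypeR R * cylType (uncorr P S V) => (p.1 : R) + q p.2 / (2 * x)) @^-1` `[x, +oo[%classic).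
      exact: measurable_preimageT.
    by apply/seteqP; split => w /=; rewrite in_itv/= andbT.
  have := @measurable_snd _ _ (measurableTypeR R) (cylType (uncorr P S V)) measurableT _ mE.
  by rewrite setTI.
pose F (p : measurableTypeR R * cylType (uncorr P S V)) : \bar R := (\1_C p)%:E.
have mF : measurable_fun setT F.
  by apply/measurable_EFinP; exact: measurable_indic.
have F0 p : (0 <= F p)%E by rewrite lee_fin.
have PE : (P ([set w | x <= V w + q w / (2 * x)]%R `&` E) = \int[P]_w F (V w, w))%E.
  transitivity (\int[P]_w (\1_([set w | x <= V w + q w / (2 * x)]%R `&` E) w)%:E)%E.
    by rewrite integral_indic ?setIT//; exact: measurableI.
  apply: eq_integral => w _; rewrite /F /= !indicE.
  suff -> : (w \in [set w | x <= V w + q w / (2 * x)]%R `&` E) = ((V w, w) \in C) by [].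
  by apply/idP/idP; rewrite !inE.
rewrite PE (indep_integral gS SV V1 mF F0).
rewrite -ge0_integralZl ?lee_fin ?(ltW (tail_scale_gt0 x0))//; last 2 first.
- have := @measurable_fun_fubini_tonelli_G _ _ (measurableTypeR R) (cylType (uncorr P S V)) R nz F mF F0.
  by move=> h; exact: (measurableT_comp h mid).
- by move=> w _; apply: integral_ge0.
apply: eq_integral => w _.
have -> : (\int[nz]_z F (z, w) = (\1_E w)%:E * nz `[(x - q w / (2 * x))%R, +oo[%classic)%E.
  rewrite [in RHS]indicE; have [wE|wE] := boolP (w \in E).
    rewrite mul1e.
    transitivity (\int[nz]_z (\1_(`[(x - q w / (2 * x))%R, +oo[%classic) z)%:E)%E; last first.
      by rewrite integral_indic ?setIT.
    apply: eq_integral => z _; rewrite /F !indicE.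
    suff -> : (z \in `[(x - q w / (2 * x))%R, +oo[%classic) = ((z, w) \in C) by [].
    move: wE; rewrite inE => wE.
    apply/idP/idP; rewrite !inE /C/= in_itv/= andbT lerBlDr//.
    by case.
  rewrite mul0e; apply: integral0_eq => z _; rewrite /F indicE memNset//.
  by move=> [_ /= /mem_set]; apply/negP.
by rewrite muleCA tail_integralE.
Qed.

Lemma measurable_tail_prob x : 0 < x -> measurable [set w | x <= V w + q w / (2 * x)].
Proof. by move=> x0; have [+ _] := tail_probE measurableT x0; rewrite setIT. Qed.

Let mtail x : 0 < x -> measurable_fun setT (fun w : T => tail_integral x (q w)).
Proof.
move=> x0; rewrite /tail_integral.
have mqT : measurable_fun setT (q : T -> R).
  exact: (measurableT_comp mq (measurable_cyl_id (uncorr_measurable gS (V:=V)))).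
rewrite (_ : (fun w => _) = (fun w => (tail_scale x)%:E * nz `[(x - q w / (2 * x))%R, +oo[%classic)%E); last first.
  by apply/funext => w; rewrite tail_integralE.
apply: measurable_funeM.
pose g (z : R) := fine (nz `[z, +oo[%classic).
have gE z : (nz `[z, +oo[%classic = (g z)%:E)%E by rewrite /g fineK//; exact: (@fin_num_measure _ _ _ nz).
under eq_fun do rewrite gE; apply/measurable_EFinP.
(* The normal tail is monotone in its threshold, hence a measurable function of it. *)
have mg : measurable_fun setT (fun z => - g z).
  apply: nondecreasing_measurable => // u v uv; rewrite /g lerN2 fine_le//; try exact: (@fin_num_measure _ _ _ nz).
  by apply: le_measure; rewrite ?inE//; apply/subitvPl; rewrite bnd_simp.
have mg' : measurable_fun setT g.
  by have := measurableT_comp (@oppr_measurable R setT) mg; apply: eq_measurable_fun => z _ /=; rewrite opprK.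
apply: (measurableT_comp mg'); apply: measurable_funB => //; exact: measurable_funM.
Qed.

Lemma tail_prob_le x : 0 < x ->
  ((tail_scale x)%:E * P [set w | x <= V w + q w / (2 * x)]%R <= Dq%:E)%E.
Proof.
move=> x0; have [_] := tail_probE measurableT x0; rewrite setIT => ->.
rewrite -qD; apply: ge0_le_integral => //=.
- by move=> w _; rewrite indicT mul1e tail_integral_ge0.
- by under eq_fun do rewrite indicT mul1e; exact: mtail.
- apply/measurable_EFinP; apply: measurableT_comp => //; apply: measurable_funM => //.
  exact: (measurableT_comp mq (measurable_cyl_id (uncorr_measurable gS (V:=V)))).
- by move=> w _; rewrite indicT mul1e; exact: tail_integral_le.
Qed.

(** As [E x] increases to the whole space, the integrand in [tail_probE] increases to exp(q/2).
    Monotonicity in the real variable x carries a bound found at one integer to all larger x. *)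
Lemma tail_prob_ge (E : R -> set (cylType (uncorr P S V))) (e : R) : 0 < e ->
  (forall x, measurable (E x)) -> (forall x y, x <= y -> E x `<=` E y) ->
  (forall w, exists x, E x w) ->
  exists2 x0, 0 < x0 & forall x, x0 <= x ->
    ((Dq - e)%:E <= (tail_scale x)%:E * P ([set w | x <= V w + q w / (2 * x)]%R `&` E x))%E.
Proof.
move=> e0 mE hE cE.
have mid : measurable_fun setT (idfun : T -> cylType (uncorr P S V)).
  exact: (measurable_cyl_id (uncorr_measurable gS (V:=V))).
pose f (x : R) (w : T) : \bar R := ((\1_(E x) w)%:E * tail_integral x (q w))%E.
have f0 x w : (0 <= f x w)%E by rewrite mule_ge0 ?tail_integral_ge0// lee_fin.
have mf x : 0 < x -> measurable_fun setT (f x).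
  move=> x0; apply: emeasurable_funM; last exact: mtail.
  apply/measurable_EFinP.
  have h : measurable_fun setT (\1_(E x) : cylType (uncorr P S V) -> R) by exact: measurable_indic.
  exact: (measurableT_comp h mid).
have hf x y w : 0 < x -> x <= y -> (f x w <= f y w)%E.
  move=> x0 xy; apply: lee_pmul => //; rewrite ?tail_integral_ge0 ?lee_fin//; last exact: tail_integral_homo.
  rewrite !indicE ler_nat; case: (boolP (w \in E x)) => //; rewrite inE => /(hE _ _ xy) h.
  by rewrite mem_set.
have fc w : (f n.+1%:R w @[n --> \oo] --> (expR (q w / 2))%:E)%E.
  have [x Ex] := cE w.
  apply: cvg_trans (@tail_integral_cvg R (q w)); apply: near_eq_cvg.
  near=> n; rewrite /f indicE mem_set ?mul1e//.
  apply: (hE x) => //; have : ((Num.truncn `|x|).+1 <= n.+1)%N.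
    by rewrite ltnS; near: n; exact: nbhs_infty_ge.
  rewrite -(ler_nat R); apply: le_trans.
  by rewrite (le_trans (ler_norm _))// ltW// Num.Theory.truncnS_gt.
have n0 n : 0 < n.+1%:R :> R by rewrite ltr0n.
have hnd w : setT w -> {homo (fun n => f n.+1%:R w) : m n / (m <= n)%N >-> (m <= n)%E}.
  by move=> _ m n mn; apply: hf => //; rewrite ler_nat ltnS.
have := @cvg_monotone_convergence _ _ _ P setT measurableT (fun n w => f n.+1%:R w)
   (fun n => mf _ (n0 n)) (fun n w _ => f0 _ _) hnd.
have -> : (\int[P]_(x in setT) limn (fun n => f n.+1%:R x) = Dq%:E)%E.
  by rewrite -qD; apply: eq_integral => w _; exact/cvg_lim.
move=> cv.
have [n hn] : exists n, ((Dq - e)%:E <= \int[P]_w f n.+1%:R w)%E.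
  have lt : ((Dq - e)%:E < Dq%:E)%E by rewrite lte_fin ltrBlDr ltrDl.
  have /cv[n _ /(_ n (leqnn n)) h] : nbhs Dq%:E [set y | (Dq - e)%:E < y]%E.
    by apply: open_nbhs_nbhs; split; [exact: open_ereal_gt_ereal|].
  by exists n; exact/ltW.
exists n.+1%:R => // x nx; have x0 : 0 < x by exact: lt_le_trans nx.
have [_ ->] := tail_probE (mE x) x0.
apply: (le_trans hn); apply: ge0_le_integral => //=; try exact: mf.
by move=> w _; exact: hf.
Unshelve. all: by end_near. Qed.

End GaussianQuadratic.

(** * Exponentially small events and chaining *)

Section ExponentiallySmall.
Context {d} {T : measurableType d} {R : realType} (P : probability T R).

(** A covering measurable set is asked for because [A u] is typically a union over all points of the
    box, whose measurability is not established. *)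
Definition exp_small (M : R) (A : R -> set T) : Prop :=
  exists u0 : R, forall u, u0 <= u -> exists F : set T,
    [/\ measurable F, (P F <= (expR (- (M * u ^+ 2)))%:E)%E & A u `<=` F].

Lemma exp_small_sub M A B : (\forall u \near +oo, A u `<=` B u) ->
  exp_small M B -> exp_small M A.
Proof.
move=> [u1 [_ AB]] [u0 h]; exists (Num.max u0 (u1 + 1)) => u; rewrite ge_max => /andP[u0u u1u].
have [F [mF PF BF]] := h u u0u; exists F; split => //.
by apply: subset_trans BF; apply: AB; rewrite (lt_le_trans _ u1u)// ltrDl.
Qed.

Lemma exp_small_le M M' A : M' <= M -> exp_small M A -> exp_small M' A.
Proof.
move=> MM [u0 h]; exists u0 => u /h[F [mF PF AF]]; exists F; split => //.
by apply: (le_trans PF); rewrite lee_fin ler_expR lerN2 ler_wpM2r ?sqr_ge0.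
Qed.

Lemma exp_small0 M : exp_small M (fun=> set0).
Proof. by exists 0 => u _; exists set0; split => //; rewrite measure0 lee_fin expR_ge0. Qed.

Lemma exp_smallU M M' A B : M' < M -> exp_small M A -> exp_small M B ->
  exp_small M' (fun u => A u `|` B u).
Proof.
(* For such u one has (M - M') u^2 >= 1, so the loss in rate absorbs the factor 2 of the union
   bound. *)
move=> MM [u1 h1] [u2 h2]; exists (Num.max (Num.max u1 u2) (1 + (M - M')^-1)) => u.
rewrite !ge_max => /andP[/andP[/h1[F1 [m1 P1 A1]] /h2[F2 [m2 P2 A2]]] u3].
exists (F1 `|` F2); split; [exact: measurableU| |exact: setUSS].
apply: (le_trans (measureU2 _ m1 m2)); apply: (le_trans (leeD P1 P2)).
rewrite -EFinD lee_fin -mulr2n -mulr_natl.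
have dM : 0 < M - M' by rewrite subr_gt0.
have iM : 0 < (M - M')^-1 by rewrite invr_gt0.
have uu : 1 <= (M - M') * u ^+ 2.
  have u1' : 1 <= u by lra.
  have : (M - M') * (M - M')^-1 <= (M - M') * u by rewrite ler_pM2l//; lra.
  rewrite mulfV ?gt_eqF// => h; nra.
have -> : - (M' * u ^+ 2) = (M - M') * u ^+ 2 + - (M * u ^+ 2) by ring.
rewrite expRD ler_pM2r ?expR_gt0//.
apply: le_trans (expR_ge1Dx _); lra.
Qed.

Lemma exp_small_exists (I : finType) M M' (A : I -> R -> set T) : M' < M ->
  (forall i, exp_small M (A i)) -> exp_small M' (fun u => [set w | exists i, A i u w]).
Proof.
move=> MM h.
suff H (s : seq I) : forall M', M' < M -> exp_small M' (fun u => [set w | exists2 i, i \in s & A i u w]).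
  apply: exp_small_sub (H (enum I) _ MM); near=> u => w [i Ai].
  by exists i => //; rewrite mem_enum.
elim: s => [M1 _|i s IH M1 M1M].
  apply: exp_small_sub (exp_small0 M1); near=> u => w [i] /=.
  by rewrite in_nil.
have M2 : M1 < (M1 + M) / 2 by lra.
have M3 : (M1 + M) / 2 < M by lra.
apply: exp_small_sub (exp_smallU M2 (exp_small_le (ltW M3) (h i)) (IH _ M3)).
near=> u => w [j]; rewrite in_cons => /predU1P[->|js] Aj; first by left.
by right; exists j.
Unshelve. all: by end_near. Qed.

Lemma measure_exists_le (I : finType) (A : I -> set T) (e : R) :
  (forall i, measurable (A i)) -> (forall i, (P (A i) <= e%:E)%E) ->
  measurable [set w | exists i, A i w] /\
  (P [set w | exists i, A i w] <= (#|I|%:R * e)%:E)%E.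
Proof.
move=> mA Ae.
suff H (s : seq I) : measurable [set w | exists2 i, i \in s & A i w] /\
    (P [set w | exists2 i, i \in s & A i w] <= ((size s)%:R * e)%:E)%E.
  rewrite cardE; have -> : [set w | exists i, A i w] = [set w | exists2 i, i \in enum I & A i w].
    by apply/seteqP; split => w [i]; [exists i; rewrite ?mem_enum|exists i].
  exact: H.
elim: s => [|i s [IH1 IH2]].
  rewrite (_ : [set _ | _] = set0); first by rewrite measure0 mul0r; split.
  by apply/seteqP; split => w // [].
rewrite (_ : [set _ | _] = A i `|` [set w | exists2 i, i \in s & A i w]).
  split; first exact: measurableU.
  apply: (le_trans (measureU2 _ (mA i) IH1)).
  by rewrite /= -natr1 mulrDl mul1r addrC EFinD leeD.
apply/seteqP; split => w.
  by move=> [j]; rewrite in_cons => /predU1P[->|js] Aj; [left|right; exists j].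
by move=> [Ai|[j js Aj]]; [exists i => //; exact: mem_head|exists j => //; rewrite in_cons js orbT].
Qed.

End ExponentiallySmall.

(** * Dyadic grids of the box *)

Section Grid.
Context {R : realType} {N : nat} (a b : 'rV[R]_N).
Hypothesis hab : forall i, a 0 i < b 0 i.

(** There are 2^n + 1 values per side: a coordinate equal to its upper end point has index 2^n. *)
Definition grid_index n := {ffun 'I_N -> 'I_(2 ^ n).+1}.

Definition grid_point n (p : grid_index n) : 'rV[R]_N :=
  \row_i (a 0 i + (b 0 i - a 0 i) * ((p i)%:R / 2 ^+ n)).

Definition grid_cell n (t : 'rV[R]_N) : grid_index n :=
  [ffun i => inord (Num.truncn (2 ^+ n * ((t 0 i - a 0 i) / (b 0 i - a 0 i))))].

Definition grid_proj n (t : 'rV[R]_N) := grid_point (grid_cell n t).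

Lemma grid_point_box n (p : grid_index n) : box a b (grid_point p).
Proof.
move=> i; rewrite mxE.
have ba : 0 < b 0 i - a 0 i by rewrite subr_gt0.
have q0 : 0 <= (p i)%:R / 2 ^+ n :> R by rewrite divr_ge0// exprn_ge0.
have q1 : (p i)%:R / 2 ^+ n <= 1 :> R.
  by rewrite ler_pdivrMr ?exprn_gt0// mul1r -natrX ler_nat -ltnS ltn_ord.
by apply/andP; split; nra.
Qed.

Lemma grid_proj_near n t i : box a b t ->
  0 <= t 0 i - grid_proj n t 0 i <= (b 0 i - a 0 i) / 2 ^+ n.
Proof.
move=> bt; rewrite /grid_proj mxE ffunE.
have ba : 0 < b 0 i - a 0 i by rewrite subr_gt0.
have /andP[ta tb] := bt i.
set x := (t 0 i - a 0 i) / (b 0 i - a 0 i).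
have x0 : 0 <= x by rewrite divr_ge0 ?subr_ge0// ltW.
have x1 : x <= 1 by rewrite ler_pdivrMr// mul1r lerD2r.
have tx : t 0 i = a 0 i + (b 0 i - a 0 i) * x by rewrite /x mulrC divfK ?gt_eqF//; ring.
have e0 : 0 < 2 ^+ n :> R by rewrite exprn_gt0.
have /andP[h1 h2] := truncn_itv (mulr_ge0 (ltW e0) x0).
have lt : (Num.truncn (2 ^+ n * x) < (2 ^ n).+1)%N.
  rewrite ltnS -(ler_nat R); apply: (le_trans h1); rewrite natrX.
  by rewrite ler_piMr// ltW.
rewrite inordK// tx; move: h1 h2 => /=; set m := Num.truncn _.
have -> : m.+1%:R = m%:R + 1 :> R by rewrite natr1.
move: (m%:R : R) (2 ^+ n) e0 => {}m e {lt} e0 h1 h2.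
have k1 : m / e <= x by rewrite ler_pdivrMr// mulrC.
have k2 : x <= m / e + e^-1.
  have : x <= (m + 1) / e by rewrite ler_pdivlMr// mulrC ltW.
  by rewrite mulrDl mul1r.
have ei : 0 < e^-1 by rewrite invr_gt0.
by apply/andP; split; nra.
Qed.

Lemma grid_proj_step n t i : box a b t ->
  `|grid_proj n.+1 t 0 i - grid_proj n t 0 i| <= (b 0 i - a 0 i) / 2 ^+ n.
Proof.
move=> bt; have /andP[h1 h2] := grid_proj_near n i bt.
have /andP[h3 h4] := grid_proj_near n.+1 i bt.
have h5 : (b 0 i - a 0 i) / 2 ^+ n.+1 <= (b 0 i - a 0 i) / 2 ^+ n.
  apply: ler_wpM2l; first by rewrite subr_ge0 ltW.
  by rewrite lef_pV2 ?posrE ?exprn_gt0// exprS ler_peMl ?exprn_ge0// ler1n.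
by rewrite ler_norml; apply/andP; split; lra.
Qed.

Lemma pow2_invn_cvg (c : R) : c / 2 ^+ n @[n --> \oo] --> (0 : R).
Proof.
have := @cvg_geometric R c (2^-1); rewrite ger0_norm// invf_lt1// ltr1n => /(_ isT).
by rewrite /geometric/=; under eq_fun do rewrite exprVn.
Qed.

Lemma grid_proj_cvg t : box a b t -> grid_proj n t @[n --> \oo] --> t.
Proof.
move=> bt; apply/cvgrPdist_le => e e0.
pose c := \sum_i (b 0 i - a 0 i).
have c0 i : b 0 i - a 0 i <= c.
  rewrite /c (bigD1 i)//= lerDl sumr_ge0// => j _; by rewrite subr_ge0 ltW.
have /cvgrPdist_le/(_ e e0) := pow2_invn_cvg c.
apply: filterS => n; rewrite sub0r normrN => h.
rewrite /Num.norm/= mx_normrE; apply: bigmax_le => [|[i j] _]; first exact: ltW.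
rewrite ord1 !mxE -/(grid_proj n t); have := grid_proj_near n j bt.
rewrite [grid_proj n t 0 j]mxE => /andP[h1 h2].
rewrite ger0_norm// (le_trans h2)// (le_trans _ h)// (le_trans _ (ler_norm _))//.
by rewrite ler_wpM2r// invr_ge0 exprn_ge0.
Qed.

End Grid.

Section Chaining.
Context {d} {T : measurableType d} {R : realType} (P : probability T R).
Variable S : set (T -> R).
Hypothesis gS : gspace P S.
Context {N : nat} (a b : 'rV[R]_N).
Hypothesis hab : forall i, a 0 i < b 0 i.

Definition vincr (Y : 'rV[R]_N -> T -> R) t s :=
  cov P (fun w => Y t w - Y s w) (fun w => Y t w - Y s w).

(** The rate [M] is arbitrary: once the grid is fine enough, the oscillation off the grid is
    negligible against every prescribed Gaussian rate, so suprema reduce to finitely many points. *)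
Definition osc (Y : 'rV[R]_N -> T -> R) : Prop := forall e M : R, 0 < e -> 0 < M ->
  exists n0, forall n, (n0 <= n)%N -> exp_small P M
    (fun u => [set w | exists2 t, box a b t & e * u < `|Y t w - Y (grid_proj a b n t) w|]).

Lemma osc_const (V : T -> R) : osc (fun=> V).
Proof.
move=> e M e0 M0; exists 0%N => n _; exists 0 => u u0; exists set0; split => //.
  by rewrite measure0 lee_fin expR_ge0.
by move=> w [t _]; rewrite subrr normr0 ltNge mulr_ge0// ltW.
Qed.

Lemma osc_linear (c : R) Y Z : osc Y -> osc Z -> osc (fun t w => c * Y t w + Z t w).
Proof.
move=> oY oZ e M e0 M0.
pose e' := e / (2 * (`|c| + 1)).
have c1 : 0 < `|c| + 1 by rewrite ltr_wpDl.
have e'0 : 0 < e' by rewrite divr_gt0// mulr_gt0.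
have M1 : 0 < M + 1 by rewrite addr_gt0.
have [n1 h1] := oY e' (M + 1) e'0 M1.
have [n2 h2] := oZ e' (M + 1) e'0 M1.
exists (maxn n1 n2) => n; rewrite geq_max => /andP[/h1 s1 /h2 s2].
have MM : M < M + 1 by rewrite ltrDl.
apply: exp_small_sub (exp_smallU MM s1 s2).
near=> u => w [t bt] lt.
have u0 : 0 <= u by near: u; exact: nbhs_pinfty_ge.
have [l1|l1] := ltP (e' * u) `|Y t w - Y (grid_proj a b n t) w|; first by left; exists t.
have [l2|l2] := ltP (e' * u) `|Z t w - Z (grid_proj a b n t) w|; first by right; exists t.
exfalso; move: lt; apply/negP; rewrite -leNgt.
have -> : c * Y t w + Z t w - (c * Y (grid_proj a b n t) w + Z (grid_proj a b n t) w) =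
  c * (Y t w - Y (grid_proj a b n t) w) + (Z t w - Z (grid_proj a b n t) w) by ring.
apply: (le_trans (ler_normD _ _)); rewrite normrM.
have h3 : `|c| * `|Y t w - Y (grid_proj a b n t) w| <= `|c| * (e' * u) by rewrite ler_wpM2l.
apply: (le_trans (lerD h3 l2)).
have -> : `|c| * (e' * u) + e' * u = e / 2 * u by rewrite /e'; field; rewrite gt_eqF.
by nra.
Unshelve. all: by end_near. Qed.

Lemma gspace_norm_tail Z v y : S Z -> cov P Z Z <= v -> 0 < v -> 0 < y ->
  measurable [set w | y <= `|Z w|] /\
  (P [set w | y <= `|Z w|]%R <= (2 * expR (- (y ^+ 2 / (2 * v))))%:E)%E.
Proof.
move=> SZ cv v0 y0.
have SN : S (fun w => - Z w).
  have := gspaceZ gS (-1) SZ; rewrite (_ : (fun w => _) = (fun w => - Z w))//.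
  by apply/funext => w; rewrite mulN1r.
have cN : cov P (fun w => - Z w) (fun w => - Z w) <= v.
  by rewrite (_ : cov _ _ _ = cov P Z Z)//; apply: eq_Rintegral => w _; rewrite mulrNN.
have m (Y : T -> R) : S Y -> measurable [set w | y <= Y w].
  move=> SY; rewrite (_ : [set w | _] = Y @^-1` `[y, +oo[%classic).
    rewrite -[X in measurable X]setTI; exact: (gspace_measurable gS SY).
  by apply/seteqP; split => w /=; rewrite in_itv/= andbT.
rewrite (_ : [set w | y <= `|Z w|] = [set w | y <= Z w] `|` [set w | y <= - Z w]); last first.
  by apply/seteqP; split => w /=; rewrite ler_normr => /orP.
split; first by apply: measurableU; exact: m.
apply: (le_trans (measureU2 _ (m _ SZ) (m _ SN))).
rewrite mulr_natl mulr2n EFinD; apply: leeD.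
- exact: (cgauss_tail (gspace_cgauss gS SZ)).
- exact: (cgauss_tail (gspace_cgauss gS SN)).
Qed.

Lemma expR_quad_ge (x : R) : 0 <= x -> (x / 2) ^+ 2 <= expR x.
Proof.
move=> x0; have -> : x = x / 2 + x / 2 by field.
rewrite expRD -expr2.
have -> : (x / 2 + x / 2) / 2 = x / 2 by field.
rewrite ler_pXn2r ?nnegrE ?expR_ge0 ?divr_ge0//.
apply: le_trans (expR_ge1Dx _); lra.
Qed.

(** The left side is the exponent of the number of grid pairs at scale n plus the desired rate; the
    right side is the exponent of a single increment, which grows geometrically in n. *)
Lemma chaining_scale (l c M : R) (L : nat) : 0 < l -> 0 < c -> 0 < M ->
  exists n0, forall n, (n0 <= n)%N -> L%:R * n.+2%:R + M <= c * expR (n%:R * (2 * l)).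
Proof.
move=> l0 c0 M0.
pose B := (3 * L%:R + M) / (c * l ^+ 2).
have cl : 0 < c * l ^+ 2 by rewrite mulr_gt0// exprn_gt0.
exists (maxn 1 (Num.truncn B).+1) => n; rewrite geq_max => /andP[n1 nB].
have n1' : 1 <= n%:R :> R by rewrite ler1n.
have L0 : 0 <= L%:R :> R by [].
have hB : 3 * L%:R + M <= n%:R * (c * l ^+ 2).
  rewrite -ler_pdivrMr// -/B ltW//; apply: (lt_le_trans (Num.Theory.truncnS_gt B)).
  by rewrite ler_nat.
have h := @expR_quad_ge (n%:R * (2 * l)).
have {}h : (n%:R * l) ^+ 2 <= expR (n%:R * (2 * l)).
  have -> : n%:R * l = n%:R * (2 * l) / 2 by field.
  by apply: h; rewrite !mulr_ge0// ltW.
apply: (le_trans _ (ler_wpM2l (ltW c0) h)).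
have n2 : n.+2%:R = n%:R + 2 :> R by rewrite -addn2 natrD.
rewrite n2; move: (n%:R : R) (L%:R : R) n1' L0 hB => x y x1 y0 hB.
have -> : c * (x * l) ^+ 2 = x * (x * (c * l ^+ 2)) by ring.
have : x * (3 * y + M) <= x * (x * (c * l ^+ 2)) by rewrite ler_pM2l//; lra.
nra.
Qed.

Variables (Y : 'rV[R]_N -> T -> R) (l K : R).
Hypothesis SY : forall t, box a b t -> S (Y t).
Hypothesis cY : forall w, continuous (fun t => Y t w).
Hypothesis l0 : 0 < l.
Hypothesis K0 : 0 < K.
Hypothesis hY : forall n t s, box a b t -> box a b s ->
  (forall i, `|t 0 i - s 0 i| <= (b 0 i - a 0 i) / 2 ^+ n) ->
  vincr Y t s <= K * expR (- (4 * l * n%:R)).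

Let g n := grid_proj a b n.

(** With r = exp(-l) the thresholds (1 - r) r^n u sum to r^n0 u over the scales from n0 on. The
    standard deviation at scale n is of order r^(2n), so the ratio of threshold to deviation grows
    like r^-n. Pairs too far apart never occur in a chain and contribute nothing. *)
Definition bad_incr (u : R) n (pq : grid_index n * grid_index n.+1) : set T :=
  if [forall i, `|grid_point a b pq.1 0 i - grid_point a b pq.2 0 i| <= (b 0 i - a 0 i) / 2 ^+ n]
  then [set w | (1 - expR (- l)) * expR (- l) ^+ n * u <=
                `|Y (grid_point a b pq.1) w - Y (grid_point a b pq.2) w|]
  else set0.

Let rho0 : 0 < 1 - expR (- l).
Proof. by rewrite subr_gt0 expR_lt1 oppr_lt0. Qed.

Lemma bad_incr_le u n pq : 1 <= u -> measurable (@bad_incr u n pq) /\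
  (P (@bad_incr u n pq) <=
   (2 * expR (- ((1 - expR (- l)) ^+ 2 / (2 * K) * expR (n%:R * (2 * l)) * u ^+ 2)))%:E)%E.
Proof.
move=> u1; rewrite /bad_incr; case: ifP => [/forallP h|_]; last first.
  by split => //; rewrite measure0 lee_fin mulr_ge0// expR_ge0.
have b1 : box a b (grid_point a b pq.1) by exact: grid_point_box.
have b2 : box a b (grid_point a b pq.2) by exact: grid_point_box.
have v0 : 0 < K * expR (- (4 * l * n%:R)) by rewrite mulr_gt0// expR_gt0.
have y0 : 0 < (1 - expR (- l)) * expR (- l) ^+ n * u.
  by rewrite !mulr_gt0// ?exprn_gt0 ?expR_gt0// (lt_le_trans ltr01).
have [m le] := @gspace_norm_tail (fun w => Y (grid_point a b pq.1) w - Y (grid_point a b pq.2) w)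
  _ _ (gspaceB gS (SY b1) (SY b2)) (hY b1 b2 h) v0 y0.
split => //; apply: (le_trans le); rewrite lee_fin; apply: ler_wpM2l => //.
rewrite ler_expR lerN2 -expRM_natl.
have -> : expR (- (4 * l * n%:R)) = expR (n%:R * - l) ^+ 2 / expR (n%:R * (2 * l)).
  rewrite -expRM_natl -expRB; congr expR; ring.
have e1 : expR (n%:R * (2 * l)) != 0 by rewrite gt_eqF// expR_gt0.
have e2 : expR (n%:R * - l) != 0 by rewrite gt_eqF// expR_gt0.
move: (expR (n%:R * (2 * l))) (expR (n%:R * - l)) (expR (- l)) e1 e2 => x y z x0 yn0.
rewrite le_eqVlt; apply/orP; left; apply/eqP; field.
by rewrite x0 yn0 gt_eqF.
Qed.

Definition bad_scale u n : set T := [set w | exists pq, @bad_incr u n pq w].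

(** The number of pairs, (2^n + 1)^N (2^(n+1) + 1)^N, is at most 2^(2 N (n+2)); the additional
    factor 2 comes from the two-sided tail. *)
Lemma bad_scale_le u n : 1 <= u -> measurable (bad_scale u n) /\
  (P (bad_scale u n) <= (2 ^+ (2 * N * n.+2).+1 *
    expR (- ((1 - expR (- l)) ^+ 2 / (2 * K) * expR (n%:R * (2 * l)) * u ^+ 2)))%:E)%E.
Proof.
move=> u1.
have [m le] := @measure_exists_le _ _ _ P (grid_index n * grid_index n.+1)%type
   (fun pq => @bad_incr u n pq) _ (fun pq => (bad_incr_le pq u1).1) (fun pq => (bad_incr_le pq u1).2).
split => //; apply: (le_trans le); rewrite lee_fin mulrA.
rewrite ler_wpM2r ?expR_ge0// exprSr ler_wpM2r// -natrX ler_nat card_prod !card_ffun !card_ord.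
have -> : (2 * N * n.+2 = n.+2 * N + n.+2 * N)%N by rewrite -mulnDl addnn -mul2n mulnAC.
rewrite expnD !expnM; have H x y : (x <= y)%N -> (x ^ N <= y ^ N)%N.
  by move=> xy; have [->//|N0] := posnP N; rewrite leq_exp2r.
have e2 k : (2 ^ k.+1 = 2 ^ k + 2 ^ k)%N by rewrite expnS mul2n addnn.
have p2 k : (0 < 2 ^ k)%N by rewrite expn_gt0.
apply: leq_mul; apply: H.
  by rewrite !e2; have := p2 n; move: (2 ^ n)%N => x; lia.
by rewrite !e2; have := p2 n; move: (2 ^ n)%N => x; lia.
Qed.

Lemma chaining_sum M : 0 < M -> exists n1, forall n0, (n1 <= n0)%N -> forall u, 1 <= u ->
  exists F : set T, [/\ measurable F, (P F <= (expR (- (M * u ^+ 2)))%:E)%E &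
    forall n, (n0 <= n)%N -> bad_scale u n `<=` F].
Proof.
move=> M0; set c := (1 - expR (- l)) ^+ 2 / (2 * K).
have c0 : 0 < c by rewrite divr_gt0 ?mulr_gt0 ?exprn_gt0.
have [n1 hn1] := chaining_scale (2 * N + 2) l0 c0 M0.
exists n1 => n0 n10 u u1.
pose B n := if (n0 <= n)%N then bad_scale u n else set0.
have mB n : measurable (B n) by rewrite /B; case: ifP => // _; exact: (bad_scale_le n u1).1.
exists (\bigcup_n B n); split.
- exact: bigcup_measurable.
- have le n : (P (B n) <= (expR (- (M * u ^+ 2)) / (2 ^ n.+1)%:R)%:E)%E.
    rewrite /B; case: ifP => [n0n|_]; last first.
      by rewrite measure0 lee_fin divr_ge0// expR_ge0.
    apply: (le_trans (bad_scale_le n u1).2); rewrite lee_fin.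
    rewrite ler_pdivlMr ?ltr0n ?expn_gt0// natrX mulrAC -exprD.
    (* Powers of 2 become powers of e. The number of pairs and the factor 2^(n+1), included to make
       the sum over scales converge, cost (2N + 1)(n + 2) in the exponent. *)
    have e2 : 2 <= expR 1 :> R by apply: le_trans (expR_ge1Dx _); lra.
    apply: (@le_trans _ _ (expR (((2 * N * n.+2).+1 + n.+1)%:R * 1) *
        expR (- (c * expR (n%:R * (2 * l)) * u ^+ 2)))).
      rewrite ler_wpM2r ?expR_ge0// expRM_natl.
      by apply: lerXn2r => //; rewrite nnegrE ?expR_ge0.
    rewrite -expRD ler_expR mulr1.
    have := hn1 n (leq_trans n10 n0n).
    have -> : ((2 * N * n.+2).+1 + n.+1 = (2 * N + 1) * n.+2)%N by rewrite mulnDl mul1n; move: (2 * N * n.+2)%N => x; lia.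
    have : ((2 * N + 1) * n.+2)%:R <= (2 * N + 2)%:R * n.+2%:R :> R.
      by rewrite -natrM ler_nat leq_mul2r leq_add2l orbT.
    have u2 : 1 <= u ^+ 2 by rewrite exprn_ege1.
    have y0 : 0 <= (2 * N + 2)%:R * n.+2%:R :> R by rewrite mulr_ge0.
    move: u2 y0; set x := ((2 * N + 1) * n.+2)%:R; set y := _ * _; set z := c * _.
    move: (u ^+ 2) => v; move: x y z => x y z v1 y0 xy yz; nra.
  have h := @measure_sigma_subadditive _ R T P (\bigcup_n B n) B mB (bigcup_measurable (fun n _ => mB n)) (@subset_refl _ _).
  apply: (le_trans h).
  apply: (le_trans (lee_nneseries _ (fun n _ => le n))) => //.
  exact: (@epsilon_trick0 R (expR (- (M * u ^+ 2))) xpredT (expR_ge0 _)).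
- by move=> n n0n w Bw; exists n => //; rewrite /B n0n.
Qed.

(** Off the union of all bad scales the increments along successive grid projections telescope to at
    most r^n0 u; continuity of the path passes to the point itself. *)
Lemma chaining_osc : osc Y.
Proof.
move=> e M e0 M0.
have [n1 hn1] := chaining_sum M0.
have el : 0 < e * l by rewrite mulr_gt0.
(* n0 >= 1/(e l) yields exp(l n0) >= 1 + l n0 >= 1/e, that is r^n0 <= e. *)
exists (maxn n1 (Num.truncn (e * l)^-1).+1) => n0; rewrite geq_max => /andP[n10 n20].
exists 1 => u u1; have [F [mF PF BF]] := hn1 n0 n10 u u1.
have u0 : 0 < u by exact: lt_le_trans u1.
exists F; split => // w [t bt lt]; apply: contrapT => Fw.
move: lt; apply/negP; rewrite -leNgt.
set r := expR (- l).
have r0 : 0 < r by exact: expR_gt0.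
have step n : (n0 <= n)%N -> `|Y (g n t) w - Y (g n.+1 t) w| <= (1 - r) * r ^+ n * u.
  move=> n0n; rewrite leNgt; apply/negP => lt; apply: Fw; apply: (BF n n0n).
  exists (grid_cell a b n t, grid_cell a b n.+1 t); rewrite /bad_incr ifT.
    exact: ltW.
  by apply/forallP => i /=; rewrite distrC; exact: grid_proj_step.
have sum m : `|Y (g (n0 + m)%N t) w - Y (g n0 t) w| <= (r ^+ n0 - r ^+ (n0 + m)) * u.
  elim: m => [|m IH]; first by rewrite addn0 !subrr normr0 mul0r.
  rewrite addnS; have := step _ (leq_addr m n0); rewrite distrC => s.
  have -> : Y (g (n0 + m).+1 t) w - Y (g n0 t) w = (Y (g (n0 + m).+1 t) w - Y (g (n0 + m)%N t) w)
     + (Y (g (n0 + m)%N t) w - Y (g n0 t) w) by ring.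
  apply: (le_trans (ler_normD _ _)); apply: (le_trans (lerD s IH)).
  by rewrite exprS le_eqVlt; apply/orP; left; apply/eqP; ring.
have cv : `|Y (g (n0 + m)%N t) w - Y (g n0 t) w| @[m --> \oo] --> `|Y t w - Y (g n0 t) w|.
  apply: cvg_norm; apply: cvgB; last exact: cvg_cst.
  have h : Y (g n t) w @[n --> \oo] --> Y t w.
    exact: (@cvg_comp nat 'rV[R]_N R (fun n => g n t) (fun t => Y t w) _ _ _ (grid_proj_cvg hab bt) (@cY w t)).
  exact: (@cvg_comp nat nat R (addn n0) (fun n => Y (g n t) w) _ _ _ (@cvg_addnl n0) h).
have : `|Y t w - Y (g n0 t) w| <= r ^+ n0 * u.
  rewrite -(cvg_lim (@Rhausdorff R) cv); apply: limr_le; first by apply/cvg_ex; eexists; exact: cv.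
  apply: nearW => m; apply: (le_trans (sum m)); apply: ler_wpM2r; first exact: ltW.
  by rewrite lerBlDr lerDl exprn_ge0// ltW.
move=> /le_trans; apply; rewrite ler_wpM2r ?(ltW u0)//.
have n0l : (e * l)^-1 <= n0%:R.
  rewrite ltW//; apply: (lt_le_trans (Num.Theory.truncnS_gt _)); by rewrite ler_nat.
rewrite /r -expRM_natl mulrN expRN -[e]invrK lef_pV2 ?posrE ?expR_gt0 ?invr_gt0//.
apply: le_trans (expR_ge1Dx _).
have : e^-1 <= n0%:R * l.
  by rewrite -ler_pdivrMr// -invfM.
lra.
Qed.
End Chaining.

(** * Large deviations of suprema of fields with small oscillation *)

Section OscillationBounds.
Context {d} {T : measurableType d} {R : realType} (P : probability T R).
Variable S : set (T -> R).
Hypothesis gS : gspace P S.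
Context {N : nat} (a b : 'rV[R]_N).
Hypothesis hab : forall i, a 0 i < b 0 i.
Implicit Types Y : 'rV[R]_N -> T -> R.

Lemma exp_small_scale M A (k : R) : 0 < k -> exp_small P M A ->
  exp_small P (M * k ^+ 2) (fun u => A (k * u)).
Proof.
move=> k0 [u0 h]; exists (u0 / k) => u; rewrite ler_pdivrMr// mulrC => /h[F [mF PF AF]].
by exists F; split => //; rewrite -mulrA -exprMn.
Qed.

Lemma gauss_exp_small Z (v c : R) : S Z -> cov P Z Z <= v -> 0 < v -> 0 < c ->
  exp_small P (c ^+ 2 / (2 * v)) (fun u => [set w | c * u <= Z w]).
Proof.
move=> SZ cv v0 c0; exists 1 => u u1; exists [set w | c * u <= Z w]; split => //.
  rewrite (_ : [set w | _] = Z @^-1` `[c * u, +oo[%classic).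
    by rewrite -[X in measurable X]setTI; exact: (gspace_measurable gS SZ).
  by apply/seteqP; split => w /=; rewrite in_itv/= andbT.
have u0 : 0 < u by exact: lt_le_trans u1.
apply: (le_trans (cgauss_tail (gspace_cgauss gS SZ) cv v0 (mulr_gt0 c0 u0))).
by rewrite lee_fin exprMn mulrAC.
Qed.

(** Off an event of higher rate, the supremum over [D] exceeds u only if the value at one of
    finitely many points of [D] exceeds (1 - 2e) u; the margin between [v] and [v'] pays for the
    factor. *)
Lemma osc_ldp Y (D : set 'rV[R]_N) (v v' : R) :
  (forall t, box a b t -> S (Y t)) -> osc P a b Y -> D `<=` box a b ->
  (forall t, D t -> cov P (Y t) (Y t) <= v) -> v < v' -> 0 < v' ->
  exp_small P (2 * v')^-1 (fun u => [set w | exists2 t, D t & u <= Y t w]).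
Proof.
move=> SY oY Db Dv vv v'0.
(* Keeps the variance bound positive, hence divisible, and still below v'. *)
pose v1 := Num.max v (v' / 2).
have v10 : 0 < v1 by rewrite lt_max divr_gt0// orbT.
have v1v : v1 < v' by rewrite gt_max vv/= ltr_pdivrMr// ltr_pMr// ltr1n.
have Dv1 t : D t -> cov P (Y t) (Y t) <= v1.
  by move=> /Dv h; rewrite le_max h.
pose r := v1 / v'; have r0 : 0 < r by rewrite divr_gt0.
have r1 : r < 1 by rewrite ltr_pdivrMr// mul1r.
pose e := (1 - r) / 4; have e0 : 0 < e by rewrite divr_gt0// subr_gt0.
(* c = (1 + r)/2, and ((1 + r)/2)^2 > r is what makes c^2/(2 v1) exceed 1/(2 v'). *)
pose c := 1 - 2 * e; have cE : c = (1 + r) / 2 by rewrite /c /e; field.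
have c0 : 0 < c by rewrite cE; lra.
pose M1 := c ^+ 2 / (2 * v1).
have MM : (2 * v')^-1 < M1.
  rewrite /M1 ltr_pdivlMr ?mulr_gt0//.
  have -> : (2 * v')^-1 * (2 * v1) = r by rewrite /r; field; rewrite gt_eqF.
  rewrite cE; nra.
have M10 : 0 < M1 by rewrite divr_gt0 ?mulr_gt0// exprn_gt0.
have [n0 /(_ n0 (leqnn _)) on] := oY e M1 e0 M10.
(* Grid points may lie outside [D], where the variance bound is unknown. Each cell meeting [D] gets
   a representative in [D]; comparing with it through the grid point costs the oscillation twice. *)
pose D' (p : @grid_index N n0) := [set t | D t /\ grid_cell a b n0 t = p].
pose rep p := xget 0 (D' p).
have Drep t : D t -> D' (grid_cell a b n0 t) (rep (grid_cell a b n0 t)).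
  by move=> Dt; apply: (@xgetI _ _ _ t).
pose A p u : set T := if `[< D' p !=set0 >] then [set w | c * u <= Y (rep p) w] else set0.
have sA p : exp_small P M1 (A p).
  rewrite /A; case: asboolP => [[t D't]|_]; last exact: exp_small0.
  have [Dr _] : D' p (rep p) by exact: (xgetI 0 D't).
  by apply: gauss_exp_small => //; [apply: SY; exact: Db|exact: Dv1].
pose M2 := ((2 * v')^-1 + M1) / 2.
have M21 : M2 < M1 by rewrite /M2; lra.
have M22 : (2 * v')^-1 < M2 by rewrite /M2; lra.
apply: exp_small_sub (exp_smallU M22 (exp_small_exists M21 sA) (exp_small_le (ltW M21) on)).
near=> u => w [t Dt ut].
have [Dr cr] := Drep t Dt; set p := grid_cell a b n0 t in Dr cr *.
have [l1|l1] := ltP (e * u) `|Y t w - Y (grid_proj a b n0 t) w|.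
  by right; exists t => //; exact: Db.
have [l2|l2] := ltP (e * u) `|Y (rep p) w - Y (grid_proj a b n0 (rep p)) w|.
  by right; exists (rep p) => //; exact: Db.
left; exists p; rewrite /A asboolT; last by exists t.
move: l1 l2; rewrite /grid_proj -/p cr !ler_norml => /andP[_ h1] /andP[h2 _] /=.
rewrite /c; lra.
Unshelve. all: by end_near. Qed.

Lemma osc_bounded Y (M : R) : (forall t, box a b t -> S (Y t)) -> osc P a b Y -> 0 < M ->
  exists2 L, 0 < L & exp_small P M (fun u => [set w | exists2 t, box a b t & L * u <= `|Y t w|]).
Proof.
move=> SY oY M0; have M20 : 0 < M + 2 by rewrite addr_gt0.
have [n /(_ n (leqnn _)) on] := oY 1 (M + 2) ltr01 M20.
pose G (p : @grid_index N n) := grid_point a b p.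
have bG p : box a b (G p) by exact: grid_point_box.
pose v := 1 + \sum_p cov P (Y (G p)) (Y (G p)).
have cge0 p : 0 <= cov P (Y (G p)) (Y (G p)) by apply: (cov_ge0 gS); exact: SY.
have v1 : 1 <= v by rewrite lerDl sumr_ge0.
have v0 : 0 < v by exact: lt_le_trans v1.
have cv p : cov P (Y (G p)) (Y (G p)) <= v.
  rewrite /v (bigD1 p)//= addrCA lerDl addr_ge0// sumr_ge0//.
(* As c >= 1, c^2 >= c >= 2 v (M + 2): every grid value beyond c u has rate at least M + 2. *)
pose c := 2 * v * (M + 2) + 1.
have c1 : 1 <= c by rewrite /c lerDr !mulr_ge0// ltW.
have c0 : 0 < c by exact: lt_le_trans c1.
have cM : M + 2 <= c ^+ 2 / (2 * v).
  rewrite ler_pdivlMr ?mulr_gt0// expr2.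
  apply: (@le_trans _ _ c); last by rewrite ler_peMl// ltW.
  by rewrite /c [_ * (2 * v)]mulrC lerDl.
exists (1 + c); first by rewrite addr_gt0.
pose A p u := [set w | c * u <= Y (G p) w] `|` [set w | c * u <= - Y (G p) w].
have sA p : exp_small P (M + 1) (A p).
  apply: (@exp_smallU _ _ _ _ (M + 2)); first by rewrite ltrD2l ltr1n.
    by apply: exp_small_le cM _; apply: gauss_exp_small => //; exact: SY.
  apply: exp_small_le cM _; apply: gauss_exp_small => //.
    have := gspaceZ gS (-1) (SY _ (bG p)); rewrite (_ : (fun w => _) = (fun w => - Y (G p) w))//.
    by apply/funext => w; rewrite mulN1r.
  by rewrite (_ : cov _ _ _ = cov P (Y (G p)) (Y (G p)))//; apply: eq_Rintegral => w _; rewrite mulrNN.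
have M1 : M < M + 2^-1 by rewrite ltrDl invr_gt0.
have M2 : M + 2^-1 < M + 1 by rewrite ltrD2l invf_lt1// ltr1n.
have M3 : M + 2^-1 <= M + 2 by rewrite lerD2l; lra.
apply: exp_small_sub (exp_smallU M1 (exp_small_exists M2 sA) (exp_small_le M3 on)).
near=> u => w [t bt ut].
have [l1|l1] := ltP (1 * u) `|Y t w - Y (grid_proj a b n t) w|; first by right; exists t.
left; exists (grid_cell a b n t); apply/orP; rewrite -ler_normr -/(grid_proj a b n t).
move: l1 ut; rewrite mul1r mulrDl mul1r => l1 ut.
have := ler_normD (Y t w - Y (grid_proj a b n t) w) (Y (grid_proj a b n t) w); rewrite subrK => h.
lra.
Unshelve. all: by end_near. Qed.

(** Off an event of rate [M] the gradient is bounded by a multiple of u over the whole box, so [Y]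
    varies by less than e u within a fine cell. This passes the oscillation property from second
    derivatives to first ones and then to the field. *)
Lemma osc_grad Y (Yg : 'I_N -> 'rV[R]_N -> T -> R) :
  (forall i t, box a b t -> S (Yg i t)) -> (forall i, osc P a b (Yg i)) ->
  (forall w t s C, box a b t -> box a b s ->
     (forall i r, box a b r -> `|Yg i r w| <= C) ->
     `|Y t w - Y s w| <= C * \sum_i `|t 0 i - s 0 i|) ->
  osc P a b Y.
Proof.
move=> SYg oYg lip e M e0 M0.
have M10 : 0 < M + 1 by rewrite addr_gt0.
have /choice[L hL] i : exists L, 0 < L /\
    exp_small P (M + 1) (fun u => [set w | exists2 t, box a b t & L * u <= `|Yg i t w|]).
  by have [L L0 h] := osc_bounded (SYg i) (oYg i) M10; exists L.
pose C := \sum_i L i.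
have CL i : L i <= C.
  by rewrite /C (bigD1 i)//= lerDl sumr_ge0// => j _; rewrite ltW//; have [] := hL j.
have C0 : 0 <= C by rewrite /C sumr_ge0// => j _; rewrite ltW//; have [] := hL j.
pose c := C * \sum_i (b 0 i - a 0 i).
have /cvgrPdist_le/(_ e e0)[n0 _ hn0] := pow2_invn_cvg c.
exists n0 => n n0n.
have MM : M < M + 1 by rewrite ltrDl.
apply: exp_small_sub (exp_small_exists MM (fun i => (hL i).2)).
near=> u => w [t bt]; rewrite ltNge => /negP lt; apply: contrapT => nex; apply: lt.
have u0 : 0 <= u by near: u; exact: nbhs_pinfty_ge.
have bg : box a b (grid_proj a b n t) by exact: grid_point_box.
have le i r : box a b r -> `|Yg i r w| <= C * u.
  move=> br; rewrite leNgt; apply/negP => lt; apply: nex; exists i; exists r => //.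
  by apply: (le_trans _ (ltW lt)); rewrite ler_wpM2r.
apply: (le_trans (lip w t _ (C * u) bt bg le)).
rewrite mulrAC ler_wpM2r//; apply: le_trans (le_trans (ler_norm _) _); last first.
  by have := hn0 n n0n; rewrite sub0r normrN; exact.
rewrite /c -mulrA ler_wpM2l// mulr_suml; apply: ler_sum => i _.
by have /andP[h1 h2] := grid_proj_near hab n i bt; rewrite ger0_norm.
Unshelve. all: by end_near. Qed.

Lemma cov_continuous_on Y t0 e :
  (forall t, box a b t -> S (Y t)) -> (forall w, continuous (fun t => Y t w)) -> box a b t0 ->
  0 < e -> exists2 r, 0 < r & forall t, box a b t -> `|t - t0| <= r ->
    `|cov P (Y t) (Y t) - cov P (Y t0) (Y t0)| <= e.
Proof.
move=> SY cY bt0 e0; apply: contrapT => nex.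
have h n : exists t, box a b t /\ `|t - t0| <= n.+1%:R^-1 /\ e < `|cov P (Y t) (Y t) - cov P (Y t0) (Y t0)|.
  apply: contrapT => ht; apply: nex; exists n.+1%:R^-1; first by rewrite invr_gt0 ltr0n.
  move=> t bt tt; rewrite leNgt; apply/negP => lt; apply: ht; by exists t.
have [t_ ht] := choice h.
have tc : t_ n @[n --> \oo] --> t0.
  apply/cvgrPdist_le => d0 d00; near=> n.
  rewrite distrC; apply: (le_trans (ht n).2.1); near: n.
  have /cvgrPdist_le/(_ d0 d00) := @cvg_harmonic R.
  by apply: filterS => n; rewrite sub0r normrN; apply: le_trans; exact: ler_norm.
have Yc w : Y (t_ n) w @[n --> \oo] --> Y t0 w.
  exact: (@cvg_comp nat 'rV[R]_N R t_ (fun t => Y t w) _ _ _ tc (@cY w t0)).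
have := cov_cvg gS (fun n => SY _ (ht n).1) (fun n => SY _ (ht n).1) (SY _ bt0) (SY _ bt0) Yc Yc.
move=> /cvgrPdist_le/(_ e e0)[n _ /(_ n (leqnn _))].
by rewrite distrC leNgt (ht n).2.2.
Unshelve. all: by end_near. Qed.

(** A strict variance inequality at [t0] persists on a small ball by continuity; [osc_ldp] with u
    replaced by k u gives a rate strictly above 1/(2v). *)
Lemma osc_near Y t0 (k v : R) :
  (forall t, box a b t -> S (Y t)) -> (forall w, continuous (fun t => Y t w)) ->
  osc P a b Y -> box a b t0 -> 0 < k -> 0 < v -> cov P (Y t0) (Y t0) < k ^+ 2 * v ->
  exists2 r, 0 < r & exists2 al, 0 < al & exp_small P ((2 * v)^-1 + al)
    (fun u => [set w | exists2 t, box a b t /\ `|t - t0| <= r & k * u <= Y t w]).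
Proof.
move=> SY cY oY bt0 k0 v0 lt; set c := cov _ _ _ in lt.
have c0 : 0 <= c by apply: (cov_ge0 gS); exact: SY.
have k20 : 0 < k ^+ 2 by rewrite exprn_gt0.
(* c + e bounds the variance on the ball and c + 2e, the midpoint of c and k^2 v, leaves room on
   both sides. *)
pose e := (k ^+ 2 * v - c) / 4; have e0 : 0 < e by rewrite divr_gt0// subr_gt0.
have [r r0 hr] := cov_continuous_on SY cY bt0 e0.
exists r => //.
pose v' := (c + 2 * e) / k ^+ 2.
have v'0 : 0 < v' by rewrite divr_gt0// ltr_wpDl// mulr_gt0.
have v'v : v' < v by rewrite ltr_pdivrMr// mulrC /e; lra.
exists ((2 * v')^-1 - (2 * v)^-1).
  have h2 : 2 * v' < 2 * v by lra.
  by rewrite subr_gt0 ltf_pV2 ?posrE//; rewrite mulr_gt0.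
rewrite addrC subrK.
have h := @osc_ldp Y [set t | box a b t /\ `|t - t0| <= r] (c + e) (c + 2 * e) SY oY.
have {}h : exp_small P (2 * (c + 2 * e))^-1
    (fun u => [set w | exists2 t, box a b t /\ `|t - t0| <= r & u <= Y t w]).
  apply: h.
  - by move=> t [].
  - by move=> t [bt tt]; have := hr t bt tt; rewrite -/c ler_norml => /andP[_]; lra.
  - lra.
  - by rewrite ltr_wpDl// mulr_gt0.
have -> : (2 * v')^-1 = (2 * (c + 2 * e))^-1 * k ^+ 2.
  have e2 : 0 < c + 2 * e by rewrite ltr_wpDl// mulr_gt0.
  by rewrite /v'; field; rewrite !gt_eqF.
exact: (exp_small_scale k0 h).
Qed.

End OscillationBounds.

(** * Taylor expansion along segments *)

Section Paths.
Context {R : realType} {N : nat}.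
Implicit Types (f : 'rV[R]_N -> R) (x v : 'rV[R]_N).

Definition C1 f : Prop :=
  forall i, (forall t, derivable f t (Defs.basis i)) /\ continuous (partial f i).

Lemma norm_coord v i : `|v 0 i| <= `|v|.
Proof.
rewrite [leRHS]/Num.norm/= mx_normrE.
exact: (le_bigmax _ (fun ij : 'I_1 * 'I_N => `|v ij.1 ij.2|) (0, i)).
Qed.

Lemma norm_le_coord v (e : R) : 0 <= e -> (forall i, `|v 0 i| <= e) -> `|v| <= e.
Proof.
move=> e0 h; rewrite /Num.norm/= mx_normrE; apply: bigmax_le => // -[i j] _.
by rewrite ord1; exact: h.
Qed.

Lemma is_derive_line f x v (h : R) : derivable f (x + h *: v) v ->
  is_derive h 1 (fun h => f (x + h *: v)) ('D_v f (x + h *: v)).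
Proof.
move=> df.
have E : (fun k : R => k^-1 *: (((fun h => f (x + h *: v)) \o shift h) (k *: 1) - f (x + h *: v))) =
   (fun k : R => k^-1 *: ((f \o shift (x + h *: v)) (k *: v) - f (x + h *: v))).
  apply/funext => k /=; congr (_ *: (f _ - _)).
  by rewrite [k *: 1]mulr1 scalerDl addrCA.
split; first by rewrite /derivable E.
by rewrite /derive E.
Qed.

Lemma MVT_between (g dg : R -> R) (c : R) : (forall h : R, is_derive h 1 g (dg h)) ->
  exists2 xi, `|xi| <= `|c| & g c - g 0 = dg xi * c.
Proof.
move=> dgP.
have cg D : {within D, continuous g}.
  apply: continuous_subspaceT => y; apply/differentiable_continuous.
  by rewrite -derivable1_diffP; case: (dgP y).
have [c0|c0] := leP 0 c.
  have [xi] := MVT_segment c0 (fun y _ => dgP y) (cg _).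
  rewrite in_itv/= => /andP[h1 h2] e; exists xi; last by rewrite e subr0.
  by rewrite !ger0_norm.
have [xi] := MVT_segment (ltW c0) (fun y _ => dgP y) (cg _).
rewrite in_itv/= => /andP[h1 h2] e; exists xi.
  by rewrite !ler0_norm ?(ltW c0)// lerN2.
by rewrite -[LHS]opprB e; ring.
Qed.

Lemma partial_MVT f x i (c : R) : (forall t, derivable f t (Defs.basis i)) ->
  exists2 xi, `|xi| <= `|c| & f (x + c *: Defs.basis i) - f x = partial f i (x + xi *: Defs.basis i) * c.
Proof.
move=> df.
have [xi h1 h2] := MVT_between c (fun h => is_derive_line (df (x + h *: Defs.basis i))).
by exists xi => //; rewrite -h2 scale0r addr0.
Qed.

Definition row_trunc v (k : nat) : 'rV[R]_N := \row_i (if (i < k)%N then v 0 i else 0).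

Lemma row_truncS v (k : 'I_N) : row_trunc v k.+1 = row_trunc v k + v 0 k *: Defs.basis k.
Proof.
apply/rowP => i; rewrite !mxE eqxx/= ltnS leq_eqVlt (inj_eq val_inj) [i == k]eq_sym.
case: eqVneq => [<-|ne]/=; first by rewrite ltnn add0r mulr1.
by rewrite mulr0 addr0.
Qed.

(** The increment is split by changing one coordinate at a time, and the mean value theorem is
    applied on each of the N segments; the intermediate points stay in the sup-norm ball of radius
    [r]. *)
Lemma partial_increment f x v (e r : R) : (forall i t, derivable f t (Defs.basis i)) ->
  0 <= e -> `|v| <= r ->
  (forall i y, `|y - x| <= r -> `|partial f i y - partial f i x| <= e) ->
  `|f (x + v) - f x - \sum_i v 0 i * partial f i x| <= e * \sum_i `|v 0 i|.
Proof.
move=> df e0 vr hr.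
have -> : f (x + v) - f x = \sum_(i < N) (f (x + row_trunc v i.+1) - f (x + row_trunc v i)).
  rewrite -(big_mkord xpredT (fun i => f (x + row_trunc v i.+1) - f (x + row_trunc v i))).
  rewrite telescope_sumr//; congr (f (_ + _) - f _).
    by apply/rowP => i; rewrite mxE ltn_ord.
  rewrite -[LHS]addr0; congr (_ + _).
  by apply/rowP => i; rewrite !mxE.
rewrite -sumrB mulr_sumr; apply: (le_trans (ler_norm_sum _ _ _)); apply: ler_sum => i _.
rewrite row_truncS addrA.
have [xi xiv ->] := partial_MVT (x + row_trunc v i) (v 0 i) (df i).
rewrite mulrC -mulrBr normrM mulrC; apply: ler_wpM2r => //; apply: hr.
rewrite -(addrA x); set A := _ + xi *: _.
have -> : x + A - x = A by rewrite addrC addKr.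
apply: norm_le_coord; first exact: le_trans vr.
move=> j; rewrite !mxE eqxx/=; case: (eqVneq j i) => [->|ne].
  by rewrite ltnn add0r mulr1 (le_trans xiv)// (le_trans (norm_coord _ _)).
rewrite mulr0 addr0; case: ifP => _; last by rewrite normr0 (le_trans _ vr).
exact: le_trans (norm_coord _ _) vr.
Qed.

Lemma C1_dir_derive f x v : C1 f -> derivable f x v /\ 'D_v f x = \sum_i v 0 i * partial f i x.
Proof.
move=> Cf.
suff cv : h^-1 *: ((f \o shift x) (h *: v) - f x) @[h --> 0^'] --> \sum_i v 0 i * partial f i x.
  split; first by apply/cvg_ex; eexists; exact: cv.
  exact/cvg_lim.
apply/cvgrPdist_le => e e0.
pose s := 1 + \sum_i `|v 0 i|.
have s0 : 0 < s by rewrite ltr_pwDl// sumr_ge0.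
have es : 0 < e / s by rewrite divr_gt0.
have [r r0 hr] : exists2 r, 0 < r & forall i y, `|y - x| <= r -> `|partial f i y - partial f i x| <= e / s.
  have H : \forall y \near x, forall i, `|partial f i x - partial f i y| <= e / s.
    have H i : \forall y \near x, `|partial f i x - partial f i y| <= e / s.
      by have /cvgrPdist_le/(_ _ es) := (Cf i).2 x.
    exact: (@filter_forall _ 'I_N (fun i y => `|partial f i x - partial f i y| <= e / s) (nbhs x) _ H).
  move: H => /nbhs_ballP[r /= r0 hr]; exists (r / 2); first by rewrite divr_gt0.
  move=> i y yx; rewrite distrC; apply: hr; rewrite -ball_normE /= distrC (le_lt_trans yx)//.
  by rewrite ltr_pdivrMr// ltr_pMr// ltr1n.
pose r' := r / (1 + `|v|).
have v1 : 0 < 1 + `|v| by rewrite ltr_pwDl.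
have r'0 : 0 < r' by rewrite divr_gt0.
have N0 : \forall h \near (0 : R)^', `|h| < r' by exact: dnbhs0_lt.
near=> h; have h0 : h != 0 by near: h; exact: nbhs_dnbhs_neq.
have hr' : `|h| < r' by near: h.
have hv : `|h *: v| <= r.
  rewrite normrZ; have h2 : `|h| * (1 + `|v|) <= r by rewrite -ler_pdivlMr// ltW.
  apply: le_trans h2; rewrite ler_wpM2l// lerDr//.
have := partial_increment (fun i t => (Cf i).1 t) (ltW es) hv hr.
have -> : \sum_i (h *: v) 0 i * partial f i x = h * \sum_i v 0 i * partial f i x.
  by rewrite mulr_sumr; apply: eq_bigr => i _; rewrite mxE mulrA.
have -> : \sum_i `|(h *: v) 0 i| = `|h| * \sum_i `|v 0 i|.
  by rewrite mulr_sumr; apply: eq_bigr => i _; rewrite mxE normrM.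
move: (\sum_i v 0 i * partial f i x) => D le.
rewrite distrC /=.
have -> : h^-1 *: (f (h *: v + x) - f x) - D = h^-1 * (f (x + h *: v) - f x - h * D).
  by rewrite [h *: v + x]addrC [_ *: _]/( _ * _) mulrBr mulKf.
rewrite normrM normfV ler_pdivrMl ?normr_gt0//; apply: (le_trans le).
rewrite mulrCA ler_wpM2l// mulrAC ler_pdivrMr// ler_wpM2l ?(ltW e0)// /s lerDr//.
Unshelve. all: by end_near. Qed.

Lemma C1_is_derive_line f x v (h : R) : C1 f ->
  is_derive h 1 (fun h => f (x + h *: v)) (\sum_i v 0 i * partial f i (x + h *: v)).
Proof.
by move=> Cf; have [d <-] := C1_dir_derive (x + h *: v) v Cf; exact: is_derive_line.
Qed.

Lemma box_convex (a b t s : 'rV[R]_N) (h : R) : box a b t -> box a b s -> 0 <= h <= 1 ->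
  box a b (s + h *: (t - s)).
Proof.
move=> bt bs /andP[h0 h1] i; rewrite !mxE; have /andP[t1 t2] := bt i; have /andP[s1 s2] := bs i.
by apply/andP; split; nra.
Qed.

Lemma C1_lipschitz f (a b t s : 'rV[R]_N) C : C1 f -> box a b t -> box a b s ->
  (forall i r, box a b r -> `|partial f i r| <= C) ->
  `|f t - f s| <= C * \sum_i `|t 0 i - s 0 i|.
Proof.
move=> Cf bt bs hC.
have D h := C1_is_derive_line s (t - s) h Cf.
have cg : {within `[0, 1], continuous (fun h : R => f (s + h *: (t - s)))}.
  apply: continuous_subspaceT => y; apply/differentiable_continuous.
  by rewrite -derivable1_diffP; case: (D y).
have [xi] := MVT_segment ler01 (fun y _ => D y) cg.
rewrite in_itv/= => xi01; rewrite scale1r scale0r addr0 [s + (t - s)]addrC subrK subr0 mulr1 => ->.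
apply: (le_trans (ler_norm_sum _ _ _)); rewrite mulr_sumr; apply: ler_sum => i _.
rewrite normrM !mxE mulrC ler_wpM2r//; apply: hC; exact: box_convex.
Qed.

Lemma C2_C1 f : C2 f -> C1 f.
Proof. by case=> _ h _. Qed.

Lemma C2_partial_C1 f j : C2 f -> C1 (partial f j).
Proof. by case=> _ _ h i; have [] := h i j. Qed.

Lemma taylor2 (g dg ddg : R -> R) : (forall h : R, is_derive h 1 g (dg h)) ->
  (forall h : R, is_derive h 1 dg (ddg h)) ->
  exists2 xi, 0 <= xi <= 1 & g 1 = g 0 + dg 0 + ddg xi / 2.
Proof.
move=> D1 D2.
pose K := g 1 - g 0 - dg 0.
(* p vanishes at 1, and at 0 by the choice of [K]; its derivative (1 - h)(2K - g'') vanishes inside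
   by Rolle, which is the Lagrange remainder. *)
pose p h := g 1 - g h - dg h * (1 - h) - K * (1 - h) ^+ 2.
have Dp (h : R) : is_derive h 1 p ((1 - h) * (2 * K - ddg h)).
  have := D1 h; have := D2 h => ? ?; rewrite /p; apply: is_derive_eq.
  by rewrite /GRing.scale/=; ring.
have cp : {within `[0, 1], continuous p}.
  apply: continuous_subspaceT => y; apply/differentiable_continuous.
  by rewrite -derivable1_diffP; case: (Dp y).
have p01 : p 0 = p 1 by rewrite /p /K; ring.
have [xi] := Rolle ltr01 (fun y _ => let: DeriveDef d _ := Dp y in d) cp p01.
rewrite in_itv/= => /andP[x0 x1] [_ e]; exists xi; first by rewrite !ltW.
have [_] := Dp xi; rewrite e => /esym/eqP; rewrite mulf_eq0 subr_eq0 (gt_eqF x1)/= subr_eq0 => /eqP e2.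
by rewrite -e2 /K; field.
Qed.

Lemma C2_taylor f x v : C2 f -> exists2 xi, 0 <= xi <= 1 &
  f (x + v) = f x + \sum_i v 0 i * partial f i x +
    (\sum_i \sum_j v 0 i * v 0 j * partial2 f i j (x + xi *: v)) / 2.
Proof.
move=> Cf.
have D1 h := C1_is_derive_line x v h (C2_C1 Cf).
have D2 (h : R) : is_derive h 1 (fun h => \sum_j v 0 j * partial f j (x + h *: v))
   (\sum_i \sum_j v 0 i * v 0 j * partial2 f i j (x + h *: v)).
  have Dj j : is_derive h 1 (fun h : R => v 0 j * partial f j (x + h *: v))
      (v 0 j * \sum_i v 0 i * partial2 f i j (x + h *: v)).
    have := C1_is_derive_line x v h (C2_partial_C1 j Cf) => ?.
    by apply: is_derive_eq; rewrite /GRing.scale/=; ring.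
  have -> : (fun h => \sum_j v 0 j * partial f j (x + h *: v)) =
      \sum_j (fun h => v 0 j * partial f j (x + h *: v)).
    by apply/funext => y; rewrite fct_sumE.
  have [d e] := @is_derive_sum R R R N (fun j h => v 0 j * partial f j (x + h *: v)) h 1 _ Dj.
  split => //; rewrite e.
  rewrite exchange_big/=; apply: eq_bigr => j _; rewrite mulr_sumr; apply: eq_bigr => i _.
  by ring.
have [xi xi01 e] := taylor2 D1 D2.
by exists xi => //; move: e; rewrite scale1r scale0r !addr0.
Qed.

(** Were the derivative positive in direction s, it would stay so nearby by continuity, and the mean
    value theorem would give a larger value at a short step. *)
Lemma partial_sign f t i (s h0 : R) : C1 f -> 0 < h0 -> s != 0 ->
  (forall h, 0 < h <= h0 -> f (t + (h * s) *: Defs.basis i) <= f t) -> s * partial f i t <= 0.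
Proof.
move=> Cf h00 s0 hf; rewrite leNgt; apply/negP => lt.
have : \forall y \near t, 0 < s * partial f i y.
  have cs : s * partial f i y @[y --> t] --> s * partial f i t.
    exact: (cvgM (cvg_cst s) ((Cf i).2 t)).
  have /cvgrPdist_lt/(_ _ lt) := cs.
  by apply: filterS => y; rewrite ltr_norml => /andP[_]; lra.
move=> /nbhs_ballP[r /= r0 hr].
pose h := Num.min h0 (r / (2 * `|s|)).
have ns : 0 < `|s| by rewrite normr_gt0.
have h1 : 0 < h by rewrite lt_min h00 divr_gt0// mulr_gt0.
have hs : h * `|s| <= r / 2.
  apply: (@le_trans _ _ (r / (2 * `|s|) * `|s|)); first by rewrite ler_pM2r// ge_min lexx orbT.
  by rewrite le_eqVlt; apply/orP; left; apply/eqP; field; rewrite gt_eqF.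
have [xi xih e] := partial_MVT t (h * s) (Cf i).1.
have := hf h; rewrite h1 ge_min lexx/= => /(_ isT); rewrite -subr_le0 e.
have : 0 < s * partial f i (t + xi *: Defs.basis i).
  apply: hr; rewrite -ball_normE /= opprD addrA subrr sub0r normrN.
  apply: (@le_lt_trans _ _ (r / 2)); last by rewrite ltr_pdivrMr// ltr_pMr// ltr1n.
  apply: norm_le_coord; first by rewrite divr_ge0// ltW.
  move=> j; rewrite !mxE eqxx/=; case: (j == i); rewrite ?mulr1 ?mulr0 ?normr0 ?divr_ge0 ?(ltW r0)//.
  by apply: (le_trans xih); rewrite normrM (gtr0_norm h1).
move=> p q; have : 0 < h * (s * partial f i (t + xi *: Defs.basis i)) by rewrite mulr_gt0.
by rewrite mulrA mulrC ltNge q.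
Qed.

End Paths.

(** * Modification on a null set and derivatives of covariances *)

Section NullModification.
Import HBSimple HBNNSimple.
Context {d} {T : measurableType d} {R : realType} (P : probability T R).
Variable N0 : set T.
Hypothesis mN : measurable N0.
Hypothesis PN : P N0 = 0%E.

(** No measurability of [f] or [g] is assumed: on the null set the derivatives of the original field
    take arbitrary values. The integral is a supremum over simple functions below [f], and cutting
    such a function off on [N0] puts it below [g] without changing its integral. *)
Lemma nneg_null_le (f g : T -> \bar R) : (forall w, 0 <= f w)%E -> (forall w, 0 <= g w)%E ->
  (forall w, ~ N0 w -> f w = g w) -> (\int[P]_w f w <= \int[P]_w g w)%E.
Proof.
move=> f0 g0 fg; rewrite [leLHS]ge0_integralTE//; apply: ge_ereal_sup => _ [h /= hf <-].
have mC := measurableC mN.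
rewrite [leRHS]ge0_integralTE//; apply: ereal_sup_ubound.
exists (proj_nnsfun h mC).
  move=> w; rewrite /= mindicE; have [|] := boolP (w \in ~` N0).
    by rewrite inE mulr1 => /fg <-.
  by rewrite mulr0.
rewrite -!integralT_nnsfun; apply: ge0_ae_eq_integral => //.
- by apply/measurable_EFinP.
- by apply/measurable_EFinP.
- by move=> w _; rewrite lee_fin.
- by move=> w _; rewrite lee_fin.
exists N0; split => // w /=; apply: contra_notP => Nw _.
by rewrite mindicE mem_set// mulr1.
Qed.

Lemma integral_null_eq (f g : T -> \bar R) : (forall w, ~ N0 w -> f w = g w) ->
  (\int[P]_w f w = \int[P]_w g w)%E.
Proof.
move=> fg; rewrite integralE [RHS]integralE.
have E (f1 g1 : T -> \bar R) : (forall w, 0 <= f1 w)%E -> (forall w, 0 <= g1 w)%E ->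
    (forall w, ~ N0 w -> f1 w = g1 w) -> (\int[P]_w f1 w = \int[P]_w g1 w)%E.
  move=> f0 g0 e; apply/eqP; rewrite eq_le !nneg_null_le//.
  by move=> w Nw; rewrite e.
apply: (f_equal2 (fun a b => a - b)%E); apply: E => // w Nw.
- by rewrite !funeposE fg.
- by rewrite !funenegE fg.
Qed.

Lemma Rintegral_null_eq (f g : T -> R) : (forall w, ~ N0 w -> f w = g w) ->
  \int[P]_w f w = \int[P]_w g w.
Proof. by move=> fg; rewrite /Rintegral (@integral_null_eq _ (EFin \o g))// => w Nw /=; rewrite fg. Qed.

Lemma cov_null_eq (Y Z Y' Z' : T -> R) : (forall w, ~ N0 w -> Y w = Y' w) ->
  (forall w, ~ N0 w -> Z w = Z' w) -> cov P Y Z = cov P Y' Z'.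
Proof. by move=> h1 h2; apply: Rintegral_null_eq => w Nw; rewrite h1// h2. Qed.

Lemma cgauss_null_eq (Y Z : T -> R) v : measurable_fun setT Y ->
  (forall w, ~ N0 w -> Y w = Z w) -> cgauss P Z v -> cgauss P Y v.
Proof.
move=> mY YZ [mZ v0 hc hs]; split => // s.
  by rewrite -(hc s); apply: Rintegral_null_eq => w Nw; rewrite YZ.
by rewrite -(hs s); apply: Rintegral_null_eq => w Nw; rewrite YZ.
Qed.

End NullModification.

Section CenteredMoments.
Context {d} {T : measurableType d} {R : realType} (P : probability T R).
Notation nz := (normal_prob (0:R) 1).

Lemma cgauss_mean (Y : T -> R) v : cgauss P Y v ->
  P.-integrable setT (EFin \o Y) /\ \int[P]_w Y w = 0.
Proof.
move=> gY; have [mY v0 _ _] := gY.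
have [i2 _] := cgauss_variance gY.
have iY : P.-integrable setT (EFin \o Y).
  have i1 : P.-integrable setT (EFin \o (fun w => 1 + Y w ^+ 2)).
    have h : P.-integrable setT (EFin \o (fun=> 1 : R)) by exact: finite_measure_integrable_cst.
    by have := integrableD measurableT h i2; apply: eq_integrable.
  apply: (le_integrable measurableT _ _ i1); first exact/measurable_EFinP.
  move=> w _ /=; rewrite lee_fin [leRHS]ger0_norm; last by rewrite addr_ge0// sqr_ge0.
  have := sqr_ge0 (`|Y w| - 1); rewrite sqrrB1 real_normK ?num_real// => h.
  have := sqr_ge0 (Y w); have := normr_ge0 (Y w); lra.
split => //.
have mS : measurable_fun setT (fun x : R => Num.sqrt v * x) by exact: measurable_funM.
have E : (\int[P]_w (Y w)%:E = \int[nz]_x (Num.sqrt v * x)%:E)%E.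
  have pos (f : R -> \bar R) : measurable_fun setT f -> (forall x, 0 <= f x)%E ->
     (\int[P]_w f (Y w) = \int[nz]_x f (Num.sqrt v * x)%R)%E by exact: cgauss_ge0_integral.
  rewrite integralE [RHS]integralE.
  have m1 : measurable_fun setT (EFin : R -> \bar R) by apply/measurable_EFinP; exact: measurable_id.
  apply: (f_equal2 (fun a b => a - b)%E).
  - transitivity (\int[P]_w (EFin^\+)%E (Y w))%E; first by apply: eq_integral => w _; rewrite !funeposE.
    rewrite (pos _ (measurable_funepos m1) (fun x => funepos_ge0 _ x)).
    by apply: eq_integral => x _; rewrite !funeposE.
  - transitivity (\int[P]_w (EFin^\-)%E (Y w))%E; first by apply: eq_integral => w _; rewrite !funenegE.
    rewrite (pos _ (measurable_funeneg m1) (fun x => funeneg_ge0 _ x)).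
    by apply: eq_integral => x _; rewrite !funenegE.
have [i0 e0] := @normal_mean R.
transitivity (\int[nz]_x (Num.sqrt v * x)); first by rewrite /Rintegral E.
by rewrite RintegralZl// e0 mulr0.
Qed.

End CenteredMoments.

Section ModifiedField.
Context {d} {T : measurableType d} {R : realType} (P : probability T R).
Context {N : nat} (X : 'rV[R]_N -> T -> R) (D : set 'rV[R]_N).
Hypothesis hX : centered_gaussian_field P D X.
Variable N0 : set T.
Hypothesis mN : measurable N0.
Hypothesis PN : P N0 = 0%E.

Definition kill_on (Y : T -> R) (w : T) : R := if `[< N0 w >] then 0 else Y w.

Lemma kill_onE (Y : T -> R) w : ~ N0 w -> kill_on Y w = Y w.
Proof. by move=> Nw; rewrite /kill_on asboolF. Qed.

Lemma measurable_kill_on (Y : T -> R) : measurable_fun setT Y -> measurable_fun setT (kill_on Y).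
Proof.
move=> mY; rewrite (_ : kill_on Y = (fun w => Y w * \1_(~` N0) w)).
  by apply: measurable_funM => //; apply: measurable_indic; exact: measurableC.
apply/funext => w; rewrite /kill_on indicE in_setC; case: asboolP => h.
  by rewrite mem_set// mulr0.
by rewrite memNset//= mulr1.
Qed.

Definition combos : set (T -> R) := [set Y | exists n (c : 'I_n -> R) (t : 'I_n -> 'rV[R]_N),
  (forall j, D (t j)) /\ Y = (fun w => \sum_(j < n) c j * kill_on (X (t j)) w)].

Lemma field_cgauss t : D t -> exists v, cgauss P (X t) v.
Proof.
move=> Dt; apply: gaussian_cgauss; last exact: hX.2.
have := hX.1 1%N (fun=> 1) (fun=> t) (fun=> Dt).
by rewrite (_ : (fun w => _) = X t)//; apply/funext => w; rewrite big_ord1 mul1r.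
Qed.

Lemma gspace_combos : gspace P combos.
Proof.
split.
- exists 0%N, (fun=> 0), (fun=> 0); split; first by case.
  by apply/funext => w; rewrite big_ord0.
- move=> a _ _ [n1 [c1 [t1 [D1 ->]]]] [n2 [c2 [t2 [D2 ->]]]].
  exists (n1 + n2)%N, (fun i : 'I_(n1 + n2) => match fintype.split i with inl j => a * c1 j | inr j => c2 j end),
    (fun i : 'I_(n1 + n2) => match fintype.split i with inl j => t1 j | inr j => t2 j end); split.
    by move=> j; case: (fintype.split j).
  apply/funext => w; rewrite big_split_ord/=; congr (_ + _).
    by rewrite mulr_sumr; apply: eq_bigr => i _; rewrite -[lshift _ _]/(fintype.unsplit (inl i)) unsplitK mulrA.
  by apply: eq_bigr => i _; rewrite -[rshift _ _]/(fintype.unsplit (inr i)) unsplitK.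
- move=> Y [n [c [t [Dt YE]]]].
  pose Z w := \sum_(j < n) c j * X (t j) w.
  have mX t' : D t' -> measurable_fun setT (X t') by move=> /field_cgauss[v []].
  have [|v gv] := @gaussian_cgauss _ _ _ P Z (hX.1 n c t Dt).
    rewrite unlock /Z.
    under eq_integral do rewrite -sumEFin.
    rewrite integral_sum//; last first.
      move=> j; have [v gv] := field_cgauss (Dt j).
      have := integrableZl measurableT (c j) (cgauss_mean gv).1.
      by apply: eq_integrable.
    apply: big1 => j _; have [v gv] := field_cgauss (Dt j).
    have [i0 e0] := cgauss_mean gv.
    under eq_integral do rewrite EFinM.
    rewrite integralZl//.
    have := hX.2 _ (Dt j); rewrite unlock => ->; by rewrite mule0.
  exists v; apply: (cgauss_null_eq mN PN _ _ gv).
    rewrite YE; apply: measurable_sum => j; apply: measurable_funM => //.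
    by apply: measurable_kill_on; exact: mX.
  by move=> w Nw; rewrite YE; apply: eq_bigr => j _; rewrite kill_onE.
Qed.

Lemma kill_on_combos t : D t -> combos (kill_on (X t)).
Proof.
move=> Dt; exists 1%N, (fun=> 1), (fun=> t); split => //.
by apply/funext => w; rewrite big_ord1 mul1r.
Qed.

End ModifiedField.

Section PartialCovariance.
Context {d} {T : measurableType d} {R : realType} (P : probability T R).
Variable S : set (T -> R).
Hypothesis gS : gspace P S.
Context {N : nat} (a b : 'rV[R]_N).
Hypothesis hab : forall i, a 0 i < b 0 i.

(** Reduces the limit defining [partial_in] to sequences, the form in which [cov_cvg] yields
    convergence of covariances. *)
Lemma cvg_seq_within (g : R -> R) (A : set R) (l : R) :
  (forall h_ : nat -> R, (forall n, h_ n != 0 /\ A (h_ n)) -> h_ n @[n --> \oo] --> (0 : R) ->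
     g (h_ n) @[n --> \oo] --> l) ->
  g h @[h --> within A (0 : R)^'] --> l.
Proof.
move=> hseq; apply/cvgrPdist_le => e e0; apply: contrapT => nnear.
have h n : exists h, [/\ h != 0, A h, `|h| < n.+1%:R^-1 & e < `|l - g h|].
  apply: contrapT => nex; apply: nnear.
  have n0 : 0 < n.+1%:R^-1 :> R by rewrite invr_gt0 ltr0n.
  suff : \forall h \near (0 : R)^', A h -> `|l - g h| <= e by [].
  have H1 : \forall h \near (0 : R)^', h != 0 by exact: nbhs_dnbhs_neq.
  have H2 : \forall h \near (0 : R)^', `|h| < n.+1%:R^-1 by exact: dnbhs0_lt.
  apply: filterS2 H1 H2 => h h0 hn Ah.
  by rewrite leNgt; apply/negP => lt; apply: nex; exists h.
have [h_ hh] := choice h.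
have h0 : h_ n @[n --> \oo] --> (0 : R).
  apply/cvgrPdist_le => e' e'0; near=> n; rewrite sub0r normrN.
  have [_ _ /ltW lt _] := hh n; apply: (le_trans lt); near: n.
  have /cvgrPdist_le/(_ e' e'0) := @cvg_harmonic R.
  by apply: filterS => n; rewrite sub0r normrN; apply: le_trans; exact: ler_norm.
have := hseq h_ (fun n => let: And4 h1 h2 _ _ := hh n in conj h1 h2) h0.
move=> /cvgrPdist_le/(_ e e0)[n _ /(_ n (leqnn _))].
by have [_ _ _] := hh n; rewrite ltNge => /negP.
Unshelve. all: by end_near. Qed.

(** The step goes towards the farther end of the i-th side and has half its length, so it exists at
    every point, end points included. *)
Lemma box_step t i : box a b t -> exists2 s : R, s != 0 &
  forall h, 0 <= h <= 1 -> box a b (t + (h * s) *: Defs.basis i).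
Proof.
move=> bt; have ba : 0 < b 0 i - a 0 i by rewrite subr_gt0.
have /andP[t1 t2] := bt i.
have [le|lt] := leP (t 0 i) ((a 0 i + b 0 i) / 2).
- exists ((b 0 i - a 0 i) / 2); first by rewrite gt_eqF// divr_gt0.
  move=> h /andP[h0 h1] j; rewrite !mxE eqxx/=; case: (eqVneq j i) => [->|_].
    rewrite mulr1; apply/andP; split; nra.
  by rewrite mulr0 addr0; exact: bt.
- exists (- ((b 0 i - a 0 i) / 2)); first by rewrite oppr_eq0 gt_eqF// divr_gt0.
  move=> h /andP[h0 h1] j; rewrite !mxE eqxx/=; case: (eqVneq j i) => [->|_].
    rewrite mulr1; apply/andP; split; nra.
  by rewrite mulr0 addr0; exact: bt.
Qed.

(** Properness of the filter of admissible increments makes limits along it unique, so that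
    [partial_in] can be evaluated at boundary points. *)
Lemma within_box_proper t i : box a b t ->
  ProperFilter (within [set h : R | box a b (t + h *: Defs.basis i)] (0 : R)^').
Proof.
move=> bt; have [s s0 hs] := box_step i bt.
apply: Build_ProperFilter_ex => A [e /= e0 hA].
have ns : 0 < `|s| by rewrite normr_gt0.
pose h := Num.min 1 (e / (2 * `|s|)).
have h0 : 0 < h by rewrite lt_min ltr01 divr_gt0// mulr_gt0.
have h1 : h <= 1 by rewrite ge_min lexx.
exists (h * s); apply: hA => /=.
- rewrite sub0r normrN normrM (gtr0_norm h0).
  apply: (@le_lt_trans _ _ (e / (2 * `|s|) * `|s|)); first by rewrite ler_pM2r// ge_min lexx orbT.
  have -> : e / (2 * `|s|) * `|s| = e / 2 by field; rewrite gt_eqF.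
  by rewrite ltr_pdivrMr// ltr_pMr// ltr1n.
- by rewrite mulf_neq0// gt_eqF.
- by apply: hs; rewrite h1 (ltW h0).
Qed.

Lemma partial_in_eq (f g : 'rV[R]_N -> R) i t : box a b t -> (forall s, box a b s -> f s = g s) ->
  partial_in (box a b) f i t = partial_in (box a b) g i t.
Proof.
move=> bt fg; rewrite /partial_in; congr (lim _).
apply/seteqP; split => A [e /= e0 hA]; exists e => //= h h1 h2 h3.
- by have := hA h h1 h2 h3; rewrite /= !fg.
- by have := hA h h1 h2 h3; rewrite /= !fg.
Qed.

Lemma partial_quotient_cvg (f : 'rV[R]_N -> R) i t (h_ : nat -> R) :
  derivable f t (Defs.basis i) -> (forall n, h_ n != 0) -> h_ n @[n --> \oo] --> (0 : R) ->
  (h_ n)^-1 * (f (t + h_ n *: Defs.basis i) - f t) @[n --> \oo] --> partial f i t.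
Proof.
move=> df hn0 h0.
have dc : h^-1 *: ((f \o shift t) (h *: Defs.basis i) - f t) @[h --> (0 : R)^'] --> partial f i t.
  exact: df.
have hd : h_ n @[n --> \oo] --> (0 : R)^'.
  move=> A [e /= e0 hA]; have /cvgrPdist_lt/(_ e e0) := h0.
  by apply: filterS => n lt; exact: hA.
have := @cvg_comp nat R R h_ _ _ _ _ hd dc.
rewrite (_ : _ \o h_ = (fun n => (h_ n)^-1 * (f (t + h_ n *: Defs.basis i) - f t)))//.
by apply/funext => n /=; rewrite [t + _]addrC.
Qed.

Variables (A B : 'rV[R]_N -> T -> R) (i : 'I_N).
Hypothesis SA : forall t, box a b t -> S (A t).
Hypothesis SB : forall t, box a b t -> S (B t).
Hypothesis dA : forall w t, derivable (fun s => A s w) t (Defs.basis i).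
Hypothesis dB : forall w t, derivable (fun s => B s w) t (Defs.basis i).
Hypothesis cB : forall w, continuous (fun s => B s w).

Lemma partial_glim t : box a b t -> glim S (fun w => partial (fun s => A s w) i t).
Proof.
move=> bt; have [s s0 hs] := box_step i bt.
pose h_ n : R := n.+1%:R^-1 * s.
have n0 n : 0 < n.+1%:R^-1 :> R by rewrite invr_gt0 ltr0n.
have h0 : h_ n @[n --> \oo] --> (0 : R).
  rewrite -(mul0r s); apply: cvgM; last exact: cvg_cst.
  exact: cvg_harmonic.
exists (fun n w => (h_ n)^-1 * (A (t + h_ n *: Defs.basis i) w - A t w)); split.
- move=> n; apply: (gspaceZ gS); apply: (gspaceB gS); last exact: SA.
  by apply: SA; apply: hs; rewrite (ltW (n0 n)) invf_le1 ?ltr0n// ler1n.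
- move=> w; apply: partial_quotient_cvg => // n.
  by rewrite mulf_neq0// gt_eqF.
Qed.

Hypothesis SAi : forall t, box a b t -> S (fun w => partial (fun s => A s w) i t).
Hypothesis SBi : forall t, box a b t -> S (fun w => partial (fun s => B s w) i t).

(** Discrete Leibniz rule: the quotient equals cov(DA_n, B(t_n)) + cov(A(t), DB_n) with difference
    quotients DA_n and DB_n, and [cov_cvg] passes to the limit. *)
Lemma cov_quotient_cvg t (h_ : nat -> R) : box a b t ->
  (forall n, h_ n != 0 /\ box a b (t + h_ n *: Defs.basis i)) -> h_ n @[n --> \oo] --> (0 : R) ->
  (h_ n)^-1 * (cov P (A (t + h_ n *: Defs.basis i)) (B (t + h_ n *: Defs.basis i)) - cov P (A t) (B t))
  @[n --> \oo] -->
  cov P (fun w => partial (fun s => A s w) i t) (B t) +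
  cov P (A t) (fun w => partial (fun s => B s w) i t).
Proof.
move=> bt hh h0.
pose t_ n := t + h_ n *: Defs.basis i.
have bt_ n : box a b (t_ n) by exact: (hh n).2.
have tc : t_ n @[n --> \oo] --> t.
  rewrite -[X in _ --> X]addr0; apply: cvgD; first exact: cvg_cst.
  rewrite -(scale0r (Defs.basis i)); apply: cvgZr_tmp => //.
pose DA n w := (h_ n)^-1 * (A (t_ n) w - A t w).
pose DB n w := (h_ n)^-1 * (B (t_ n) w - B t w).
have SDA n : S (DA n) by apply: (gspaceZ gS); apply: (gspaceB gS); exact: SA.
have SDB n : S (DB n) by apply: (gspaceZ gS); apply: (gspaceB gS); exact: SB.
have cDA w : DA n w @[n --> \oo] --> partial (fun s => A s w) i t.
  by apply: partial_quotient_cvg => // n; exact: (hh n).1.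
have cDB w : DB n w @[n --> \oo] --> partial (fun s => B s w) i t.
  by apply: partial_quotient_cvg => // n; exact: (hh n).1.
have cBt w : B (t_ n) w @[n --> \oo] --> B t w.
  exact: (@cvg_comp nat 'rV[R]_N R t_ (fun t => B t w) _ _ _ tc (@cB w t)).
have L1 := cov_cvg gS SDA (fun n => SB (bt_ n)) (SAi bt) (SB bt) cDA cBt.
have cAt w : A t w @[n --> \oo] --> A t w by exact: cvg_cst.
have L2 := cov_cvg gS (fun n => SA bt) SDB (SA bt) (SBi bt) cAt cDB.
apply: cvg_trans (cvgD L1 L2); apply: near_eq_cvg; apply: nearW => n.
have h1 : cov P (DA n) (B (t_ n)) = (h_ n)^-1 * (cov P (A (t_ n)) (B (t_ n)) - cov P (A t) (B (t_ n))).
  rewrite (covZl gS); [|by apply: (gspaceB gS); exact: SA|exact: SB].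
  by rewrite (covBl gS)//; [exact: SA|exact: SA|exact: SB].
have h2 : cov P (A t) (DB n) = (h_ n)^-1 * (cov P (A t) (B (t_ n)) - cov P (A t) (B t)).
  rewrite covC (covZl gS); [|by apply: (gspaceB gS); exact: SB|exact: SA].
  by rewrite (covBl gS); [rewrite !(covC P _ (A t))|exact: SB|exact: SB|exact: SA].
have E : cov P (DA n) (B (t_ n)) + cov P (A t) (DB n) =
    (h_ n)^-1 * (cov P (A (t_ n)) (B (t_ n)) - cov P (A t) (B t)).
  by rewrite h1 h2 -mulrDr; congr (_ * _); ring.
first [exact: E|exact: esym E].
Qed.

Lemma partial_in_cov t : box a b t ->
  partial_in (box a b) (fun t => cov P (A t) (B t)) i t =
  cov P (fun w => partial (fun s => A s w) i t) (B t) +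
  cov P (A t) (fun w => partial (fun s => B s w) i t).
Proof.
move=> bt; rewrite /partial_in; have pf := within_box_proper i bt.
by apply: cvg_lim => //; apply: cvg_seq_within => h_ hh h0; exact: cov_quotient_cvg.
Qed.

(** First-order condition at a constrained maximum: only steps to one side are admissible, whence an
    inequality. *)
Lemma cov_direction_le0 t (s : R) : box a b t -> s != 0 ->
  (forall h, 0 <= h <= 1 -> box a b (t + (h * s) *: Defs.basis i)) ->
  (forall r, box a b r -> cov P (A r) (B r) <= cov P (A t) (B t)) ->
  s * (cov P (fun w => partial (fun s => A s w) i t) (B t) +
       cov P (A t) (fun w => partial (fun s => B s w) i t)) <= 0.
Proof.
move=> bt s0 hs tmax; pose h_ n : R := n.+1%:R^-1 * s.
have n0 n : 0 < n.+1%:R^-1 :> R by rewrite invr_gt0 ltr0n.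
have h0 : h_ n @[n --> \oo] --> (0 : R).
  rewrite -(mul0r s); apply: cvgM; last exact: cvg_cst.
  exact: cvg_harmonic.
have hb n : box a b (t + h_ n *: Defs.basis i).
  by apply: hs; rewrite (ltW (n0 n)) invf_le1 ?ltr0n// ler1n.
have hn n : h_ n != 0 by rewrite mulf_neq0// gt_eqF.
have cq := cov_quotient_cvg bt (fun n => conj (hn n) (hb n)) h0.
set L := _ + _ in cq *.
pose q n := (h_ n)^-1 * (cov P (A (t + h_ n *: Defs.basis i)) (B (t + h_ n *: Defs.basis i)) - cov P (A t) (B t)).
have cv : s * q n @[n --> \oo] --> s * L by apply: cvgM; [exact: cvg_cst|exact: cq].
rewrite -(cvg_lim (@Rhausdorff R) cv); apply: limr_le; first by apply/cvg_ex; eexists; exact: cv.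
apply: nearW => n; rewrite /q mulrA.
have -> : s * (h_ n)^-1 = n.+1%:R by rewrite /h_ invfM invrK mulrCA mulfV// mulr1.
by rewrite mulr_ge0_le0// subr_le0 tmax.
Qed.

End PartialCovariance.

(** * Reduction of the excursion event to the quadratic model *)

Section PosdefForms.
Context {R : realType}.

Lemma posdef_form_ge0 n (A : 'M[R]_n) (v : 'rV[R]_n) : posdef A -> 0 <= (v *m A *m v^T) 0 0.
Proof.
move=> Ap; have [->|v0] := eqVneq v 0; first by rewrite !mul0mx mxE.
by rewrite ltW// (Ap.2 v v0).
Qed.

(** Nonnegativity of the form of [A] at v - m^-1 g A^-1, up to the factor 2/m. *)
Lemma posdef_complete_square n (A : 'M[R]_n) (v g : 'rV[R]_n) (m : R) : posdef A -> 0 < m ->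
  (v *m g^T) 0 0 - m / 2 * (v *m A *m v^T) 0 0 <= (g *m invmx A *m g^T) 0 0 / (2 * m).
Proof.
move=> Ap m0; have uA := posdef_unit Ap; have As := Ap.1.
pose y := v - m^-1 *: (g *m invmx A).
have := posdef_form_ge0 y Ap.
have e1 : y *m A = v *m A - m^-1 *: g by rewrite /y mulmxBl -scalemxAl mulmxKV.
have e2 : y^T = v^T - m^-1 *: (invmx A *m g^T).
  by rewrite /y linearB/= linearZ/= trmx_mul trmx_inv As.
have vg : (g *m v^T) 0 0 = (v *m g^T) 0 0.
  by rewrite -[g *m v^T]trmxK trmx_mul trmxK mxE.
rewrite e1 e2 mulmxBl !mulmxBr -!scalemxAl -!scalemxAr.
have -> : v *m A *m (invmx A *m g^T) = v *m g^T by rewrite mulmxA mulmxK.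
rewrite mulmxA.
move: (v *m A *m v^T) (v *m g^T) (g *m v^T) (g *m invmx A *m g^T) vg => M1 M2 M3 M4 M23.
rewrite !mxE M23; move: (M1 0 0) (M2 0 0) (M4 0 0) => x1 x2 x4.
have -> : x1 - m^-1 * x2 - (m^-1 * x2 - m^-1 * (m^-1 * x4)) =
   2 / m * (x4 / (2 * m) - (x2 - m / 2 * x1)).
  by field; rewrite gt_eqF.
by rewrite pmulr_rge0 ?divr_gt0// subr_ge0.
Qed.

Lemma complete_square_eq n (A : 'M[R]_n) (g : 'rV[R]_n) (m : R) : posdef A -> 0 < m ->
  let v := m^-1 *: (g *m invmx A) in
  (v *m g^T) 0 0 - m / 2 * (v *m A *m v^T) 0 0 = (g *m invmx A *m g^T) 0 0 / (2 * m).
Proof.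
move=> Ap m0 v; have uA := posdef_unit Ap; have As := Ap.1.
have e2 : v^T = m^-1 *: (invmx A *m g^T) by rewrite /v linearZ/= trmx_mul trmx_inv As.
rewrite e2 /v -!scalemxAl -!scalemxAr mulmxKV// mulmxA.
move: (g *m invmx A *m g^T) => M; rewrite !mxE; move: (M 0 0) => x.
by field; rewrite gt_eqF.
Qed.

(** With A = L L^T and y = v L, the form is |y|^2 and v = y L^-1 has coordinates bounded by
    multiples of |y|. The l1 norm is the one in which entrywise errors of a matrix are estimated. *)
Lemma posdef_l1_bound n (A : 'M[R]_n) : posdef A -> exists2 C, 0 < C &
  forall v : 'rV[R]_n, (\sum_i `|v 0 i|) ^+ 2 <= C * (v *m A *m v^T) 0 0.
Proof.
move=> Ap; have [L LA] := cholesky Ap.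
have uL : L \in unitmx.
  have := posdef_unit Ap; rewrite -LA !unitmxE det_mulmx.
  by rewrite unitrM => /andP[].
pose B := \sum_i \sum_j `|invmx L j i|.
have B0 : 0 <= B by apply: sumr_ge0 => i _; exact: sumr_ge0.
exists (1 + B ^+ 2); first by rewrite ltr_pwDl// sqr_ge0.
move=> v; pose y := v *m L.
have E : v *m A *m v^T = y *m y^T by rewrite -LA /y trmx_mul !mulmxA.
have yy : (y *m y^T) 0 0 = \sum_j y 0 j ^+ 2.
  by rewrite mxE; apply: eq_bigr => j _; rewrite [y^T _ _]mxE expr2.
pose q := (y *m y^T) 0 0.
have q0 : 0 <= q by rewrite /q yy sumr_ge0// => j _; exact: sqr_ge0.
have yj j : `|y 0 j| <= Num.sqrt q.
  rewrite -sqrtr_sqr ler_wsqrtr// /q yy (bigD1 j)//= lerDl sumr_ge0// => i _; exact: sqr_ge0.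
have vy : v = y *m invmx L by rewrite /y mulmxK.
have le : \sum_i `|v 0 i| <= B * Num.sqrt q.
  rewrite /B mulr_suml; apply: ler_sum => i _.
  rewrite {1}vy mxE mulr_suml; apply: (le_trans (ler_norm_sum _ _ _)); apply: ler_sum => j _.
  by rewrite normrM mulrC ler_wpM2l.
rewrite E -/q; apply: (@le_trans _ _ ((B * Num.sqrt q) ^+ 2)).
  apply: lerXn2r => //; rewrite nnegrE; first exact: sumr_ge0.
  by rewrite mulr_ge0 ?sqrtr_ge0.
by rewrite exprMn sqr_sqrtr// ler_wpM2r// lerDr.
Qed.

Lemma form_perturb n (A M : 'M[R]_n) (v : 'rV[R]_n) (e C : R) : 0 <= e ->
  (\sum_i `|v 0 i|) ^+ 2 <= C * (v *m A *m v^T) 0 0 ->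
  (forall i j, `|M i j - A i j| <= e) ->
  `|(v *m M *m v^T) 0 0 - (v *m A *m v^T) 0 0| <= e * C * (v *m A *m v^T) 0 0.
Proof.
move=> e0 hC hM; rewrite !quadE -sumrB -quadE.
apply: (@le_trans _ _ (e * (\sum_i `|v 0 i|) ^+ 2)); last by rewrite -mulrA ler_wpM2l.
rewrite expr2 mulr_suml mulr_sumr; apply: (le_trans (ler_norm_sum _ _ _)); apply: ler_sum => i _.
rewrite -sumrB !mulr_sumr; apply: (le_trans (ler_norm_sum _ _ _)); apply: ler_sum => j _.
by rewrite -mulrBl normrM normrM ler_wpM2r// mulr_ge0.
Qed.

End PosdefForms.

Section Negligible.
Context {d} {T : measurableType d} {R : realType} (P : probability T R).
Variable s2 : R.

(** Rate strictly above 1/(2 s2), the rate of the main term Psi(u / sqrt(s2)). *)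
Definition neg (A : R -> set T) : Prop :=
  exists2 al, 0 < al & exp_small P ((2 * s2)^-1 + al) A.

Lemma neg_sub A B : (\forall u \near +oo, A u `<=` B u) -> neg B -> neg A.
Proof. by move=> AB [al al0 h]; exists al => //; exact: exp_small_sub h. Qed.

Lemma negU A B : neg A -> neg B -> neg (fun u => A u `|` B u).
Proof.
move=> [a a0 hA] [b b0 hB]; exists (Num.min a b / 2); first by rewrite divr_gt0// lt_min a0.
apply: (@exp_smallU _ _ _ _ ((2 * s2)^-1 + Num.min a b)).
- by rewrite ltrD2l ltr_pdivrMr// ltr_pMr ?ltr1n// lt_min a0.
- by apply: exp_small_le hA; rewrite lerD2l ge_min lexx.
- by apply: exp_small_le hB; rewrite lerD2l ge_min lexx orbT.
Qed.

Lemma neg_exists (I : finType) (A : I -> R -> set T) : (forall i, neg (A i)) ->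
  neg (fun u => [set w | exists i, A i u w]).
Proof.
move=> h.
suff H (s : seq I) : neg (fun u => [set w | exists2 i, i \in s & A i u w]).
  by apply: neg_sub (H (enum I)); near=> u => w [i Ai]; exists i => //; rewrite mem_enum.
elim: s => [|i s IH].
  exists 1 => //; apply: exp_small_sub (exp_small0 P _); near=> u => w [i] /=.
  by rewrite in_nil.
apply: neg_sub (negU (h i) IH); near=> u => w [j]; rewrite in_cons => /predU1P[->|js] Aj.
  by left.
by right; exists j.
Unshelve. all: by end_near. Qed.

Lemma neg_near_family (I : finType) (A : I -> R -> R -> set T) :
  (forall i r r' u, r <= r' -> A i r u `<=` A i r' u) ->
  (forall i, exists2 r, 0 < r & neg (A i r)) ->
  exists2 r, 0 < r & neg (fun u => [set w | exists i, A i r u w]).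
Proof.
move=> mono h.
have /choice[r hr] i : exists r, 0 < r /\ neg (A i r).
  by have [r r0 n] := h i; exists r.
pose r0 := \big[Num.min/1]_i r i.
have r0i i : r0 <= r i by rewrite /r0 (bigD1 i)//= ge_min lexx.
exists r0; first by rewrite /r0; apply: lt_bigmin => // i _; exact: (hr i).1.
apply: neg_sub (neg_exists (fun i => (hr i).2)); near=> u => w [i Ai]; exists i.
exact: mono Ai.
Unshelve. all: by end_near. Qed.

End Negligible.

Section Compact.
Context {R : realType} {N : nat} (a b : 'rV[R]_N).

Lemma box_compact : compact (box a b).
Proof.
have := @rV_compact R N (fun i => `[a 0 i, b 0 i]%classic) (fun i => @segment_compact _ _ _).
by rewrite (_ : [set v | _] = box a b).
Qed.

Lemma ball_box_compact t0 (r : R) : 0 < r -> compact (box a b `&` [set t | `|t - t0| <= r]).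
Proof.
move=> r0; apply: compact_closedI; first exact: box_compact.
rewrite (_ : [set t | _] = closed_ball t0 r); first exact: closed_ball_closed.
by rewrite closed_ballE//; apply/seteqP; split => t; rewrite /closed_ball_/= distrC.
Qed.

Lemma far_box_compact t0 (r : R) : compact (box a b `&` [set t | r <= `|t - t0|]).
Proof.
apply: compact_closedI; first exact: box_compact.
rewrite (_ : [set t | _] = ~` ball t0 r); first by apply: open_closedC; exact: ball_open.
apply/seteqP; split => t; rewrite -ball_normE/= distrC.
  by move=> h; apply/negP; rewrite -leNgt.
by move=> /negP; rewrite -leNgt.
Qed.

End Compact.

Section FaceSums.
Context {R : realType} {N : nat} (tau : {set 'I_N}).

Lemma continuous_linear (f g : 'rV[R]_N -> R) (c : R) : continuous f -> continuous g ->
  continuous (fun t => c * f t + g t).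
Proof. by move=> cf cg t; exact: (cvgD (cvgM (cvg_cst c) (cf t)) (cg t)). Qed.

Lemma continuous_cst_row (x : R) : continuous (fun _ : 'rV[R]_N => x).
Proof. exact: cst_continuous. Qed.

Lemma sum_face (F : 'I_N -> R) : (forall i, i \notin tau -> F i = 0) ->
  \sum_i F i = \sum_(k < #|tau|) F (enum_val k).
Proof.
move=> F0; rewrite (bigID (mem tau))/= [X in _ + X]big1 ?addr0; last by move=> i /F0.
by rewrite big_enum_val.
Qed.

Definition face_vec (v : 'rV[R]_#|tau|) : 'rV[R]_N :=
  \row_j \sum_(k < #|tau|) v 0 k * (j == enum_val k)%:R.

Lemma face_vecE v k : face_vec v 0 (enum_val k) = v 0 k.
Proof.
rewrite mxE (bigD1 k)//= eqxx mulr1 big1 ?addr0// => l lk.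
by rewrite (inj_eq enum_val_inj) eq_sym (negbTE lk) mulr0.
Qed.

Lemma face_vec0 v j : j \notin tau -> face_vec v 0 j = 0.
Proof.
move=> jt; rewrite mxE big1// => k _; case: eqP => [e|_]; last by rewrite mulr0.
by move: jt; rewrite e enum_valP.
Qed.

Lemma face_taylor (f : 'rV[R]_N -> R) (x v : 'rV[R]_N) : C2 f ->
  (forall j, j \notin tau -> v 0 j = 0) ->
  let vK : 'rV[R]_#|tau| := \row_k v 0 (enum_val k) in
  let g : 'rV[R]_#|tau| := \row_k partial f (enum_val k) x in
  exists2 xi, 0 <= xi <= 1 &
    f (x + v) = f x + (vK *m g^T) 0 0 +
      (vK *m (\matrix_(i, j) partial2 f (enum_val i) (enum_val j) (x + xi *: v)) *m vK^T) 0 0 / 2.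
Proof.
move=> Cf v0 vK g; have [xi xi01 ->] := C2_taylor x v Cf.
exists xi => //; congr (_ + _ + _ / 2).
  rewrite sum_face; last by move=> i /v0 ->; rewrite mul0r.
  by rewrite mxE; apply: eq_bigr => k _; rewrite !mxE.
rewrite sum_face; last by move=> i /v0 ->; rewrite big1// => j _; rewrite !mul0r.
rewrite quadE; apply: eq_bigr => i _.
rewrite sum_face; last by move=> j /v0 ->; rewrite mulr0 mul0r.
by apply: eq_bigr => j _; rewrite !mxE mulrC.
Qed.

End FaceSums.

Lemma le_double_sum (R : realType) (I : finType) (c : I -> I -> R) i j :
  (forall i j, 0 <= c i j) -> c i j <= 1 + \sum_i \sum_j c i j.
Proof.
move=> c0; apply: (@le_trans _ _ (\sum_j c i j)).
  by rewrite (bigD1 j)//= lerDl sumr_ge0.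
apply: (@le_trans _ _ (\sum_i \sum_j c i j)); last by rewrite lerDr.
by rewrite [leRHS](bigD1 i)//= lerDl sumr_ge0// => k _; exact: sumr_ge0.
Qed.

(** * Localisation at the variance maximum and comparison with the quadratic model *)

Section Excursion.
Context {d} {T : measurableType d} {R : realType} (P : probability T R).
Variable S : set (T -> R).
Hypothesis gS : gspace P S.
Context {N : nat} (a b : 'rV[R]_N).
Hypothesis hab : forall i, a 0 i < b 0 i.
Variable Z : 'rV[R]_N -> T -> R.
Let Z1 i t w := partial (fun s => Z s w) i t.
Let Z2 i j t w := partial2 (fun s => Z s w) i j t.
Hypothesis CZ : forall w, C2 (fun s => Z s w).
Hypothesis SZ : forall t, box a b t -> S (Z t).
Hypothesis SZ1 : forall i t, box a b t -> S (Z1 i t).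
Hypothesis SZ2 : forall i j t, box a b t -> S (Z2 i j t).
Hypothesis oZ : osc P a b Z.
Hypothesis oZ1 : forall i, osc P a b (Z1 i).
Hypothesis oZ2 : forall i j, osc P a b (Z2 i j).
Variables (ts : 'rV[R]_N) (tau : {set 'I_N}).
Hypothesis bts : box a b ts.
Let s2 := cov P (Z ts) (Z ts).
Hypothesis s20 : 0 < s2.
Hypothesis uniq_max : forall t, box a b t -> t != ts -> cov P (Z t) (Z t) < s2.
(** Gives the inward direction at [ts] for the coordinates fixed on the face. *)
Variable sgn : 'I_N -> R.
Hypothesis sgn0 : forall j, j \notin tau -> sgn j != 0.
Hypothesis sgn_box : forall j t, j \notin tau -> box a b t -> 0 <= sgn j * (t 0 j - ts 0 j).
Hypothesis sgn_cov : forall j, j \notin tau -> sgn j * cov P (Z ts) (Z1 j ts) < 0.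
Hypothesis ts_tau : forall i, i \in tau -> a 0 i < ts 0 i < b 0 i.
Let A : 'M[R]_#|tau| := \matrix_(i, j) - cov P (Z ts) (Z2 (enum_val i) (enum_val j) ts).
Hypothesis Ap : posdef A.

Let cZ w : continuous (fun t => Z t w). Proof. by case: (CZ w). Qed.
Let cZ1 i w : continuous (fun t => Z1 i t w). Proof. by case: (CZ w) => _ h _; case: (h i). Qed.
Let cZ2 i j w : continuous (fun t => Z2 i j t w). Proof. by case: (CZ w) => _ _ h; case: (h i j). Qed.

Definition near_box r : set 'rV[R]_N := [set t | box a b t /\ `|t - ts| <= r].

Let neg := neg P s2.

Lemma near_neg Y k : (forall t, box a b t -> S (Y t)) -> (forall w, continuous (fun t => Y t w)) ->
  osc P a b Y -> 0 < k -> cov P (Y ts) (Y ts) < k ^+ 2 * s2 ->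
  exists2 r, 0 < r & neg (fun u => [set w | exists2 t, near_box r t & k * u <= Y t w]).
Proof.
move=> SY cY oY k0 lt; have [r r0 h] := osc_near gS SY cY oY bts k0 s20 lt.
by exists r.
Qed.

Lemma bounded_var_neg (D : set 'rV[R]_N) v : D `<=` box a b -> 0 <= v -> v < s2 ->
  (forall t, D t -> cov P (Z t) (Z t) <= v) ->
  neg (fun u => [set w | exists2 t, D t & u <= Z t w]).
Proof.
move=> Db v0 vs Dv; pose v' := (v + s2) / 2.
have v'0 : 0 < v' by rewrite divr_gt0// ltr_wpDl.
have vv' : v < v' by rewrite /v'; lra.
have v's : v' < s2 by rewrite /v'; lra.
exists ((2 * v')^-1 - (2 * s2)^-1).
  have h2 : 2 * v' < 2 * s2 by lra.
  by rewrite subr_gt0 ltf_pV2 ?posrE//; rewrite mulr_gt0.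
by rewrite addrC subrK; exact: (osc_ldp gS SZ oZ Db Dv vv' v'0).
Qed.

(** On the compact part of the box at distance at least r the variance attains its maximum, which is
    below [s2] because [ts] is the unique maximiser. *)
Lemma far_neg r : 0 < r ->
  neg (fun u => [set w | exists2 t, box a b t /\ r <= `|t - ts| & u <= Z t w]).
Proof.
move=> r0; set D := [set t | box a b t /\ r <= `|t - ts|].
have [D0|D0] := pselect (D !=set0); last first.
  apply: (@bounded_var_neg D 0) => //; first by move=> t [].
  by move=> t Dt; exfalso; apply: D0; exists t.
have cD : {within D, continuous (fun t => cov P (Z t) (Z t))}.
  apply/subspace_continuousP => t [bt tr]; apply/cvgrPdist_le => e e0.
  have [q q0 hq] := cov_continuous_on gS SZ cZ bt e0.
  apply/nbhs_ballP; exists q => // s; rewrite -ball_normE/= => st [bs _].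
  by rewrite distrC; apply: hq; rewrite // distrC ltW.
have [c /set_mem [bc rc] hc] := EVT_max_rV D0 (@far_box_compact _ _ a b ts r) cD.
apply: (@bounded_var_neg D (cov P (Z c) (Z c))).
- by move=> t [].
- by apply: (cov_ge0 gS); exact: SZ.
- apply: uniq_max => //; apply/eqP => e; move: rc; rewrite e subrr normr0.
  by rewrite leNgt r0.
- by move=> t Dt; apply: hc; exact: mem_set.
Qed.

(** If Z >= u at a point where the inward derivative is nonnegative, then Z + la sgn Z1 >= u there.
    As variance decreases inward at [ts], a small [la] brings the variance of this sum at [ts] below
    [s2]. *)
Lemma grad_neg : exists2 r, 0 < r & neg (fun u => [set w | exists j, j \notin tau /\
  exists2 t, near_box r t & u <= Z t w /\ 0 <= sgn j * Z1 j t w]).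
Proof.
apply: (neg_near_family (A := fun j r u => [set w | j \notin tau /\
  exists2 t, near_box r t & u <= Z t w /\ 0 <= sgn j * Z1 j t w])).
  move=> j r r' u rr w [jt [t [bt tr] h]]; split => //; exists t => //.
  by split => //; exact: le_trans rr.
move=> j; have [jt|jt] := boolP (j \in tau).
  exists 1 => //; exists 1 => //; apply: exp_small_sub (exp_small0 P _).
  by near=> u => w [].
pose c := sgn j * cov P (Z ts) (Z1 j ts); pose q := sgn j ^+ 2 * cov P (Z1 j ts) (Z1 j ts).
have c0 : c < 0 by exact: sgn_cov.
have q0 : 0 <= q by rewrite mulr_ge0 ?sqr_ge0// (cov_ge0 gS)//; exact: SZ1.
(* The variance changes by la (la q + 2 c), and la q <= - c, so the bracket is at most c < 0. *)
pose la := - c / (1 + q).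
have la0 : 0 < la by rewrite divr_gt0 ?oppr_gt0// ltr_pwDl.
pose Y t w := la * sgn j * Z1 j t w + Z t w.
have SY t : box a b t -> S (Y t) by move=> bt; apply: (gspaceDZ gS); [exact: SZ1|exact: SZ].
have cY w : continuous (fun t => Y t w).
  exact: continuous_linear.
have oY : osc P a b Y by exact: osc_linear.
have lt : cov P (Y ts) (Y ts) < 1 ^+ 2 * s2.
  have S1 := SZ1 j bts; have S0 := SZ bts; have SS := gspaceZ gS (la * sgn j) S1.
  have -> : cov P (Y ts) (Y ts) = la ^+ 2 * q + 2 * la * c + s2.
    rewrite /Y (covDD gS SS S0) (covZl gS _ S1 SS) (covC _ (Z1 j ts)) !(covZl gS _ S1)//.
    by rewrite (covC P (Z1 j ts) (Z ts)) /c /q /s2; ring.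
  rewrite expr1n mul1r gtrDr.
  have -> : la ^+ 2 * q + 2 * la * c = la * (la * q + 2 * c) by ring.
  rewrite pmulr_rlt0//.
  have : la * (1 + q) = - c by rewrite /la divfK// gt_eqF// ltr_pwDl.
  clearbody la; clearbody c q => h; nra.
have [r r0 h] := near_neg SY cY oY ltr01 lt.
exists r => //; apply: neg_sub h; near=> u => w [_ [t nt [ut g0]]]; exists t => //.
by rewrite mul1r /Y (le_trans ut)// lerDr -mulrA mulr_ge0// ltW.
Unshelve. all: by end_near. Qed.

(** On this event 2 Z(t) - Z(ts) is at least (1 + e) u, while at t = ts its variance is just
    [s2]. *)
Lemma low_neg e : 0 < e -> exists2 r, 0 < r & neg (fun u => [set w |
  exists2 t, near_box r t & u <= Z t w /\ Z ts w <= (1 - e) * u]).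
Proof.
move=> e0; pose Y t w := 2 * Z t w + (-1 * Z ts w + 0 * Z ts w).
have k0 : 0 < 1 + e by rewrite addr_gt0.
have SC : S (fun w => -1 * Z ts w + 0 * Z ts w).
  by apply: (gspaceDZ gS); [exact: SZ|apply: (gspaceZ gS); exact: SZ].
have SY t : box a b t -> S (Y t) by move=> bt; apply: (gspaceDZ gS) => //; exact: SZ.
have cY w : continuous (fun t => Y t w).
  by apply: continuous_linear => //; exact: continuous_cst_row.
have oY : osc P a b Y by apply: osc_linear => //; exact: osc_const.
have lt : cov P (Y ts) (Y ts) < (1 + e) ^+ 2 * s2.
  have -> : cov P (Y ts) (Y ts) = s2.
    by apply: eq_Rintegral => w _; rewrite /Y; ring.
  rewrite ltr_pMl// exprn_egt1//; lra.
have [r r0 h] := near_neg SY cY oY k0 lt.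
exists r => //; apply: neg_sub h; near=> u => w [t nt [ut le]]; exists t => //.
by rewrite /Y; lra.
Unshelve. all: by end_near. Qed.

Lemma high_neg e : 0 < e -> neg (fun u => [set w | (1 + e) * u <= Z ts w]).
Proof.
move=> e0; have k0 : 0 < 1 + e by rewrite addr_gt0.
have lt : cov P (Z ts) (Z ts) < (1 + e) ^+ 2 * s2.
  rewrite ltr_pMl// exprn_egt1//; lra.
have [r r0 h] := near_neg SZ cZ oZ k0 lt.
apply: neg_sub h; near=> u => w le; exists ts => //; split => //.
by rewrite subrr normr0 ltW.
Unshelve. all: by end_near. Qed.

(** Regression coefficient of the second derivative at [ts] on [Z ts]; the residual [Dv] below is
    uncorrelated with [Z ts]. *)
Let rho i j := cov P (Z ts) (Z2 i j ts) / s2.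

(** A large residual of either sign pushes Z(ts) + la (Z2 - rho Z(ts)), or the same with -la, above
    (1 - e) u + la de u = (1 + e) u. At [ts] the variance of this field is only s2 + la^2 c: the
    cost is quadratic in e, the gain in the threshold linear, so small e works. *)
Lemma hess_neg de : 0 < de -> exists2 e0, 0 < e0 & forall e, 0 < e <= e0 ->
  exists2 r, 0 < r & neg (fun u => [set w | exists ij : 'I_N * 'I_N,
    exists2 t, near_box r t &
      0 < u /\ (1 - e) * u <= Z ts w /\ de * u < `|Z2 ij.1 ij.2 t w - rho ij.1 ij.2 * Z ts w|]).
Proof.
move=> de0; pose Dv i j w := - rho i j * Z ts w + Z2 i j ts w.
have SDv i j : S (Dv i j) by apply: (gspaceDZ gS); [exact: SZ|exact: SZ2].
pose c i j := cov P (Dv i j) (Dv i j).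
have c0 i j : 0 <= c i j by exact: (cov_ge0 gS).
pose C := 1 + \sum_i \sum_j c i j.
have S0 : 0 <= \sum_i \sum_j c i j by apply: sumr_ge0 => i _; exact: sumr_ge0.
have C0 : 0 < C by rewrite ltr_pwDl.
have cC i j : c i j <= C by exact: le_double_sum.
exists (de ^+ 2 * s2 / (4 * C)); first by rewrite divr_gt0 ?mulr_gt0 ?exprn_gt0.
move=> e /andP[e0 ele].
have k0 : 0 < 1 + e by rewrite addr_gt0.
(* la de = 2 e lifts 1 - e to 1 + e; the bound on e makes la^2 c at most e s2, below the gain (1 +
   e)^2 - 1 times s2. *)
pose la := 2 * e / de; have la0 : 0 < la by rewrite divr_gt0// mulr_gt0.
apply: (neg_near_family (A := fun ij r u => [set w | exists2 t, near_box r t &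
      0 < u /\ (1 - e) * u <= Z ts w /\ de * u < `|Z2 ij.1 ij.2 t w - rho ij.1 ij.2 * Z ts w|])).
  move=> j r r' u rr w [t [bt tr] h]; exists t => //.
  by split => //; exact: le_trans rr.
move=> [i j] /=.
pose Y (s : R) t w := s * la * Z2 i j t w + ((1 - s * la * rho i j) * Z ts w + 0 * Z ts w).
have HY s : s ^+ 2 = 1 -> exists2 r, 0 < r & neg (fun u => [set w | exists2 t, near_box r t & (1 + e) * u <= Y s t w]).
  move=> s1; apply: near_neg => //.
  - move=> t bt; apply: (gspaceDZ gS); first exact: SZ2.
    by apply: (gspaceDZ gS); [exact: SZ|apply: (gspaceZ gS); exact: SZ].
  - by move=> w; apply: continuous_linear => //; exact: continuous_cst_row.
  - by apply: osc_linear => //; exact: osc_const.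
  have -> : cov P (Y s ts) (Y s ts) = la ^+ 2 * c i j + s2.
    have SS := gspaceZ gS (s * la) (SDv i j).
    have -> : cov P (Y s ts) (Y s ts) =
        cov P (fun w => s * la * Dv i j w + Z ts w) (fun w => s * la * Dv i j w + Z ts w).
      by apply: eq_Rintegral => w _; rewrite /Y /Dv; ring.
    have cD0 : cov P (Dv i j) (Z ts) = 0.
      rewrite /Dv (covDl gS) ?(covZl gS) //; try exact: SZ; try exact: SZ2; try (apply: (gspaceZ gS); exact: SZ).
      by rewrite (covC P (Z2 i j ts)) -/s2 /rho mulNr divfK ?gt_eqF// addNr.
    rewrite (covDD gS SS (SZ bts)) (covZl gS _ (SDv i j) SS) (covC _ (Dv i j)) !(covZl gS _ (SDv i j))//; last exact: SZ.
    rewrite cD0 !mulr0 addr0 mulrA -expr2 exprMn s1 mul1r; congr (_ + _).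
  have : la ^+ 2 * c i j <= e * s2.
    have -> : la ^+ 2 = 4 * e ^+ 2 / de ^+ 2 by rewrite /la; field; rewrite gt_eqF.
    apply: (@le_trans _ _ (4 * e ^+ 2 / de ^+ 2 * C)).
      apply: ler_wpM2l; last exact: cC.
      by rewrite divr_ge0 ?sqr_ge0// mulr_ge0 ?sqr_ge0.
    move: ele; rewrite ler_pdivlMr ?mulr_gt0// => ele.
    rewrite mulrAC ler_pdivrMr ?exprn_gt0//.
    have -> : 4 * e ^+ 2 * C = e * (e * (4 * C)) by ring.
    have -> : e * s2 * de ^+ 2 = e * (de ^+ 2 * s2) by ring.
    by rewrite ler_wpM2l// ltW.
  have : 0 < e * s2 by rewrite mulr_gt0.
  have : 0 < e ^+ 2 * s2 by rewrite mulr_gt0// exprn_gt0.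
  by move: (la ^+ 2 * c i j) => x; lra.
have [r1 r10 h1] := HY 1 (expr1n _ _).
have [r2 r20 h2] := HY (-1) (sqrr_sign _ 1).
exists (Num.min r1 r2); first by rewrite lt_min r10.
apply: neg_sub (negU h1 h2); near=> u => w [t [bt]]; rewrite le_min => /andP[n1 n2] [u0 [xu]].
have E : 2 * e * u = la * (de * u) by rewrite /la; field; rewrite gt_eqF.
rewrite ltr_normr => /orP[]; rewrite -(ltr_pM2l la0) -E => h; [left|right]; exists t => //; rewrite /Y; lra.
Unshelve. all: by end_near. Qed.

(** Since Z(ts) also exceeds (1 + e) u only negligibly often, it may be replaced by u in the
    regression; e is small enough for this to cost at most half of [de]. *)
Lemma hess_good de : 0 < de -> exists e, 0 < e < 1 /\ exists2 r, 0 < r &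
  neg (fun u => [set w | 0 < u /\ (1 - e) * u <= Z ts w /\ exists ij : 'I_N * 'I_N,
    exists2 t, near_box r t & de * u < `|Z2 ij.1 ij.2 t w - rho ij.1 ij.2 * u|]).
Proof.
move=> de0; have de2 : 0 < de / 2 by rewrite divr_gt0.
have [e0 e00 he] := hess_neg de2.
pose C := 1 + \sum_i \sum_j `|rho i j|.
have C0 : 0 < C by rewrite ltr_pwDl// sumr_ge0// => i _; exact: sumr_ge0.
have rC i j : `|rho i j| <= C by apply: (le_double_sum (c := fun i j => `|rho i j|)).
pose e := Num.min (Num.min e0 (1 / 2)) (de / (2 * C)).
have ep : 0 < e by rewrite !lt_min e00 !divr_gt0// mulr_gt0.
have e1 : e < 1 by rewrite (@le_lt_trans _ _ (1 / 2))//; [rewrite /e !ge_min lexx !orbT|lra].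
have ee0 : 0 < e <= e0 by rewrite ep !ge_min lexx.
have eC : e * C <= de / 2.
  apply: (@le_trans _ _ (de / (2 * C) * C)); first by apply: ler_wpM2r; [exact: ltW|rewrite /e ge_min lexx orbT].
  by rewrite le_eqVlt; apply/orP; left; apply/eqP; field; rewrite gt_eqF.
exists e; split; first by rewrite ep.
have [r r0 h] := he e ee0; exists r => //.
apply: neg_sub (negU h (high_neg ep)); near=> u => w [u0 [xl [[i j] [t nt lt]]]].
have [xh|xh] := leP ((1 + e) * u) (Z ts w); first by right.
left; exists (i, j); exists t => //; split => //; split => //.
rewrite ltNge; apply/negP => le; move: lt; apply/negP; rewrite -leNgt /=.
have -> : Z2 i j t w - rho i j * u = (Z2 i j t w - rho i j * Z ts w) + rho i j * (Z ts w - u) by ring.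
apply: (le_trans (ler_normD _ _)); rewrite normrM.
have : `|Z ts w - u| <= e * u by rewrite ler_norml; apply/andP; split; lra.
move=> k; have : `|rho i j| * `|Z ts w - u| <= C * (e * u) by rewrite ler_pM.
have : C * (e * u) <= de / 2 * u by rewrite mulrA (mulrC C) ler_wpM2r// ltW.
by move: le => /=; lra.
Unshelve. all: by end_near. Qed.


Let ev (i : 'I_#|tau|) : 'I_N := enum_val i.
Let G (i : 'I_#|tau|) : T -> R := Z1 (ev i) ts.

(** A_ij = - s2 rho_ij, so - (s2/u) M is entrywise within s2 de of [A], and [form_perturb]
    applies. *)
Lemma face_hessian_bound (de C u : R) (M : 'M[R]_#|tau|) : 0 < u -> 0 < de ->
  (forall v : 'rV[R]_#|tau|, (\sum_i `|v 0 i|) ^+ 2 <= C * (v *m A *m v^T) 0 0) ->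
  (forall i j, `|M i j - rho (ev i) (ev j) * u| <= de * u) ->
  forall v : 'rV[R]_#|tau|, `|(v *m M *m v^T) 0 0 + u / s2 * (v *m A *m v^T) 0 0| <=
    u / s2 * (s2 * de * C) * (v *m A *m v^T) 0 0.
Proof.
move=> u0 de0 hC hM v.
pose M' := - (s2 / u) *: M.
have us : 0 < u / s2 by rewrite divr_gt0.
have hM' i j : `|M' i j - A i j| <= s2 * de.
  have -> : M' i j - A i j = - (s2 / u) * (M i j - rho (ev i) (ev j) * u).
    rewrite [M' i j]mxE [A i j]mxE /rho /ev; field.
    by rewrite !gt_eqF.
  rewrite normrM normrN (gtr0_norm (divr_gt0 s20 u0)).
  apply: (@le_trans _ _ (s2 / u * (de * u))); first by apply: ler_wpM2l; [rewrite ltW// divr_gt0|exact: hM].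
  by rewrite le_eqVlt; apply/orP; left; apply/eqP; field; rewrite gt_eqF.
have := form_perturb (ltW (mulr_gt0 s20 de0)) (hC v) hM'.
have -> : (v *m M' *m v^T) 0 0 = - (s2 / u) * (v *m M *m v^T) 0 0.
  by rewrite /M' -scalemxAr -scalemxAl mxE.
move: ((v *m M *m v^T) 0 0) ((v *m A *m v^T) 0 0) => x y h.
have -> : x + u / s2 * y = - (u / s2) * (- (s2 / u) * x - y) by field; rewrite !gt_eqF.
rewrite normrM normrN (gtr0_norm us) -[leRHS]mulrA; apply: ler_wpM2l; [exact: ltW|exact: h].
Qed.

Let Q w := quad (invmx A) G w.

Let QE w : Q w = ((\row_i G i w) *m invmx A *m (\row_i G i w)^T) 0 0.
Proof. by rewrite quadE; apply: eq_bigr => i _; apply: eq_bigr => j _; rewrite !mxE. Qed.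

Lemma near_box_segment r t xi : near_box r t -> 0 <= xi <= 1 -> near_box r (ts + xi *: (t - ts)).
Proof.
move=> [bt tr] xi01; split; first exact: box_convex.
rewrite addrC addKr normrZ; case/andP: xi01 => x0 x1.
by rewrite ger0_norm// (le_trans (ler_piMl _ x1)).
Qed.

(** Otherwise moving coordinate j of [t] towards that of [ts] stays in the neighbourhood, which is a
    product set as the norm is the sup norm, and raises Z because the inward derivative is
    negative. *)
Lemma max_on_face r t w : near_box r t -> (forall s, near_box r s -> Z s w <= Z t w) ->
  (forall j, j \notin tau -> sgn j * Z1 j t w < 0) -> forall j, j \notin tau -> t 0 j = ts 0 j.
Proof.
move=> [bt tr] tmax hg j jt; apply/eqP; rewrite -subr_eq0; apply: contraT => ne.
have s0 := sgn0 jt.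
have lt : 0 < sgn j * (t 0 j - ts 0 j) by rewrite lt_def mulf_neq0//= sgn_box.
pose h0 := (t 0 j - ts 0 j) / sgn j.
have h00 : 0 < h0.
  have -> : h0 = sgn j * (t 0 j - ts 0 j) / sgn j ^+ 2 by rewrite /h0; field.
  by rewrite divr_gt0// exprn_even_gt0.
have hE : t 0 j - ts 0 j = h0 * sgn j by rewrite /h0 divfK.
have := @partial_sign R N (fun s => Z s w) t j (- sgn j) h0 (C2_C1 (CZ w)) h00.
rewrite oppr_eq0 s0 => /(_ isT).
have /[swap]/[apply] : forall h, 0 < h <= h0 -> Z (t + (h * - sgn j) *: Defs.basis j) w <= Z t w.
  move=> h /andP[hp hh]; apply: tmax.
  pose th := h / h0.
  have th0 : 0 <= th by rewrite divr_ge0// ltW.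
  have th1 : th <= 1 by rewrite ler_pdivrMr// mul1r.
  have cj : t 0 j + h * - sgn j = t 0 j + th * (ts 0 j - t 0 j).
    have -> : ts 0 j - t 0 j = - (h0 * sgn j) by rewrite -hE opprB.
    by rewrite /th; field; rewrite gt_eqF.
  split.
    move=> i; rewrite !mxE eqxx/=; case: (eqVneq i j) => [->|_].
      rewrite mulr1 cj; have /andP[? ?] := bt j; have /andP[? ?] := bts j.
      by apply/andP; split; nra.
    by rewrite mulr0 addr0; exact: bt.
  apply: norm_le_coord; first exact: le_trans tr.
  move=> i; rewrite !mxE eqxx/=; have ti := norm_coord (t - ts) i.
  rewrite !mxE in ti; case: (eqVneq i j) => [->|_].
    rewrite mulr1 cj.
    have -> : t 0 j + th * (ts 0 j - t 0 j) - ts 0 j = (1 - th) * (t 0 j - ts 0 j) by ring.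
    rewrite normrM ger0_norm ?subr_ge0//.
    have := norm_coord (t - ts) j; rewrite !mxE => /le_trans/(_ tr).
    by apply: le_trans; rewrite ler_piMl// gerBl.
  by rewrite mulr0 addr0 (le_trans ti).
by rewrite mulNr oppr_le0 leNgt hg.
Qed.

(** Off negligible events the maximiser near [ts] lies on the face, and the Hessian on the segment
    to it is at most - (1 - e)(u/s2) A as a form. Taylor's formula at [ts] and completion of the
    square bound Z at the maximiser by the quadratic model. *)
Lemma upper_excursion (e : R) : 0 < e < 1 -> neg (fun u => [set w |
  (exists2 t, box a b t & u <= Z t w) /\ Z ts w + s2 / (2 * u * (1 - e)) * Q w < u]).
Proof.
move=> /andP[e0 e1]; have [C C0 hC] := posdef_l1_bound Ap.
(* Chosen so that the relative error s2 de C of [face_hessian_bound] is e. *)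
pose de := e / (C * s2); have de0 : 0 < de by rewrite divr_gt0// mulr_gt0.
have [e' [/andP[e'0 e'1] [r1 r10 h1]]] := hess_good de0.
have [r2 r20 h2] := grad_neg.
have [r3 r30 h3] := low_neg e'0.
pose r := Num.min r1 (Num.min r2 r3).
have r0 : 0 < r by rewrite !lt_min r10 r20.
have nr r' t : r <= r' -> near_box r t -> near_box r' t.
  by move=> rr [bt tr]; split => //; exact: le_trans rr.
have rr1 : r <= r1 by rewrite ge_min lexx.
have rr2 : r <= r2 by rewrite !ge_min lexx orbT.
have rr3 : r <= r3 by rewrite !ge_min lexx !orbT.
apply: neg_sub (negU (far_neg r0) (negU h1 (negU h2 h3))).
near=> u => w [[t0 bt0 ut0] lt].
have u0 : 0 < u by near: u; exact: nbhs_pinfty_gt.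
apply: contrapT => /not_orP[nfar /not_orP[nhess /not_orP[ngrad nlow]]].
have n0 : near_box r t0.
  split => //; rewrite leNgt; apply/negP => l; apply: nfar; exists t0 => //.
  by split => //; exact: ltW.
have ne : near_box r !=set0 by exists t0.
have cK : {within near_box r, continuous (fun t => Z t w)} by apply: continuous_subspaceT; exact: cZ.
have [t /set_mem nt tmax] := EVT_max_rV ne (@ball_box_compact _ _ a b ts r r0) cK.
have {}tmax s : near_box r s -> Z s w <= Z t w by move=> ns; apply: tmax; exact: mem_set.
have ut : u <= Z t w by exact: le_trans (tmax _ n0).
have xl : (1 - e') * u < Z ts w.
  by rewrite ltNge; apply/negP => l; apply: nlow; exists t => //; exact: nr nt.
have hg j : j \notin tau -> sgn j * Z1 j t w < 0.
  move=> jt; rewrite ltNge; apply/negP => l; apply: ngrad; exists j; split => //.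
  by exists t => //; exact: nr nt.
have tf := max_on_face nt tmax hg.
have v0 j : j \notin tau -> (t - ts) 0 j = 0 by move=> /tf; rewrite !mxE => ->; rewrite subrr.
have [xi xi01] := face_taylor ts (CZ w) v0.
set v := \row_k _; set g := \row_k _; set M := \matrix_(i, j) _; rewrite addrC subrK => ZE.
have np := near_box_segment nt xi01.
have hM i j : `|M i j - rho (ev i) (ev j) * u| <= de * u.
  rewrite mxE leNgt; apply/negP => l; apply: nhess; split => //; split; first exact: ltW.
  by exists (ev i, ev j); exists (ts + xi *: (t - ts)) => //; exact: nr np.
have := face_hessian_bound u0 de0 hC hM v.
have -> : s2 * de * C = e by rewrite /de; field; rewrite !gt_eqF.
rewrite ler_norml => /andP[_ hb].
pose m := u / s2 * (1 - e).
have m0 : 0 < m by rewrite mulr_gt0 ?divr_gt0// subr_gt0.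
have sq := posdef_complete_square v g Ap m0.
move: lt; apply/negP; rewrite -leNgt.
have -> : s2 / (2 * u * (1 - e)) * Q w = (g *m invmx A *m g^T) 0 0 / (2 * m).
  by rewrite QE /m; field; rewrite !gt_eqF// subr_gt0.
apply: (le_trans ut); rewrite ZE -addrA lerD2l; apply: le_trans sq.
rewrite lerD2l; move: hb; rewrite /m; move: ((v *m M *m v^T) 0 0) ((v *m A *m v^T) 0 0) (u / s2) => x y z; lra.
Unshelve. all: by end_near. Qed.

Let Y i w := \sum_j G j w * invmx A j i.

(** The point ts + m^-1 A^-1 G, extended by 0 off the face and with m = (1 + e) u/s2, is tested. It
    maximises the lower quadratic bound, so Z there is at least the model value, provided it is near
    [ts] and Z(ts) >= (1 - e') u; smallness of [Y] ensures both. *)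
Lemma lower_excursion (e : R) : 0 < e < 1 -> exists2 k, 0 < k & neg (fun u => [set w |
  [/\ u <= Z ts w + s2 / (2 * u * (1 + e)) * Q w, forall i, `|Y i w| <= k * u &
      ~ exists2 t, box a b t & u <= Z t w]]).
Proof.
move=> /andP[e0 e1]; have [C C0 hC] := posdef_l1_bound Ap.
pose de := e / (C * s2); have de0 : 0 < de by rewrite divr_gt0// mulr_gt0.
have [e' [/andP[e'0 e'1] [r1 r10 h1]]] := hess_good de0.
(* Distance from [ts] to the ends of the free sides, capped by the radius [r1]; it is positive
   because the face is relatively open. *)
pose q := \big[Num.min/r1]_(i | i \in tau) Num.min (ts 0 i - a 0 i) (b 0 i - ts 0 i).
have q0 : 0 < q.
  apply: lt_bigmin => // i /ts_tau/andP[h k].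
  by rewrite lt_min !subr_gt0 h k.
have qr : q <= r1 by exact: bigmin_le_id.
have qt i : i \in tau -> q <= ts 0 i - a 0 i /\ q <= b 0 i - ts 0 i.
  move=> it; have : q <= Num.min (ts 0 i - a 0 i) (b 0 i - ts 0 i) by exact: bigmin_le_cond.
  by rewrite le_min => /andP.
pose B := 1 + \sum_i \sum_j `|A i j|.
have B0 : 0 < B by rewrite ltr_pwDl// sumr_ge0// => i _; exact: sumr_ge0.
(* k s2 <= q keeps the tested point in the neighbourhood; k B s2 <= 2 e' with k <= 1 makes the
   quadratic term at most e' u, whence the lower bound on Z(ts). *)
pose k := Num.min (Num.min 1 (q / s2)) (2 * e' / (B * s2)).
have k0 : 0 < k by rewrite !lt_min ltr01 !divr_gt0// mulr_gt0.
have k1 : k <= 1 by rewrite !ge_min lexx.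
have kq : k * s2 <= q by rewrite -ler_pdivlMr// !ge_min lexx orbT.
have kB : k * (B * s2) <= 2 * e' by rewrite -ler_pdivlMr ?mulr_gt0// !ge_min lexx orbT.
exists k => //; apply: neg_sub h1; near=> u => w [ux Yk nex].
have u0 : 0 < u by near: u; exact: nbhs_pinfty_gt.
apply: contrapT => nhess; apply: nex.
pose g : 'rV[R]_#|tau| := \row_i G i w.
pose y := g *m invmx A.
have yE i : y 0 i = Y i w by rewrite mxE; apply: eq_bigr => j _; rewrite mxE.
pose m := u / s2 * (1 + e).
have m0 : 0 < m by rewrite mulr_gt0 ?divr_gt0// addr_gt0.
pose v := m^-1 *: y.
have vk i : `|v 0 i| <= q.
  apply: le_trans kq; rewrite mxE normrM yE gtr0_norm ?invr_gt0//.
  rewrite mulrC ler_pdivrMr//; apply: (le_trans (Yk i)).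
  rewrite -mulrA ler_wpM2l ?(ltW k0)// /m mulrA [s2 * _]mulrC divfK ?gt_eqF//.
  by rewrite ler_peMr ?(ltW u0)// lerDl ltW.
pose t := ts + face_vec v.
have fv j : `|face_vec v 0 j| <= q.
  have [jt|jt] := boolP (j \in tau).
    by rewrite -(enum_rankK_in jt jt) face_vecE.
  by rewrite face_vec0// normr0 ltW.
have nt : near_box r1 t.
  split.
    move=> j; have -> : t 0 j = ts 0 j + face_vec v 0 j by rewrite [LHS]mxE.
    have [jt|jt] := boolP (j \in tau); last by rewrite face_vec0// addr0; exact: bts.
    have [h2 h3] := qt j jt; have := fv j; rewrite ler_norml => /andP[h4 h5].
    by apply/andP; split; lra.
  rewrite /t addrC addKr; apply: norm_le_coord; first exact: ltW.
  by move=> j; exact: le_trans (fv j) qr.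
have v0 j : j \notin tau -> (t - ts) 0 j = 0 by move=> jt; rewrite /t addrC addKr face_vec0.
have [xi xi01] := face_taylor ts (CZ w) v0.
have -> : \row_k (t - ts) 0 (enum_val k) = v by apply/rowP => i; rewrite mxE /t addrC addKr face_vecE.
have -> : \row_k partial (Z^~ w) (enum_val k) ts = g by apply/rowP => i; rewrite !mxE.
set M := \matrix_(i, j) _; rewrite addrC subrK => ZE.
have np := near_box_segment nt xi01.
have yAy : (y *m A *m y^T) 0 0 = Q w.
  have uA := posdef_unit Ap.
  by rewrite QE /y mulmxKV// trmx_mul trmx_inv Ap.1 mulmxA.
have Qle : Q w <= k ^+ 2 * u ^+ 2 * B.
  rewrite -yAy quadE /B mulrDr mulr1 mulr_sumr.
  apply: (@le_trans _ _ (\sum_i k ^+ 2 * u ^+ 2 * \sum_j `|A i j|)); last first.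
    by rewrite lerDr mulr_ge0 ?sqr_ge0.
  apply: ler_sum => i _; rewrite mulr_sumr; apply: ler_sum => j _.
  apply: (le_trans (ler_norm _)); rewrite normrM mulrC ler_wpM2r// normrM.
  have -> : k ^+ 2 * u ^+ 2 = k * u * (k * u) by ring.
  by rewrite ler_pM// yE.
have xl : (1 - e') * u <= Z ts w.
  have : s2 / (2 * u * (1 + e)) * Q w <= e' * u.
    have -> : s2 / (2 * u * (1 + e)) * Q w = Q w * s2 / (2 * u * (1 + e)) by ring.
    rewrite ler_pdivrMr ?mulr_gt0 ?addr_gt0//.
    apply: (@le_trans _ _ (k ^+ 2 * u ^+ 2 * B * s2)); first by apply: ler_wpM2r; [exact: ltW|].
    have -> : k ^+ 2 * u ^+ 2 * B * s2 = k * (k * (B * s2)) * u ^+ 2 by ring.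
    have : k * (k * (B * s2)) <= 2 * e'.
      apply: le_trans kB; rewrite ler_piMl// ltW// !mulr_gt0//.
    move=> h; apply: (@le_trans _ _ (2 * e' * u ^+ 2)); first by rewrite ler_wpM2r// sqr_ge0.
    have : 0 <= e * e' * u ^+ 2 by rewrite !mulr_ge0 ?sqr_ge0// ltW.
    lra.
  lra.
have hM i j : `|M i j - rho (ev i) (ev j) * u| <= de * u.
  rewrite mxE leNgt; apply/negP => l; apply: nhess; split => //; split => //.
  by exists (ev i, ev j); exists (ts + xi *: (t - ts)).
have := face_hessian_bound u0 de0 hC hM v.
have -> : s2 * de * C = e by rewrite /de; field; rewrite !gt_eqF.
rewrite ler_norml => /andP[hb _].
have /= sq := complete_square_eq g Ap m0; rewrite -/y -/v in sq.
exists t; first by case: nt.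
apply: (le_trans ux).
have -> : s2 / (2 * u * (1 + e)) * Q w = (g *m invmx A *m g^T) 0 0 / (2 * m).
  by rewrite QE /m; field; rewrite !gt_eqF// addr_gt0.
rewrite ZE -addrA lerD2l -sq lerD2l; move: hb; rewrite /m.
move: ((v *m M *m v^T) 0 0) ((v *m A *m v^T) 0 0) (u / s2) => x z zz; lra.
Unshelve. all: by end_near. Qed.

End Excursion.

(** * Asymptotics of the quadratic model *)

Section DetPerturbation.
Context {R : realType} {n : nat} (A La : 'M[R]_n).
Hypothesis Ap : posdef A.
Hypothesis Lp : posdef La.
Hypothesis ALp : posdef (A - La).

(** Exhibits the determinant as a polynomial in c, which yields its continuity. *)
Lemma det_pencilE (c : R) : \det (A - c *: La) =
  (\det (map_mx polyC A - 'X *: map_mx polyC La)).[c].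
Proof.
rewrite -horner_evalE -det_map_mx; congr (\det _).
apply/matrixP => i j; rewrite !mxE /= /horner_eval; by rewrite !hornerE.
Qed.

(** The form of [La] is at most B C times that of A - La, so a perturbation (c - 1) La with |c - 1|
    < 1/(B C) keeps positivity. *)
Lemma posdef_pencil : exists2 d, 0 < d & forall c, `|c - 1| < d -> posdef (A - c *: La).
Proof.
have [C C0 hC] := posdef_l1_bound ALp.
pose B := 1 + \sum_i \sum_j `|La i j|.
have B0 : 0 < B by rewrite ltr_pwDl// sumr_ge0// => i _; exact: sumr_ge0.
exists (B * C)^-1; first by rewrite invr_gt0 mulr_gt0.
move=> c cd; split.
  by rewrite linearB/= linearZ/= Ap.1 Lp.1.
move=> v v0.
have -> : A - c *: La = (A - La) - (c - 1) *: La by rewrite scalerBl scale1r opprB addrA subrK.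
have e : (v *m ((A - La) - (c - 1) *: La) *m v^T) 0 0 =
    (v *m (A - La) *m v^T) 0 0 - (c - 1) * (v *m La *m v^T) 0 0.
  rewrite mulmxBr mulmxBl -scalemxAr -scalemxAl.
  by move: (v *m (A - La) *m v^T) (v *m La *m v^T) => M1 M2; rewrite !mxE.
rewrite e.
have p := ALp.2 v v0; have p2 := Lp.2 v v0.
have le : (v *m La *m v^T) 0 0 <= B * (\sum_i `|v 0 i|) ^+ 2.
  rewrite quadE; apply: (@le_trans _ _ (\sum_i \sum_j B * (`|v 0 i| * `|v 0 j|))).
    apply: ler_sum => i _; apply: ler_sum => j _; apply: (le_trans (ler_norm _)).
    rewrite !normrM ler_wpM2r ?mulr_ge0//.
    apply: (@le_trans _ _ (\sum_j `|La i j|)).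
      by rewrite (bigD1 j)//= lerDl sumr_ge0.
    apply: (@le_trans _ _ (\sum_i \sum_j `|La i j|)); last by rewrite lerDr.
    by rewrite [leRHS](bigD1 i)//= lerDl sumr_ge0// => k _; exact: sumr_ge0.
  rewrite expr2 mulr_suml mulr_sumr le_eqVlt; apply/orP; left; apply/eqP.
  by apply: eq_bigr => i _; rewrite !mulr_sumr.
have {}le : (v *m La *m v^T) 0 0 <= B * (C * (v *m (A - La) *m v^T) 0 0).
  by apply: (le_trans le); rewrite ler_wpM2l// ltW.
move: le p p2 cd; move: ((v *m La *m v^T) 0 0) ((v *m (A - La) *m v^T) 0 0) => x y le y0 x0.
rewrite ltr_norml => /andP[_ cd]; rewrite subr_gt0.
have [c1|c1] := leP (c - 1) 0; first by apply: le_lt_trans y0; rewrite mulr_le0_ge0// ltW.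
have h : (c - 1) * x <= (c - 1) * (B * (C * y)) by rewrite ler_pM2l.
apply: (le_lt_trans h); rewrite !mulrA -[ltRHS]mul1r ltr_pM2r//.
by move: cd; rewrite -[(B * C)^-1]div1r ltr_pdivlMr ?mulr_gt0// mulrA.
Qed.

Lemma det_ratio_continuous (e : R) : 0 < e -> exists2 d, 0 < d & forall c, `|c - 1| < d ->
  posdef (A - c *: La) /\
  `|Num.sqrt (\det A / \det (A - c *: La)) - Num.sqrt (\det A / \det (A - La))| <= e.
Proof.
move=> e0; have [d d0 hd] := posdef_pencil.
pose p := \det (map_mx polyC A - 'X *: map_mx polyC La).
have A1 : A - 1 *: La = A - La by rewrite scale1r.
have pc : p.[c] @[c --> (1 : R)] --> p.[1] by exact: continuous_horner.
have p1 : p.[1] != 0 by rewrite -det_pencilE A1 gt_eqF// posdef_det.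
have cv : Num.sqrt (\det A / p.[c]) @[c --> (1 : R)] --> Num.sqrt (\det A / p.[1]).
  apply: continuous_cvg; first exact: sqrt_continuous.
  by apply: cvgM; [exact: cvg_cst|exact: cvgV].
have /cvgrPdist_le/(_ e e0)/nbhs_ballP[d' /= d'0 h] := cv.
exists (Num.min d d'); first by rewrite lt_min d0.
move=> c; rewrite lt_min => /andP[c1 c2]; split; first exact: hd.
have := h c; rewrite -ball_normE/= distrC => /(_ c2).
by rewrite -!det_pencilE A1 distrC.
Qed.

End DetPerturbation.

(** * Passage from the quadratic model to the limit *)

Section Asymptotics.
Context {d} {T : measurableType d} {R : realType} (P : probability T R).
Variable S : set (T -> R).
Hypothesis gS : gspace P S.
Variable X0 : T -> R.
Hypothesis SX : S X0.
Let s2 := cov P X0 X0.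
Hypothesis s20 : 0 < s2.
Let s := Num.sqrt s2.
Variables (E : R -> set T) (exc : R -> R).
(** [exc] is constrained only by measurable sets containing or contained in [E u]. It will be the
    completed probability for the original field, whose excursion agrees with [E u] off a null
    set. *)
Hypothesis excU : forall u F, measurable F -> E u `<=` F -> exc u <= fine (P F).
Hypothesis excL : forall u F, measurable F -> F `<=` E u -> fine (P F) <= exc u.

Let sgt0 : 0 < s. Proof. by rewrite sqrtr_gt0. Qed.
Let ss : s ^+ 2 = s2. Proof. by rewrite sqr_sqrtr// ltW. Qed.
Let V w := s^-1 * X0 w.
Let SV : S V. Proof. exact: (gspaceZ gS). Qed.
Let V1 : cov P V V = 1.
Proof.
rewrite (covZl gS)// covC (covZl gS)// -/s2 -ss; field.
by rewrite gt_eqF.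
Qed.

Lemma fineP_U (F1 F2 : set T) : measurable F1 -> measurable F2 ->
  fine (P (F1 `|` F2)) <= fine (P F1) + fine (P F2).
Proof.
move=> m1 m2; rewrite -fineD; try exact: fin_num_measure.
by apply: fine_le; rewrite ?fin_numD ?fin_num_measure//; [exact: measurableU|exact: measureU2].
Qed.

Lemma fineP_D (F1 F2 : set T) : measurable F1 -> measurable F2 ->
  fine (P F1) <= fine (P (F1 `\` F2)) + fine (P F2).
Proof.
move=> m1 m2; apply: le_trans (fineP_U (measurableD m1 m2) m2).
have mU := measurableU _ _ (measurableD m1 m2) m2.
apply: fine_le; [exact: fin_num_measure|exact: fin_num_measure|].
apply: le_measure; rewrite ?inE//.
by move=> w F1w; have [|] := pselect (F2 w); [right|left].
Qed.

Lemma tail_scale_small (al e : R) : 0 < al -> 0 < e -> \forall u \near +oo,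
  tail_scale (u / s) * expR (- (((2 * s2)^-1 + al) * u ^+ 2)) <= e.
Proof.
move=> al0 e0; pose p : R := normal_peak 1.
have p0 : 0 < p by rewrite normal_peak_gt0// oner_neq0.
near=> u.
have u1 : 1 <= u by near: u; apply: nbhs_pinfty_ge; exact: num_real.
have u0 : 0 < u by exact: lt_le_trans u1.
have ub : (s * p * al * e)^-1 <= u by near: u; apply: nbhs_pinfty_ge; exact: num_real.
have -> : tail_scale (u / s) * expR (- (((2 * s2)^-1 + al) * u ^+ 2)) =
    u / (s * p) * expR (- (al * u ^+ 2)).
  have -> : - (((2 * s2)^-1 + al) * u ^+ 2) = - ((u / s) ^+ 2 / 2) + - (al * u ^+ 2).
    by rewrite -ss; field; rewrite gt_eqF.
  rewrite expRD (expRN ((u / s) ^+ 2 / 2)) /tail_scale -/p.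
  have := expR_gt0 ((u / s) ^+ 2 / 2); move: (expR ((u / s) ^+ 2 / 2)) (expR _) => x y x0.
  by field; rewrite !gt_eqF.
rewrite expRN ler_pdivrMr ?expR_gt0//.
have h : al * u ^+ 2 <= expR (al * u ^+ 2) by apply: le_trans (expR_ge1Dx _); rewrite lerDr.
apply: (@le_trans _ _ (e * (al * u ^+ 2))); last by rewrite ler_wpM2l// ltW.
rewrite ler_pdivrMr ?mulr_gt0//.
have k0 : 0 < s * p * al * e by rewrite !mulr_gt0.
have : 1 <= u * (s * p * al * e) by rewrite -ler_pdivrMr// div1r.
move=> h2; have -> : e * (al * u ^+ 2) * (s * p) = u * (u * (s * p * al * e)) by ring.
by rewrite ler_peMr// ltW.
Unshelve. all: by end_near. Qed.

(** Mills ratio, obtained as the case q = 0 of the rescaled tail: bounded by 1 and monotone with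
    limit 1. *)
Lemma tail_scale_Psi : tail_scale (u / s) * Psi (u / s) @[u --> +oo] --> (1 : R).
Proof.
apply/cvgrPdist_le => e e0.
have H x : 0 < x -> ((tail_scale x * Psi x)%:E = tail_integral x 0)%E.
  by move=> x0; rewrite -(tail_integralE 0 x0) mul0r subr0 PsiE -EFinM.
have [n hn] : exists n, ((1 - e)%:E <= tail_integral n.+1%:R (0 : R))%E.
  have lt : ((1 - e)%:E < (expR (0 / 2) : R)%:E)%E by rewrite mul0r expR0 lte_fin ltrBlDr ltrDl.
  have /(@tail_integral_cvg R 0)[n _ /(_ n (leqnn n)) h] : nbhs (expR (0 / 2) : R)%:E [set y | (1 - e)%:E < y]%E.
    by apply: open_nbhs_nbhs; split; [exact: open_ereal_gt_ereal|].
  by exists n; exact/ltW.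
near=> u.
have un : s * n.+1%:R <= u by near: u; apply: nbhs_pinfty_ge; exact: num_real.
have xn : n.+1%:R <= u / s by rewrite ler_pdivlMr// mulrC.
have n0 : 0 < n.+1%:R :> R by rewrite ltr0n.
have x0 : 0 < u / s by exact: lt_le_trans xn.
have h1 := tail_integral_le 0 x0; rewrite mul0r expR0 -H// lee_fin in h1.
have h2 := le_trans hn (tail_integral_homo 0 n0 xn); rewrite -H// lee_fin in h2.
by rewrite ler_norml; apply/andP; split; lra.
Unshelve. all: by end_near. Qed.

Lemma P_tail_Psi u : 0 < u -> fine (P [set w | u <= X0 w]) = Psi (u / s).
Proof.
move=> u0; have -> : [set w | u <= X0 w] = V @^-1` `[u / s, +oo[%classic.
  have e w : (u / s <= V w) = (u <= X0 w) by rewrite /V [s^-1 * _]mulrC ler_pM2r ?invr_gt0.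
  by apply/seteqP; split => w /=; rewrite in_itv/= andbT e.
rewrite (cgauss_law (gspace_cgauss gS SV))// V1 sqrtr1.
rewrite (_ : _ @^-1` _ = `[u / s, +oo[%classic) ?PsiE//.
by apply/seteqP; split => x /=; rewrite mul1r.
Qed.

Variables (k : nat) (G : 'I_k -> T -> R) (A La : 'M[R]_k).
Hypothesis SG : forall i, S (G i).
Hypothesis XG : forall i, cov P X0 (G i) = 0.
Hypothesis cG : forall i j, cov P (G i) (G j) = La i j.
Hypothesis Ap : posdef A.
Hypothesis Lp : posdef La.
Hypothesis ALp : posdef (A - La).
Let Q w := quad (invmx A) G w.
Hypothesis hU : forall e, 0 < e < 1 -> neg P s2 (fun u => [set w |
  E u w /\ X0 w + s2 / (2 * u * (1 - e)) * Q w < u]).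
Hypothesis hL : forall e, 0 < e < 1 -> exists2 c, 0 < c & neg P s2 (fun u => [set w |
  [/\ u <= X0 w + s2 / (2 * u * (1 + e)) * Q w,
      forall i, `|\sum_j G j w * invmx A j i| <= c * u & ~ E u w]]).
Let D1 := Num.sqrt (\det A / \det (A - La)).

Let UG i : uncorr P S V (G i).
Proof. by split; [exact: SG|rewrite covC (covC P _ V) (covZl gS)// XG mulr0]. Qed.

Let mG i : measurable_fun setT (G i : cylType (uncorr P S V) -> R).
Proof. exact: measurable_cyl. Qed.

Let mcQ (c : R) : measurable_fun setT ((fun w => c * Q w) : cylType (uncorr P S V) -> R).
Proof. by apply: measurable_funM => //; exact: measurable_quad. Qed.

(** Sandwich between the tails of V + c Q/(2x) with c = 1/(1 - h) above and c = 1/(1 + h) below,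
    where x = u/s. The error e is shared between the determinant ratio, the negligible event and, in
    the lower bound, [tail_prob_ge]. *)
Lemma excursion_limit : tail_scale (u / s) * exc u @[u --> +oo] --> D1.
Proof.
apply/cvgrPdist_le => e e0; have e30 : 0 < e / 3 by rewrite divr_gt0.
have [dl dl0 hdl] := det_ratio_continuous Ap Lp ALp e30.
(* h/(1 - h) <= 2h <= dl/2, so both constants 1/(1 - h) and 1/(1 + h) are within [dl] of 1. *)
pose h := Num.min (1 / 2) (dl / 4).
have h0 : 0 < h by rewrite lt_min !divr_gt0.
have h1 : h <= 1 / 2 by rewrite ge_min lexx.
have hd : h <= dl / 4 by rewrite ge_min lexx orbT.
have h01 : 0 < h < 1 by rewrite h0/=; lra.
pose cu := (1 - h)^-1; pose cl := (1 + h)^-1.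
have p1 : 0 < 1 - h by lra.
have p2 : 0 < 1 + h by lra.
have cu0 : 0 < cu by rewrite invr_gt0.
have cl0 : 0 < cl by rewrite invr_gt0.
have dlh : dl * h <= dl * (1 / 2) by rewrite ler_pM2l.
have cud : `|cu - 1| < dl.
  have -> : cu - 1 = h / (1 - h) by rewrite /cu; field; rewrite gt_eqF.
  rewrite gtr0_norm ?divr_gt0// ltr_pdivrMr//; lra.
have cld : `|cl - 1| < dl.
  have -> : cl - 1 = - (h / (1 + h)) by rewrite /cl; field; rewrite gt_eqF.
  rewrite normrN gtr0_norm ?divr_gt0// ltr_pdivrMr//.
  have : 0 < dl * h by rewrite mulr_gt0.
  lra.
have [ApU DU] := hdl _ cud; have [ApL DL] := hdl _ cld.
have IU := integral_quad gS SG cG cu0 Ap Lp ApU.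
have IL := integral_quad gS SG cG cl0 Ap Lp ApL.
have [al al0 [u1 nU]] := hU h01.
have [c c0 [be be0 [u2 nL]]] := hL h01.
(* At x = u/s the bound is c u, the restriction in [hL]. These sets depend on [G] alone, increase
   with x and exhaust the space, as [tail_prob_ge] requires. *)
pose Ev (x : R) : set (cylType (uncorr P S V)) :=
  [set w | forall i, `|\sum_j G j w * invmx A j i| <= c * s * x].
have mEv x : measurable (Ev x).
  have -> : Ev x = \big[setI/setT]_(i < k) [set w : cylType (uncorr P S V) | `|\sum_j G j w * invmx A j i| <= c * s * x].
    apply/seteqP; split => w.
      by move=> hw; rewrite -bigcap_seq => i _; exact: hw.
    by rewrite -bigcap_seq => hw i; apply: hw; rewrite /= mem_index_enum.
  apply: bigsetI_measurable => i _.
  have mf : measurable_fun setT (fun w : cylType (uncorr P S V) => `|\sum_j G j w * invmx A j i|).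
    apply: measurableT_comp => //; apply: measurable_sum => j.
    by apply: measurable_funM.
  rewrite (_ : [set w | _] = (fun w : cylType (uncorr P S V) => `|\sum_j G j w * invmx A j i|) @^-1` `]-oo, (c * s * x)%R]%classic).
    exact: measurable_preimageT.
  by apply/seteqP; split => w /=; rewrite in_itv.
have cs0 : 0 < c * s by rewrite mulr_gt0.
have hEv x y : x <= y -> Ev x `<=` Ev y.
  by move=> xy w hw i; apply: (le_trans (hw i)); rewrite ler_pM2l.
have cEv w : exists x, Ev x w.
  exists ((\sum_i `|\sum_j G j w * invmx A j i|) / (c * s)) => i.
  rewrite [leRHS]mulrC divfK ?gt_eqF// [leRHS](bigD1 i)//= lerDl sumr_ge0//.
have [x0 x00 tge] := tail_prob_ge gS SV V1 (mcQ cl) IL e30 mEv hEv cEv.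
near=> u.
have u0 : 0 < u by near: u; exact: nbhs_pinfty_gt.
have us0 : 0 < u / s by rewrite divr_gt0.
have tp : 0 < tail_scale (u / s) by exact: tail_scale_gt0.
have smU : tail_scale (u / s) * expR (- (((2 * s2)^-1 + al) * u ^+ 2)) <= e / 3.
  by near: u; exact: tail_scale_small.
have smL : tail_scale (u / s) * expR (- (((2 * s2)^-1 + be) * u ^+ 2)) <= e / 3.
  by near: u; exact: tail_scale_small.
have [FU [mFU PFU EFU]] : exists F : set T, [/\ measurable F,
    (P F <= (expR (- (((2 * s2)^-1 + al) * u ^+ 2)))%:E)%E &
    [set w | E u w /\ X0 w + s2 / (2 * u * (1 - h)) * Q w < u] `<=` F].
  by apply: nU; near: u; apply: nbhs_pinfty_ge; exact: num_real.
have [FL [mFL PFL EFL]] : exists F : set T, [/\ measurable F,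
    (P F <= (expR (- (((2 * s2)^-1 + be) * u ^+ 2)))%:E)%E &
    [set w | [/\ u <= X0 w + s2 / (2 * u * (1 + h)) * Q w,
      forall i, `|\sum_j G j w * invmx A j i| <= c * u & ~ E u w]] `<=` F].
  by apply: nL; near: u; apply: nbhs_pinfty_ge; exact: num_real.
have ux : x0 <= u / s.
  by rewrite ler_pdivlMr//; near: u; apply: nbhs_pinfty_ge; exact: num_real.
have QE (f w : R) : 0 < f -> s * (f^-1 * w / (2 * (u / s))) = s2 / (2 * u * f) * w.
  by move=> f0; rewrite -ss; field; rewrite !gt_eqF.
have eqv (f : R) w : 0 < f -> (u / s <= V w + f^-1 * Q w / (2 * (u / s))) = (u <= X0 w + s2 / (2 * u * f) * Q w).
  move=> f0; rewrite -(QE _ _ f0) /V.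
  have su : s * (u / s) = u by rewrite mulrC divfK// gt_eqF.
  have e1 (x B : R) : s * (s^-1 * x + B) = x + s * B by rewrite mulrDr mulrA mulfV ?gt_eqF// mul1r.
  by rewrite -(ler_pM2l sgt0 (u / s)) su e1.
pose F1 := [set w | u / s <= V w + cu * Q w / (2 * (u / s))].
pose F2 := [set w | u / s <= V w + cl * Q w / (2 * (u / s))].
have mF1 : measurable F1 := measurable_tail_prob gS SV V1 (mcQ cu) us0.
have mF2 : measurable F2 := measurable_tail_prob gS SV V1 (mcQ cl) us0.
have mEvT : measurable (Ev (u / s) : set T).
  by have := measurable_cyl_id (uncorr_measurable gS (V := V)) measurableT (mEv (u / s)); rewrite setTI.
have up : exc u <= fine (P F1) + expR (- (((2 * s2)^-1 + al) * u ^+ 2)).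
  apply: (@le_trans _ _ (fine (P (F1 `|` FU)))).
    apply: excU; first exact: measurableU.
    move=> w Ew; have [l|l] := leP u (X0 w + s2 / (2 * u * (1 - h)) * Q w).
      by left; rewrite /F1/= /cu eqv.
    by right; apply: EFU.
  apply: (le_trans (fineP_U mF1 mFU)); rewrite lerD2l.
  by rewrite -lee_fin fineK//; exact: fin_num_measure.
have lo : fine (P (F2 `&` Ev (u / s))) - expR (- (((2 * s2)^-1 + be) * u ^+ 2)) <= exc u.
  have mI : measurable (F2 `&` Ev (u / s) : set T) by exact: measurableI.
  rewrite lerBlDr; apply: (le_trans (fineP_D mI mFL)); apply: lerD.
    apply: excL; first exact: measurableD.
    move=> w [[w1 w2] nF]; apply: contrapT => nE; apply: nF; apply: EFL; split => //.
      by rewrite -eqv.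
    move=> i; apply: (le_trans (w2 i)).
    by rewrite -mulrA [s * _]mulrC divfK// gt_eqF.
  by rewrite -lee_fin fineK//; exact: fin_num_measure.
have tU : tail_scale (u / s) * fine (P F1) <= Num.sqrt (\det A / \det (A - cu *: La)).
  have := tail_prob_le gS SV V1 (mcQ cu) IU us0.
  by rewrite -[P _]fineK ?fin_num_measure// -EFinM lee_fin.
have tL : Num.sqrt (\det A / \det (A - cl *: La)) - e / 3 <= tail_scale (u / s) * fine (P (F2 `&` Ev (u / s))).
  have hP : ((Num.sqrt (\det A / \det (A - cl *: La)) - e / 3)%:E <=
    (tail_scale (u / s))%:E * P (F2 `&` Ev (u / s)%R))%E by exact: (tge _ ux).
  have mI : measurable (F2 `&` Ev (u / s) : set T) by exact: measurableI.
  have fE : P (F2 `&` Ev (u / s)) = (fine (P (F2 `&` Ev (u / s))))%:E.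
    by rewrite fineK//; exact: fin_num_measure.
  by rewrite fE -EFinM lee_fin in hP.
move: DU DL; rewrite -/D1 !ler_norml => /andP[_ dU] /andP[dL _].
rewrite -(ler_pM2l tp) mulrDr in up; rewrite -(ler_pM2l tp) mulrBr in lo.
by apply/andP; split; lra.
Unshelve. all: by end_near. Qed.

End Asymptotics.

(** * Variance and derivatives of the field *)

Section GramMatrix.
Context {d} {T : measurableType d} {R : realType} (P : probability T R).
Variable S : set (T -> R).
Hypothesis gS : gspace P S.

Lemma cov_null U Y : S U -> S Y -> cov P U U = 0 -> cov P U Y = 0.
Proof.
move=> SU SY U0; apply/eqP; apply: contraT => c0.
(* With Var U = 0 this multiplier would make the variance of la U + Y equal to -1. *)
pose c := cov P U Y; pose la := - (1 + cov P Y Y) / (2 * c).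
have SL := gspaceZ gS la SU.
have := cov_ge0 gS (gspaceD gS SL SY); rewrite (covDD gS SL SY) (covZl gS _ SU SL) (covC _ U).
rewrite !(covZl gS _ SU)// U0 -/c !mulr0 add0r.
have -> : 2 * (la * c) = - (1 + cov P Y Y) by rewrite /la; field.
lra.
Qed.

(** A combination of the selected variables with variance 0 is uncorrelated with every [Y p], so its
    coefficients, spread over all indices, lie in the kernel of the full Gram matrix. *)
Lemma gram_posdef m k (Y : 'I_m -> T -> R) (f : 'I_k -> 'I_m) :
  (forall p, S (Y p)) -> injective f ->
  (\matrix_(p, q) cov P (Y p) (Y q)) \in unitmx ->
  posdef (\matrix_(i, j) cov P (Y (f i)) (Y (f j))).
Proof.
move=> SY fI uM; set M := \matrix_(p, q) _ in uM; set L := \matrix_(i, j) _.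
split; first by apply/matrixP => i j; rewrite !mxE covC.
move=> v v0; pose U w := \sum_i v 0 i * Y (f i) w.
have SvY i : S (fun w => v 0 i * Y (f i) w) by exact: (gspaceZ gS).
have SU : S U by apply: (gspace_sum gS) => i _.
have UY Z : S Z -> cov P U Z = \sum_i v 0 i * cov P (Y (f i)) Z.
  by move=> SZ; rewrite (cov_suml gS)//; apply: eq_bigr => i _; rewrite (covZl gS).
have E : (v *m L *m v^T) 0 0 = cov P U U.
  rewrite quadE UY//; apply: eq_bigr => i _; rewrite covC UY// mulr_sumr.
  by apply: eq_bigr => j _; rewrite !mxE covC; ring.
rewrite E lt_def (cov_ge0 gS SU) andbT; apply: contra v0 => /eqP U0.
pose c : 'rV[R]_m := \row_p \sum_i v 0 i * (p == f i)%:R.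
have cM : c *m M = 0.
  apply/rowP => q; transitivity (cov P U (Y q)); last by rewrite mxE cov_null.
  rewrite UY// mxE.
  transitivity (\sum_p \sum_i v 0 i * (p == f i)%:R * cov P (Y p) (Y q)).
    by apply: eq_bigr => p _; rewrite !mxE mulr_suml.
  rewrite exchange_big/=; apply: eq_bigr => i _.
  rewrite (bigD1 (f i))//= eqxx mulr1 big1 ?addr0// => p /negbTE ->.
  by rewrite mulr0 mul0r.
have c0 : c = 0 by rewrite -(mulmxK uM c) cM mul0mx.
apply/eqP/rowP => i; have := congr1 (fun c : 'rV[R]_m => c 0 (f i)) c0; rewrite !mxE.
rewrite (bigD1 i)//= eqxx mulr1 big1 ?addr0// => j ji.
by rewrite (inj_eq fI) eq_sym (negbTE ji) mulr0.
Qed.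

End GramMatrix.

Section Completion.
Context {d} {T : measurableType d} {R : realType} (P : probability T R).
Variable N0 : set T.
Hypothesis mN : measurable N0.
Hypothesis PN : P N0 = 0%E.

Lemma mu_ext_fin (A : set T) : mu_ext P A \is a fin_num.
Proof.
rewrite ge0_fin_numE ?mu_ext_ge0//; apply: (@le_lt_trans _ _ (mu_ext P setT)).
  exact: le_mu_ext.
rewrite measurable_mu_extE//; exact: (le_lt_trans (probability_le1 P measurableT) (ltry 1)).
Qed.

Lemma Prob_le (A F : set T) : measurable F -> A `<=` N0 `|` F -> Prob P A <= fine (P F).
Proof.
move=> mF AF; apply: fine_le; [exact: mu_ext_fin|exact: fin_num_measure|].
apply: (le_trans (le_mu_ext P AF)); rewrite measurable_mu_extE; last exact: measurableU.
have h : (P (N0 `|` F) <= P N0 + P F)%E by exact: measureU2.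
by move: h; rewrite PN add0e.
Qed.

Lemma Prob_ge (A F : set T) : measurable F -> F `<=` N0 `|` A -> fine (P F) <= Prob P A.
Proof.
move=> mF FA; apply: fine_le; [exact: fin_num_measure|exact: mu_ext_fin|].
have e : mu_ext P F = P F by exact: measurable_mu_extE.
have e0 : (mu_ext P N0 = 0)%E by rewrite measurable_mu_extE.
have h : (mu_ext P (N0 `|` A) <= mu_ext P N0 + mu_ext P A)%E by exact: outer_measureU2.
rewrite e0 add0e in h.
by rewrite -e; exact: le_trans (le_mu_ext P FA) h.
Qed.

Lemma covariance_cov (Y Z : T -> R) : ('E_P[Y] = 0)%E -> ('E_P[Z] = 0)%E ->
  fine (covariance P Y Z) = cov P Y Z.
Proof.
move=> EY EZ; rewrite unlock EY EZ.
have e (F : T -> R) : (F \- cst (fine (0%E : \bar R))) = F by apply/funext => w /=; rewrite subr0.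
by rewrite !e unlock.
Qed.

Lemma null_eq_mean (S : set (T -> R)) (Y Z : T -> R) : gspace P S -> S Z ->
  (forall w, ~ N0 w -> Y w = Z w) -> ('E_P[Y] = 0)%E.
Proof.
move=> gS SZ YZ; rewrite unlock (integral_null_eq mN PN (g := EFin \o Z)); last first.
  by move=> w Nw /=; rewrite YZ.
have [i0 e0] := cgauss_mean (gspace_cgauss gS SZ).
rewrite -[LHS]fineK; last exact: integrable_fin_num.
by move: e0; rewrite /Rintegral => ->.
Qed.

End Completion.

Section ScaleNorm.
Context {R : realType} {N : nat}.

Lemma euclidean_norm_le (t : 'rV[R]_N) : euclidean_norm t <= \sum_i `|t 0 i|.
Proof.
have s0 : 0 <= \sum_i `|t 0 i| by exact: sumr_ge0.
rewrite /euclidean_norm -[leRHS](ger0_norm s0) -sqrtr_sqr ler_wsqrtr// expr2 mulr_suml.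
apply: ler_sum => i _; rewrite -(real_normK (num_real _)) expr2 ler_wpM2l//.
by rewrite (bigD1 i)//= lerDl sumr_ge0.
Qed.

Lemma euclidean_scale (a b : 'rV[R]_N) (C delta : R) : (forall i, a 0 i < b 0 i) -> 0 < C -> 0 < delta ->
  exists2 l, 0 < l & exists2 K, 0 < K & forall n (t : 'rV[R]_N),
    (forall i, `|t 0 i| <= (b 0 i - a 0 i) / 2 ^+ n) ->
    C * euclidean_norm t `^ (2 * delta) <= K * expR (- (4 * l * n%:R)).
Proof.
move=> hab C0 d0; pose D := 1 + \sum_i (b 0 i - a 0 i).
have D0 : 0 < D by rewrite ltr_pwDl// sumr_ge0// => i _; rewrite subr_ge0 ltW.
have l2 : 0 < ln 2 :> R by rewrite ln_gt0// ltr1n.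
(* 4 l n = 2 delta n ln 2, so exp(-4 l n) is the power 2 delta of the mesh 2^-n. *)
exists (delta * ln 2 / 2); first by rewrite divr_gt0 ?mulr_gt0.
exists (C * D `^ (2 * delta)); first by rewrite mulr_gt0// powR_gt0.
move=> n t ht.
have e2 : 0 < 2 ^- n :> R by rewrite invr_gt0 exprn_gt0.
have le : euclidean_norm t <= D * 2 ^- n.
  apply: (le_trans (euclidean_norm_le t)); rewrite /D mulrDl mulr_suml.
  apply: (@le_trans _ _ (\sum_(i < N) (b 0 i - a 0 i) * 2 ^- n)); first by apply: ler_sum => i _; exact: ht.
  by rewrite lerDr mul1r ltW.
rewrite -[leRHS]mulrA; apply: ler_wpM2l; first exact: ltW.
have -> : expR (- (4 * (delta * ln 2 / 2) * n%:R)) = (2 ^- n) `^ (2 * delta) :> R.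
  rewrite /powR gt_eqF// lnV ?posrE ?exprn_gt0// lnXn//; congr expR.
  by rewrite -[ln 2 *+ n]mulr_natr; field.
have e3 : D `^ (2 * delta) * (2 ^- n) `^ (2 * delta) = (D * 2 ^- n) `^ (2 * delta) by rewrite powRM// ltW.
rewrite e3; apply: ge0_ler_powR => //.
- by rewrite mulr_ge0 ?ltW.
- by rewrite nnegrE sqrtr_ge0.
- by rewrite nnegrE mulr_ge0 ?ltW.
Qed.

Lemma C2_cst0 : C2 (fun _ : 'rV[R]_N => 0 : R).
Proof.
have p0 i : partial (fun _ : 'rV[R]_N => 0 : R) i = (fun=> 0).
  by apply/funext => t; rewrite /partial derive_cst.
split => [|i|i j]; first exact: cst_continuous.
- by split => [t|]; [exact: derivable_cst|rewrite p0; exact: cst_continuous].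
- rewrite /partial2 p0; split => [t|]; first exact: derivable_cst.
  by rewrite p0; exact: cst_continuous.
Qed.

End ScaleNorm.

(** * A version of the field with all paths C2, its covariances and its variance function *)

Section Reduction.
Context {R : realType} {d : measure_display} {Om : measurableType d}.
Variables (P : probability Om R) (N : nat) (a b : 'rV[R]_N).
Hypothesis hN : (0 < N)%N.
Hypothesis hab : forall i, a 0 i < b 0 i.
Variable X : 'rV[R]_N -> Om -> R.
Hypothesis hX : centered_gaussian_field P (box a b) X.
Hypothesis H1 : smooth_on P X (box a b).
Hypothesis H2 : regular_on P X (box a b).
Variable N0 : set Om.
Hypothesis mN : measurable N0.
Hypothesis PN : P N0 = 0%E.
Hypothesis hC2 : forall w, ~ N0 w -> C2 (fun s => X s w).

(** The exceptional paths become 0, which is C2, so that regularity holds for every w and all limits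
    of difference quotients hold everywhere. *)
Definition good_version t := kill_on N0 (X t).
Let Z := good_version.
Let Z1 i t w := partial (fun s => Z s w) i t.
Let Z2 i j t w := partial2 (fun s => Z s w) i j t.
Let S0 := combos X (box a b) N0.
Let S := glim (glim S0).
Let gS0 : gspace P S0. Proof. exact: gspace_combos. Qed.
Let gS1 : gspace P (glim S0). Proof. exact: gspace_glim. Qed.

Lemma gspace_version : gspace P S. Proof. exact: gspace_glim. Qed.
Let gS := gspace_version.

Let pathE w : ~ N0 w -> (fun s => Z s w) = (fun s => X s w).
Proof. by move=> Nw; apply/funext => t; rewrite /Z /good_version kill_onE. Qed.

Lemma version_E t w : ~ N0 w -> X t w = Z t w.
Proof. by move=> Nw; rewrite /Z /good_version kill_onE. Qed.

Lemma version1_E i t w : ~ N0 w -> Xd X i t w = Z1 i t w.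
Proof. by move=> Nw; rewrite /Xd /Z1 pathE. Qed.

Lemma version2_E i j t w : ~ N0 w -> Xdd X i j t w = Z2 i j t w.
Proof. by move=> Nw; rewrite /Xdd /Z2 pathE. Qed.

Lemma version_C2 w : C2 (fun s => Z s w).
Proof.
have [Nw|Nw] := pselect (N0 w); last by rewrite pathE//; exact: hC2.
rewrite (_ : (fun s => Z s w) = fun=> 0); first exact: C2_cst0.
by apply/funext => t; rewrite /Z /good_version /kill_on asboolT.
Qed.
Let CZ := version_C2.

Let dZ i w t : derivable (fun s => Z s w) t (Defs.basis i).
Proof. exact: (C2_C1 (CZ w) i).1. Qed.

Let dZ1 i j w t : derivable (fun s => Z1 j s w) t (Defs.basis i).
Proof. exact: (C2_partial_C1 j (CZ w) i).1. Qed.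

Let cZ w : continuous (fun t => Z t w). Proof. by case: (CZ w). Qed.
Let cZ1 i w : continuous (fun t => Z1 i t w). Proof. by case: (CZ w) => _ h _; case: (h i). Qed.
Let cZ2 i j w : continuous (fun t => Z2 i j t w). Proof. by case: (CZ w) => _ _ h; case: (h i j). Qed.

Let S0Z t : box a b t -> S0 (Z t). Proof. exact: kill_on_combos. Qed.

Let S1Z1 i t : box a b t -> glim S0 (Z1 i t).
Proof. by move=> bt; exact: (partial_glim gS0 hab S0Z (@dZ i) bt). Qed.

Lemma version_mem t : box a b t -> S (Z t).
Proof. by move=> bt; do 2!apply: sub_glim; exact: S0Z. Qed.

Lemma version1_mem i t : box a b t -> S (Z1 i t).
Proof. by move=> bt; apply: sub_glim; exact: S1Z1. Qed.

Lemma version2_mem i j t : box a b t -> S (Z2 i j t).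
Proof. by move=> bt; exact: (partial_glim gS1 hab (@S1Z1 j) (@dZ1 i j) bt). Qed.

Let SZ := version_mem.
Let SZ1 := version1_mem.
Let SZ2 := version2_mem.

(** The Hoelder condition becomes the geometric decay of increment variances required by chaining.
    The expectation in the hypothesis is that of the original second derivatives, equal to those of
    the version off the null set. *)
Lemma version2_osc i j : osc P a b (Z2 i j).
Proof.
have [_ [C [delta [C0 delta0 hC]]]] := H1.
have [l l0 [K K0 hK]] := euclidean_scale hab C0 delta0.
apply: (chaining_osc gS hab (@SZ2 i j) (@cZ2 i j) l0 K0) => n t s bt bs ts.
apply: le_trans (hK n (t - s) _); last by move=> k; rewrite !mxE; exact: ts.
have SD := gspaceB gS (SZ2 i j bt) (SZ2 i j bs).
have := hC t s bt bs i j.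
suff -> : ('E_P[(fun w => (Xdd X i j t w - Xdd X i j s w) ^+ 2)%R] = (vincr P (Z2 i j) t s)%:E)%E.
  by rewrite lee_fin.
rewrite unlock (integral_null_eq mN PN (g := EFin \o (fun w => (Z2 i j t w - Z2 i j s w) ^+ 2))).
  have i2 := gspace_sqr_integrable gS SD.
  by rewrite -[LHS]fineK//; exact: integrable_fin_num.
by move=> w Nw /=; rewrite !version2_E.
Qed.

Lemma version1_osc j : osc P a b (Z1 j).
Proof.
apply: (osc_grad gS hab (fun i t bt => SZ2 i j bt) (fun i => version2_osc i j)).
move=> w t s C bt bs hC.
exact: (C1_lipschitz (C2_partial_C1 j (CZ w)) bt bs hC).
Qed.

Lemma version_osc : osc P a b Z.
Proof.
apply: (osc_grad gS hab SZ1 version1_osc) => w t s C bt bs hC.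
exact: (C1_lipschitz (C2_C1 (CZ w)) bt bs hC).
Qed.

Lemma nu_cov t : box a b t -> nu P X t = cov P (Z t) (Z t).
Proof.
move=> bt; have EX := hX.2 t bt.
rewrite /nu (covariance_cov EX EX); apply: (cov_null_eq mN PN) => w Nw; exact: version_E.
Qed.

Lemma partial_nu i t : box a b t -> partial_in (box a b) (nu P X) i t = 2 * cov P (Z t) (Z1 i t).
Proof.
move=> bt; rewrite (partial_in_eq i bt nu_cov).
rewrite (partial_in_cov gS hab SZ SZ (@dZ i) (@dZ i) cZ (@SZ1 i) (@SZ1 i) bt).
by rewrite (covC _ _ (Z t)) -mulr2n mulr_natl.
Qed.

Lemma partial2_nu i j t : box a b t -> partial2_in (box a b) (nu P X) i j t =
  2 * (cov P (Z1 i t) (Z1 j t) + cov P (Z t) (Z2 i j t)).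
Proof.
move=> bt; pose A t w := 2 * Z t w.
have SA s : box a b s -> S (A s) by move=> bs; apply: (gspaceZ gS); exact: SZ.
have pA s w : partial (fun s => A s w) i s = 2 * Z1 i s w by exact: (@deriveZ R _ _ (fun s => Z s w) 2 s _ (@dZ i w s)).
have dA w s : derivable (fun s => A s w) s (Defs.basis i) by exact: (@derivableZ R _ _ (fun s => Z s w) 2 s _ (@dZ i w s)).
have SAi s : box a b s -> S (fun w => partial (fun s => A s w) i s).
  move=> bs; rewrite (_ : (fun w => _) = fun w => 2 * Z1 i s w); last by apply/funext => w; rewrite pA.
  by apply: (gspaceZ gS); exact: SZ1.
rewrite /partial2_in (@partial_in_eq _ _ _ _ _ (fun t => cov P (A t) (Z1 j t)) i t bt); last first.
  by move=> s bs; rewrite partial_nu// (covZl gS) ?SZ ?SZ1//; [exact: SZ|exact: SZ1].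
rewrite (partial_in_cov gS hab SA (@SZ1 j) dA (@dZ1 i j) (@cZ1 j) SAi (@SZ2 i j) bt).
rewrite mulrDr; congr (_ + _); last first.
  by rewrite (covZl gS)//; [exact: SZ|exact: SZ2].
rewrite -(covZl gS) //; [|exact: SZ1|exact: SZ1].
by apply: eq_Rintegral => w _; rewrite pA.
Qed.

Lemma Sigma_cov (tau : {set 'I_N}) t : Sigma_mx P X tau t =
  \matrix_(i, j) cov P (Z t) (Z2 (enum_val i) (enum_val j) t).
Proof.
apply/matrixP => i j; rewrite !mxE unlock.
apply: (cov_null_eq mN PN (Y := X t) (Z := Xdd X _ _ t)) => w Nw.
  exact: version_E.
exact: version2_E.
Qed.

Lemma Lambda_cov (tau : {set 'I_N}) t : Lambda_mx P X tau t =
  \matrix_(i, j) cov P (Z1 (enum_val i) t) (Z1 (enum_val j) t).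
Proof.
apply/matrixP => i j; rewrite !mxE unlock.
apply: (cov_null_eq mN PN (Y := Xd X _ t) (Z := Xd X _ t)) => w Nw; exact: version1_E.
Qed.

(** The entries of the jets are only known up to the null set; this is the form in which they are
    compared with elements of [S]. *)
Let ok (Y : Om -> R) := exists2 Y', S Y' & forall w, ~ N0 w -> Y w = Y' w.

Let ok_map (I : Type) (r : seq I) (F : I -> Om -> R) : (forall i, ok (F i)) ->
  forall n, ok (nth (cst 0) (map F r) n).
Proof.
move=> okF; elim: r => [|i r IH] [|n] //=; exists (fun=> 0) => //; exact: (gspace0 gS).
Qed.

Let ok_cat r1 r2 : (forall n, ok (nth (cst 0) r1 n)) -> (forall n, ok (nth (cst 0) r2 n)) ->
  forall n, ok (nth (cst 0) (r1 ++ r2) n).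
Proof. by move=> h1 h2 n; rewrite nth_cat; case: ifP. Qed.

Let ok_jet2 t : box a b t -> forall n, ok (nth (cst 0) (jet2 X t) n).
Proof.
move=> bt; rewrite /jet2 -cat1s; apply: ok_cat.
  move=> n; have okX : ok (X t) by exists (Z t); [exact: SZ|move=> w; exact: version_E].
  case: n => [|n]//=; rewrite nth_nil; exists (fun=> 0) => //; exact: (gspace0 gS).
apply: ok_cat; apply: ok_map => i.
  by exists (Z1 i t); [exact: SZ1|move=> w; exact: version1_E].
by exists (Z2 i.1 i.2 t); [exact: SZ2|move=> w; exact: version2_E].
Qed.

(** The regularity hypothesis concerns two distinct points, so a second point is taken by a step
    along the first coordinate. The value and the gradient at [t] are a subfamily of the
    nondegenerate jet, and [gram_posdef] applies. *)
Lemma jet_posdef t (tau : {set 'I_N}) : box a b t ->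
  0 < cov P (Z t) (Z t) /\ posdef (Lambda_mx P X tau t).
Proof.
move=> bt; pose i0 := Ordinal hN.
have [s s0 hs] := box_step hab i0 bt.
pose t' := t + (1 * s) *: Defs.basis i0.
have bt' : box a b t' by apply: hs; rewrite ler01 lexx.
have tt' : t != t'.
  apply/eqP => /matrixP/(_ 0 i0); rewrite !mxE !eqxx mul1r mulr1 => /eqP.
  by rewrite -subr_eq0 opprD addNKr oppr_eq0 (negbTE s0).
have uM := H2 bt bt' tt'; rewrite /Defs.nondegenerate in uM.
set J := jet2 X t ++ jet2 X t' in uM.
have okJ (p : 'I_(size J)) : exists Y', S Y' /\ forall w, ~ N0 w -> nth (cst 0) J p w = Y' w.
  by have [Y' SY' e] := ok_cat (ok_jet2 bt) (ok_jet2 bt') p; exists Y'.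
have /choice[Y hY] := okJ.
have EY (p : 'I_(size J)) : expectation P (nth (cst (0 : R)) J p) = 0%E.
  exact: (null_eq_mean mN PN gS (hY p).1 (hY p).2).
have uG : (\matrix_(p, q) cov P (Y p) (Y q)) \in unitmx.
  rewrite (_ : (\matrix_(p, q) _) = covariance_matrix P J)//.
  apply/matrixP => p q; rewrite !mxE covariance_cov//; apply/esym.
  by apply: (cov_null_eq mN PN) => w; exact: (hY _).2.
have sJ : (N < size J)%N.
  rewrite /J size_cat; apply: (leq_trans _ (leq_addr _ _)).
  by rewrite /jet2 /= ltnS size_cat size_map size_enum_ord; exact: leq_addr.
pose p0 : 'I_(size J) := Ordinal (leq_ltn_trans (leq0n N) sJ).
have YX w : ~ N0 w -> Y p0 w = Z t w.
  by move=> Nw; rewrite -(hY p0).2// -version_E.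
(* The index is one more than the coordinate, since position 0 of the jet holds the value of the
   field. *)
pose f (i : 'I_#|tau|) : 'I_(size J) := Ordinal (leq_ltn_trans (ltn_ord (enum_val i)) sJ).
have Yf i w : ~ N0 w -> Y (f i) w = Z1 (enum_val i) t w.
  move=> Nw; rewrite -(hY (f i)).2// -version1_E//.
  rewrite /J /jet2 /= -catA nth_cat size_map size_enum_ord ltn_ord.
  have e := nth_ord_enum (enum_val i) (enum_val i).
  rewrite (nth_map (enum_val i)) ?e//; last by rewrite size_enum_ord; exact: ltn_ord.
split.
  have := posdef_det (@gram_posdef _ _ _ P S gS _ 1 Y (fun=> p0) (fun p => (hY p).1) _ uG).
  rewrite det_mx11 mxE (cov_null_eq mN PN YX YX); apply.
  by move=> i j _; rewrite !ord1.
have fI : injective f.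
  by move=> i j /(congr1 val)/= [] /val_inj/enum_val_inj.
have := gram_posdef gS (fun p => (hY p).1) fI uG; rewrite Lambda_cov.
rewrite (_ : (\matrix_(i, j) cov P (Y (f i)) (Y (f j))) =
  \matrix_(i, j) cov P (Z1 (enum_val i) t) (Z1 (enum_val j) t))//.
by apply/matrixP => i j; rewrite !mxE; apply: (cov_null_eq mN PN); exact: Yf.
Qed.

Lemma excursion_version w u : ~ N0 w -> (exists t, box a b t) ->
  (u%:E <= ereal_sup [set (X t w)%:E | t in box a b])%E <-> exists2 t, box a b t & u <= Z t w.
Proof.
move=> Nw [t0 bt0]; split; last first.
  move=> [t bt ut]; apply: (@le_trans _ _ (X t w)%:E); first by rewrite lee_fin version_E.
  by apply: ereal_sup_ubound; exists t.
have cK : {within box a b, continuous (fun t => Z t w)} by apply: continuous_subspaceT; exact: cZ.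
have ne : box a b !=set0 by exists t0.
have [c /set_mem bc cmax] := EVT_max_rV ne (@box_compact _ _ a b) cK.
move=> h; exists c => //; rewrite -lee_fin; apply: (le_trans h).
apply: ge_ereal_sup => _ [t bt <-]; rewrite lee_fin version_E//; apply: cmax; exact: mem_set.
Qed.

End Reduction.

Lemma detN_ratio (R : realType) n (A B : 'M[R]_n) : \det (- A) / \det (- B) = \det A / \det B.
Proof.
have dN (M : 'M[R]_n) : \det (- M) = (-1) ^+ n * \det M by rewrite -scaleN1r detZ.
have e : (-1) ^+ n != 0 :> R by rewrite signr_eq0.
rewrite !dN; move: (\det A) (\det B) ((-1) ^+ n) e => x y z z0.
by rewrite invfM mulrACA mulfV// mul1r.
Qed.

Lemma negative_definite_posdef (R : realType) n (B : 'M[R]_n) : negative_definite B -> posdef (- B).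
Proof.
move=> [Bs Bn]; split; first by rewrite linearN/= Bs.
move=> v v0; rewrite mulmxN mulNmx mxE oppr_gt0; exact: Bn.
Qed.

Lemma posdefD (R : realType) n (A B : 'M[R]_n) : posdef A -> posdef B -> posdef (A + B).
Proof.
move=> [As Ap] [Bs Bp]; split; first by rewrite linearD/= As Bs.
move=> v v0.
have -> : (v *m (A + B) *m v^T) 0 0 = (v *m A *m v^T) 0 0 + (v *m B *m v^T) 0 0.
  by rewrite mulmxDr mulmxDl mxE.
by rewrite addr_gt0 ?Ap ?Bp.
Qed.

Lemma posdefZ (R : realType) n (A : 'M[R]_n) (c : R) : 0 < c -> posdef A -> posdef (c *: A).
Proof.
move=> c0 [As Ap]; split; first by rewrite linearZ/= As.
by move=> v v0; rewrite -scalemxAr -scalemxAl mxE mulr_gt0// Ap.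
Qed.

Theorem theorem8p3 (R : realType) (d : measure_display) (Om : measurableType d)
    (P : probability Om R) (N : nat) (hN : (0 < N)%N) (a b : 'rV[R]_N)
    (hab : forall i, a 0 i < b 0 i)
    (X : 'rV[R]_N -> Om -> R)
    (hX : centered_gaussian_field P (box a b) X)
    (H1 : smooth_on P X (box a b))
    (H2 : regular_on P X (box a b))
    (k : nat) (tau : {set 'I_N}) (eps : 'I_N -> bool) (htau : #|tau| = k)
    (ts : 'rV[R]_N) (hts : face a b tau eps ts)
    (hmax : nu P X ts = sigma2 P X (box a b))
    (huniq : forall t, box a b t -> nu P X t = sigma2 P X (box a b) -> t = ts)
    (hgrad : forall i, i \notin tau -> partial_in (box a b) (nu P X) i ts != 0)
    (hhess : negative_definite (hess_nu P X (box a b) tau ts)) :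
  (k = 0%N ->
     exists alpha : R, 0 < alpha /\
     exists r : R -> R, r u @[u --> +oo] --> 0 /\
       \forall u \near +oo,
         excursion_prob P X (box a b) u =
         Psi (u / sigma P X (box a b)) +
         r u * expR (- (u ^+ 2 / (2 * sigma2 P X (box a b)))
                     - alpha * u ^+ 2)) /\
  ((1 <= k)%N ->
     exists r : R -> R, r u @[u --> +oo] --> 0 /\
       \forall u \near +oo,
         excursion_prob P X (box a b) u =
         Num.sqrt (\det (Sigma_mx P X tau ts) /
                   \det (Lambda_mx P X tau ts + Sigma_mx P X tau ts)) *
         Psi (u / sigma P X (box a b)) * (1 + r u)).

Proof.
have [aeC2 _] := H1; case: aeC2 => N0 [mN PN sN].
have hC2 w : ~ N0 w -> C2 (fun s => X s w).
  by move=> Nw; apply: contrapT => nC; apply: Nw; apply: sN.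
pose Z := good_version X N0.
pose Z1 i t w := partial (fun s => Z s w) i t.
pose Z2 i j t w := partial2 (fun s => Z s w) i j t.
pose S := glim (glim (combos X (box a b) N0)).
have gS : gspace P S by exact: gspace_version.
have CZ w : C2 (fun s => Z s w) by exact: version_C2.
have SZ t : box a b t -> S (Z t) by exact: version_mem.
have SZ1 i t : box a b t -> S (Z1 i t) by move=> bt; exact: (version1_mem hab hX mN PN hC2 i bt).
have SZ2 i j t : box a b t -> S (Z2 i j t) by move=> bt; exact: (version2_mem hab hX mN PN hC2 i j bt).
have oZ : osc P a b Z by exact: (version_osc hab hX H1 mN PN hC2).
have oZ1 i : osc P a b (Z1 i) by exact: (version1_osc hab hX H1 mN PN hC2).
have oZ2 i j : osc P a b (Z2 i j) by exact: (version2_osc hab hX H1 mN PN hC2).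
have nuE t : box a b t -> nu P X t = cov P (Z t) (Z t) by exact: (nu_cov hX mN PN).
have bts : box a b ts by case: hts.
have [s20 Lp] := jet_posdef hN hab hX H2 mN PN hC2 tau bts.
rewrite -/Z in s20; set s2 := cov P (Z ts) (Z ts) in s20.
have sE : sigma2 P X (box a b) = s2 by rewrite -hmax nuE.
have Vle t : box a b t -> cov P (Z t) (Z t) <= s2.
  move=> bt; rewrite -sE -nuE//; apply: ub_le_sup; last by exists t.
  (* Were the variances unbounded, [sup] would take its default value 0, against s2 > 0. *)
  have [[]//|nsup] := pselect (has_sup [set nu P X t | t in box a b]).
  by move: s20; rewrite -sE /sigma2 sup_out// ltxx.
have Vlt t : box a b t -> t != ts -> cov P (Z t) (Z t) < s2.
  move=> bt /eqP ne; rewrite lt_neqAle Vle// andbT; apply/eqP => e; apply: ne.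
  by apply: huniq => //; rewrite nuE// e sE.
have dirle i (s : R) : s != 0 ->
    (forall h, 0 <= h <= 1 -> box a b (ts + (h * s) *: Defs.basis i)) ->
    s * cov P (Z ts) (Z1 i ts) <= 0.
  move=> s0 hs.
  have dZ w t : derivable (fun s => Z s w) t (Defs.basis i) by exact: (C2_C1 (CZ w) i).1.
  have cZ w : continuous (fun t => Z t w) by case: (CZ w).
  have := cov_direction_le0 gS SZ SZ dZ dZ cZ (SZ1 i) (SZ1 i) bts s0 hs Vle.
  rewrite (covC P _ (Z ts)) -/(Z1 i ts) mulrDr; move: (s * _) => x; lra.
have tsi i : i \in tau -> a 0 i < ts 0 i < b 0 i by case: hts => _ + _; apply.
(* Along a free coordinate both directions are admissible, and the two one-sided inequalities give
   equality: the field at [ts] is uncorrelated with its gradient along the face. *)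
have crit i : i \in tau -> cov P (Z ts) (Z1 i ts) = 0.
  move=> it; have /andP[h1 h2] := tsi i it.
  pose q := Num.min (ts 0 i - a 0 i) (b 0 i - ts 0 i).
  have q0 : 0 < q by rewrite lt_min !subr_gt0 h1 h2.
  have qa : q <= ts 0 i - a 0 i by rewrite ge_min lexx.
  have qb : q <= b 0 i - ts 0 i by rewrite ge_min lexx orbT.
  have hb (s : R) : `|s| <= q -> forall h, 0 <= h <= 1 -> box a b (ts + (h * s) *: Defs.basis i).
    rewrite ler_norml => /andP[sq1 sq2] h /andP[h0 h1'] j; rewrite !mxE eqxx/=.
    case: (eqVneq j i) => [->|_]; last by rewrite mulr0 addr0; exact: bts.
    by rewrite mulr1; apply/andP; split; nra.
  have p1 := dirle i q; have p2 := dirle i (- q).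
  rewrite gt_eqF// in p1; rewrite oppr_eq0 gt_eqF// in p2.
  have k1 : q * cov P (Z ts) (Z1 i ts) <= 0 by apply: p1 => //; apply: hb; rewrite gtr0_norm.
  have k2 : - q * cov P (Z ts) (Z1 i ts) <= 0 by apply: p2 => //; apply: hb; rewrite normrN gtr0_norm.
  rewrite pmulr_rle0// in k1; rewrite mulNr oppr_le0 pmulr_rge0// in k2.
  by apply/eqP; rewrite eq_le k1.
pose sgn (j : 'I_N) : R := if eps j then -1 else 1.
have tsj j : j \notin tau -> ts 0 j = if eps j then b 0 j else a 0 j.
  move=> jt; case: hts => _ _ /(_ j jt) ->; case: (eps j).
    by rewrite subrr mul0r add0r mul1r.
  by rewrite subr0 mul1r mul0r addr0.
have sgn0 j : j \notin tau -> sgn j != 0.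
  by move=> _; rewrite /sgn; case: (eps j); rewrite ?oppr_eq0 oner_eq0.
have sgnb j t : j \notin tau -> box a b t -> 0 <= sgn j * (t 0 j - ts 0 j).
  move=> jt bt; rewrite tsj// /sgn; have /andP[] := bt j; case: (eps j); lra.
(* Maximality gives the weak inequality in the inward direction and [hgrad] excludes equality. *)
have sgnc j : j \notin tau -> sgn j * cov P (Z ts) (Z1 j ts) < 0.
  move=> jt; rewrite lt_neqAle mulf_neq0 ?sgn0//=; last first.
    have := hgrad j jt; rewrite (partial_nu hab hX mN PN hC2)// mulf_eq0 negb_or => /andP[_].
    by [].
  have ba : 0 < b 0 j - a 0 j by rewrite subr_gt0.
  have := dirle j (sgn j * (b 0 j - a 0 j)); rewrite mulf_neq0 ?sgn0 ?gt_eqF// => /(_ isT).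
  rewrite mulrAC pmulr_lle0//; apply => h /andP[h0 h1] i; rewrite !mxE eqxx/=.
  case: (eqVneq i j) => [->|_]; last by rewrite mulr0 addr0; exact: bts.
  rewrite mulr1 tsj// /sgn; case: (eps j); apply/andP; split; nra.
pose A : 'M[R]_#|tau| := \matrix_(i, j) - cov P (Z ts) (Z2 (enum_val i) (enum_val j) ts).
pose La := Lambda_mx P X tau ts; rewrite -/La in Lp.
have SgE : Sigma_mx P X tau ts = - A.
  by rewrite (Sigma_cov X mN PN); apply/matrixP => i j; rewrite !mxE opprK.
have LaE i j : La i j = cov P (Z1 (enum_val i) ts) (Z1 (enum_val j) ts).
  by rewrite /La (Lambda_cov X mN PN) mxE.
(* Differentiating the variance twice gives Hess nu = 2 (Lambda_K + Sigma_K) = - 2 (A - La), so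
   negative definiteness of the Hessian is positivity of A - La. *)
have ALp : posdef (A - La).
  have -> : A - La = 2^-1 *: - hess_nu P X (box a b) tau ts.
    apply/matrixP => i j.
    have eN (M : 'M[R]_#|tau|) : (- M) i j = - M i j by rewrite mxE.
    have eD (M M' : 'M[R]_#|tau|) : (M + M') i j = M i j + M' i j by rewrite mxE.
    have eZ (c : R) (M : 'M[R]_#|tau|) : (c *: M) i j = c * M i j by rewrite mxE.
    have HE : hess_nu P X (box a b) tau ts i j = 2 * (La i j - A i j).
      by rewrite LaE [A i j]mxE opprK mxE (partial2_nu hab hX mN PN hC2).
    by rewrite eD eZ !eN HE; field.
  by apply: posdefZ; [rewrite invr_gt0|exact: negative_definite_posdef].
have Ap : posdef A by have := posdefD ALp Lp; rewrite subrK.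
pose E (u : R) : set Om := [set w | exists2 t, box a b t & u <= Z t w].
pose exc := excursion_prob P X (box a b).
have exE w u : ~ N0 w -> (u%:E <= ereal_sup [set (X t w)%:E | t in box a b])%E <-> E u w.
  by move=> Nw; apply: (excursion_version hC2) => //; exists ts.
have excU u F : measurable F -> E u `<=` F -> exc u <= fine (P F).
  move=> mF EF; apply: (Prob_le mN PN mF) => w /= h.
  have [|Nw] := pselect (N0 w); [by left|right; apply: EF; exact/(exE _ _ Nw)].
have excL u F : measurable F -> F `<=` E u -> fine (P F) <= exc u.
  move=> mF FE; apply: (Prob_ge mN PN mF) => w Fw.
  have [|Nw] := pselect (N0 w); [by left|right; apply/(exE _ _ Nw); exact: FE].
have hU := @upper_excursion _ _ _ P S gS N a b Z CZ SZ SZ1 SZ2 oZ oZ1 oZ2 ts tau bts s20 Vlt sgn sgn0 sgnb sgnc Ap.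
have hL := @lower_excursion _ _ _ P S gS N a b Z CZ SZ SZ2 oZ oZ2 ts tau bts s20 tsi Ap.
have sgE : sigma P X (box a b) = Num.sqrt s2 by rewrite /sigma sE.
rewrite sgE sE; split.
- move=> k0.
  (* On a vertex the quadratic form is an empty sum, so the model event is {Z(ts) >= u}, of
     probability exactly Psi(u/sigma). *)
  have Q0 B (G : 'I_#|tau| -> Om -> R) w : quad B G w = 0.
    apply: big1 => i _; have : (i < k)%N by rewrite -htau; exact: ltn_ord.
    by rewrite k0.
  have h12 : 0 < (2^-1 : R) < 1 by rewrite invr_gt0 invf_lt1// ltr0n ltr1n.
  have [al al0 [u1 hn]] := hU (2^-1 : R) h12.
  (* Half of the gain [al] is the announced exponent; the other half drives the remainder to 0. *)
  exists (al / 2); split; first by rewrite divr_gt0.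
  exists (fun u => (exc u - Psi (u / Num.sqrt s2)) * expR (u ^+ 2 / (2 * s2) + al / 2 * u ^+ 2)); split.
    apply/cvgrPdist_le => e e0; near=> u.
    have u0 : 0 < u by near: u; exact: nbhs_pinfty_gt.
    have u1' : 1 <= u by near: u; exact: nbhs_pinfty_ge.
    have ue : 2 / (al * e) <= u by near: u; apply: nbhs_pinfty_ge; exact: num_real.
    have [F [mF PF EF]] : exists F : set Om, [/\ measurable F,
        (P F <= (expR (- (((2 * s2)^-1 + al) * u ^+ 2)))%:E)%E &
        [set w | (exists2 t, box a b t & u <= Z t w) /\
          Z ts w + s2 / (2 * u * (1 - 2^-1)) * quad (invmx A) (fun i => Z1 (enum_val i) ts) w < u] `<=` F].
      by apply: hn; near: u; apply: nbhs_pinfty_ge; exact: num_real.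
    have mX : measurable [set w | u <= Z ts w].
      rewrite (_ : [set w | _] = Z ts @^-1` `[u, +oo[%classic).
        by rewrite -[X in measurable X]setTI; exact: (gspace_measurable gS (SZ _ bts)).
      by apply/seteqP; split => w /=; rewrite in_itv/= andbT.
    have PsiP := P_tail_Psi gS (SZ _ bts) s20 u0.
    have lo : Psi (u / Num.sqrt s2) <= exc u.
      by rewrite -PsiP; apply: excL => // w uw; exists ts.
    have up : exc u <= Psi (u / Num.sqrt s2) + expR (- (((2 * s2)^-1 + al) * u ^+ 2)).
      apply: (@le_trans _ _ (fine (P ([set w | u <= Z ts w] `|` F)))).
        apply: excU; first exact: measurableU.
        move=> w Ew; have [l|l] := leP u (Z ts w); [by left|right; apply: EF; split => //].
        by rewrite Q0 mulr0 addr0.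
      apply: (le_trans (fineP_U P mX mF)); rewrite PsiP lerD2l.
      by rewrite -lee_fin fineK//; exact: fin_num_measure.
    rewrite sub0r normrN ger0_norm; last by rewrite mulr_ge0 ?expR_ge0// subr_ge0.
    have le1 : exc u - Psi (u / Num.sqrt s2) <= expR (- (((2 * s2)^-1 + al) * u ^+ 2)).
      by rewrite lerBlDl.
    apply: (le_trans (ler_wpM2r (expR_ge0 _) le1)); rewrite -expRD.
    have -> : - (((2 * s2)^-1 + al) * u ^+ 2) + (u ^+ 2 / (2 * s2) + al / 2 * u ^+ 2) = - (al / 2 * u ^+ 2).
      by field; rewrite gt_eqF.
    rewrite expRN -[e]invrK lef_pV2 ?posrE ?expR_gt0 ?invr_gt0//.
    apply: (@le_trans _ _ (al / 2 * u ^+ 2)); last by apply: le_trans (expR_ge1Dx _); rewrite lerDr.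
    have : 2 <= u * (al * e) by rewrite -ler_pdivrMr// mulr_gt0.
    move=> h2; rewrite -[e^-1]mul1r ler_pdivrMr//.
    have : u * (al * e) <= u * (u * (al * e)) by rewrite ler_peMl// !mulr_ge0// ltW.
    by move=> h3; rewrite (_ : al / 2 * u ^+ 2 * e = (u * (u * (al * e))) / 2); [lra|field].
  near=> u; rewrite -/(exc u) -mulrA -expRD.
  have -> : u ^+ 2 / (2 * s2) + al / 2 * u ^+ 2 + (- (u ^+ 2 / (2 * s2)) - al / 2 * u ^+ 2) = 0 by ring.
  by rewrite expR0 mulr1 addrC subrK.
- move=> _; pose D1 := Num.sqrt (\det A / \det (A - La)).
  have D1p : 0 < D1 by rewrite sqrtr_gt0 divr_gt0// posdef_det.
  have -> : Num.sqrt (\det (Sigma_mx P X tau ts) / \det (Lambda_mx P X tau ts + Sigma_mx P X tau ts)) = D1.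
    rewrite SgE -/La; have -> : La - A = - (A - La) by rewrite opprB.
    by rewrite detN_ratio.
  have L1 := excursion_limit gS (SZ _ bts) s20 excU excL (fun i => SZ1 (enum_val i) _ bts)
    (fun i => crit _ (enum_valP i)) (fun i j => esym (LaE i j)) Ap Lp ALp hU hL.
  have L2 := @tail_scale_Psi _ _ _ P (Z ts) s20.
  rewrite -/s2 -/D1 in L1 L2.
  (* The relative error is solved for. Numerator and denominator times [tail_scale] both converge to
     [D1], so it tends to 0. *)
  exists (fun u => exc u / (D1 * Psi (u / Num.sqrt s2)) - 1); split.
    have cv : (tail_scale (u / Num.sqrt s2) * exc u) / (D1 * (tail_scale (u / Num.sqrt s2) * Psi (u / Num.sqrt s2))) - 1
        @[u --> +oo] --> D1 / (D1 * 1) - 1.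
      apply: cvgB; last exact: cvg_cst.
      apply: cvgM; first exact: L1.
      apply: cvgV; first by rewrite mulr1 gt_eqF.
      by apply: cvgM; [exact: cvg_cst|exact: L2].
    rewrite mulr1 mulfV ?gt_eqF// subrr in cv.
    apply: cvg_trans cv; apply: near_eq_cvg; near=> u.
    have u0 : 0 < u by near: u; exact: nbhs_pinfty_gt.
    have t0 : tail_scale (u / Num.sqrt s2) != 0.
      by rewrite gt_eqF// tail_scale_gt0// divr_gt0// sqrtr_gt0.
    move: (tail_scale _) t0 (Psi _) => x x0 y; rewrite !invfM.
    have alg (z D : R) : D != 0 -> x * z * (D^-1 * (x^-1 * y^-1)) = z * (D^-1 * y^-1) 
      by move=> D0; move: (y^-1) => y'; field; rewrite ?x0 ?D0.
    by rewrite alg ?gt_eqF.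
  near=> u; rewrite -/(exc u) addrC subrK.
  have P0 : D1 * Psi (u / Num.sqrt s2) != 0.
    apply: mulf_neq0; first by rewrite gt_eqF.
    (* For large u the product is close to 1, hence [Psi] is nonzero and the division defining the
       remainder is legitimate. *)
    have : `|1 - tail_scale (u / Num.sqrt s2) * Psi (u / Num.sqrt s2)| <= 1 / 2.
      by near: u; move/cvgrPdist_le: L2; apply.
    by move=> h; apply/eqP => e; move: h; rewrite e mulr0 subr0 normr1; lra.
  by rewrite mulrC divfK.
Unshelve. all: by end_near. Qed.
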